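(* Let $\beta>0$. Let $\mathcal H,\mathcal Y$ be Hilbert spaces and let $T\in\mathcal L(\mathcal H)$ be such that $T^*\in\mathcal L(\mathcal H)$ is a $\gamma$-hypercontraction for some $\gamma>1$. Let $F\in\mathcal L(\mathcal H,\mathcal Y)$. Then the following are equivalent: 1. $F$ is a $\beta$-admissible observation operator for $T$. 2. $\displaystyle\sup_{z\in\mathbb D}(1-|z|^2)^{\frac{1+\beta}{2}}\,\|F(I-\bar zT)^{-\beta-1}\|_{\mathcal L(\mathcal H,\mathcal Y)}<\infty.$
   Context: $\mathbb D$ is the open unit disc. For $R\in\mathcal L(\mathcal H)$ define $M_R:\mathcal L(\mathcal H)\to\mathcal L(\mathcal H)$ by $M_R(X)=R^*XR$; let $\mathbf 1$ be the identity operator on $\mathcal L(\mathcal H)$ and $I$ the identity on $\mathcal H$. For $\gamma\ge1$, an operator $R\in\mathcal L(\mathcal H)$ with $\|R\|\le1$ is a $\gamma$-hypercontraction if for each $0<r<1$, $(\mathbf 1-M_{rR})^{\gamma}(I)\ge0$, where the power is defined by the holomorphic functional calculus (principal branch), the spectrum of $\mathbf 1-M_{rR}$ lying in the open right half-plane. The powers $(I-\bar zT)^{-\beta-1}$ are likewise defined by the holomorphic functional calculus. $F$ is a $\beta$-admissible observation operator for $T$ if there exists $M>0$ such that $\sum_{n=0}^\infty(1+n)^\beta\|FT^nx\|^2\le M\|x\|^2$ for every $x\in\mathcal H$. *)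

(* Defs.v *)
From HB Require Import structures.
From mathcomp Require Import all_boot all_order all_algebra sesquilinear.
From mathcomp Require Import all_classical all_reals all_analysis.
From mathcomp Require Export complex.
Export numFieldNormedType.Exports.

Set Implicit Arguments.
Unset Strict Implicit.
Unset Printing Implicit Defensive.

Import Order.TTheory GRing.Theory Num.Theory.

Local Open Scope classical_set_scope.
Local Open Scope ring_scope.
Local Open Scope complex_scope.

(* The inner product is linear in its first argument. *)
HB.mixin Record isHilbert (R : realType) H & CompleteNormedModule R[i] H := {
  inner : {dot H for Num.conj};
  inner_norm : forall x : H, inner x x = `|x| ^+ 2
}.

#[short(type="hilbertType")]
HB.structure Definition Hilbert (R : realType) :=
  {H of CompleteNormedModule R[i] H & isHilbert R H}.

Section RealNorm.
Variables (R : realType).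

(* In a [normedModType R[i]] the norm takes its values in [R[i]]; [nrm] is the
   same norm with values in [R]. *)
Definition nrm (V : normedZmodType R[i]) (x : V) : R := complex.Re `|x|.

Lemma nrmE (V : normedZmodType R[i]) (x : V) : `|x| = (nrm x)%:C.
Proof. by rewrite /nrm RRe_real// ger0_real. Qed.

Lemma nrm_ge0 (V : normedZmodType R[i]) (x : V) : 0 <= nrm x.
Proof. by have := normr_ge0 x; rewrite nrmE ler0c. Qed.

Lemma nrm0 (V : normedZmodType R[i]) : nrm (0 : V) = 0.
Proof. by rewrite /nrm normr0. Qed.

Lemma nrm0_eq0 (V : normedZmodType R[i]) (x : V) : nrm x = 0 -> x = 0.
Proof. by move=> x0; apply/eqP; rewrite -normr_eq0 nrmE x0. Qed.

Lemma nrmD (V : normedZmodType R[i]) (x y : V) : nrm (x + y) <= nrm x + nrm y.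
Proof. by rewrite -lecR rmorphD/= -!nrmE; exact: ler_normD. Qed.

Lemma nrmZ (V : normedModType R[i]) (a : R[i]) (x : V) :
  nrm (a *: x) = nrm a * nrm x.
Proof.
by apply: (@complexI R); rewrite rmorphM/= -!nrmE normrZ.
Qed.

End RealNorm.

Section BoundedOperators.
Variables (R : realType) (V W : normedModType R[i]).

Definition bounded_linear (f : V -> W) : Prop :=
  linear f /\ exists M : R, forall x, nrm (f x) <= M * nrm x.

Definition bop_pred : {pred (V -> W)} := fun f => `[< bounded_linear f >].

(* The space L(V, W) of bounded operators. *)
Record bop := Bop { bop_fun :> V -> W; bopP : bop_fun \in bop_pred }.

HB.instance Definition _ := [isSub for bop_fun].
HB.instance Definition _ := [Choice of bop by <:].

Lemma bop_submod : submod_closed bop_pred.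
Proof.
split.
  apply/asboolP; split; first by move=> a x y; rewrite /= scaler0 addr0.
  by exists 0 => x; rewrite mul0r nrm0.
move=> a f g /asboolP[lf [M hM]] /asboolP[lg [N hN]].
apply/asboolP; split.
  move=> b x y; rewrite !fctE lf lg !scalerDr !scalerA (mulrC a b).
  by rewrite -!addrA; congr (_ + _); rewrite addrCA.
exists (nrm a * M + N) => x; rewrite !fctE.
rewrite (le_trans (nrmD _ _))// nrmZ mulrDl -mulrA lerD//.
by rewrite ler_wpM2l// nrm_ge0.
Qed.

HB.instance Definition _ := GRing.isSubmodClosed.Build _ _ bop_pred
  bop_submod.
HB.instance Definition _ := [SubChoice_isSubLmodule of bop by <:].

Lemma bopE (A B : bop) : A =1 B -> A = B.
Proof. by move=> AB; apply/val_inj/funext. Qed.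

Lemma bop_linear (A : bop) : linear A.
Proof. by have /asboolP[] := bopP A. Qed.

HB.instance Definition _ (A : bop) :=
  GRing.isLinear.Build R[i] V W *:%R (bop_fun A) (bop_linear A).

Lemma bop_bounded (A : bop) : exists M : R, forall x, nrm (A x) <= M * nrm x.
Proof. by have /asboolP[] := bopP A. Qed.

Definition opnorm (A : bop) : R := sup [set nrm (A x) | x in [set x | nrm x <= 1]].

Lemma opnorm_has_sup (A : bop) :
  has_sup [set nrm (A x) | x in [set x | nrm x <= 1]].
Proof.
split; first by exists (nrm (A 0)), 0 => //=; rewrite nrm0 ler01.
have [M hM] := bop_bounded A; exists (Num.max M 0) => _ [x /= x1 <-].
rewrite (le_trans (hM x))// (@le_trans _ _ (Num.max M 0 * nrm x))//.
  by rewrite ler_wpM2r ?nrm_ge0// le_max lexx.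
by rewrite ler_piMr// le_max lexx orbT.
Qed.

Lemma opnorm_ge0 (A : bop) : 0 <= opnorm A.
Proof.
apply: (le_trans (nrm_ge0 (A 0))); apply: ub_le_sup.
  by case: (opnorm_has_sup A).
by exists 0 => //=; rewrite nrm0 ler01.
Qed.

Lemma le_opnorm (A : bop) x : nrm (A x) <= opnorm A * nrm x.
Proof.
have [->|x0] := eqVneq x 0; first by rewrite linear0 !nrm0 mulr0.
have nx0 : 0 < nrm x.
  by rewrite lt_neqAle nrm_ge0 andbT eq_sym; apply: contra x0 => /eqP/nrm0_eq0/eqP.
rewrite -ler_pdivrMr//; have nV : nrm ((nrm x)^-1%:C) = (nrm x)^-1.
  by rewrite /nrm ger0_norm//= ler0c invr_ge0 nrm_ge0.
apply: ub_le_sup; first by case: (opnorm_has_sup A).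
exists ((nrm x)^-1%:C *: x) => /=; first by rewrite nrmZ nV mulVf// gt_eqF.
by rewrite linearZ/= nrmZ nV mulrC.
Qed.

Lemma opnorm_le (A : bop) (M : R) : 0 <= M ->
  (forall x, nrm (A x) <= M * nrm x) -> opnorm A <= M.
Proof.
move=> M0 hM; apply: ge_sup; first by case: (opnorm_has_sup A).
by move=> _ [x /= x1 <-]; rewrite (le_trans (hM x))// ler_piMr.
Qed.

Lemma opnormD (A B : bop) :
  (opnorm (A + B))%:C <= (opnorm A)%:C + (opnorm B)%:C.
Proof.
rewrite -rmorphD/= lecR; apply: opnorm_le.
  by rewrite addr_ge0// opnorm_ge0.
move=> x; rewrite (_ : (A + B) x = A x + B x)//.
by rewrite (le_trans (nrmD _ _))// mulrDl lerD// le_opnorm.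
Qed.

Lemma opnormZ_le (a : R[i]) (A : bop) : opnorm (a *: A) <= nrm a * opnorm A.
Proof.
apply: opnorm_le; first by rewrite mulr_ge0 ?nrm_ge0 ?opnorm_ge0.
move=> x; rewrite (_ : (a *: A) x = a *: A x)// nrmZ -mulrA.
by rewrite ler_wpM2l ?nrm_ge0// le_opnorm.
Qed.

Lemma opnormZ (a : R[i]) (A : bop) :
  (opnorm (a *: A))%:C = `|a| * (opnorm A)%:C.
Proof.
rewrite (nrmE a) -rmorphM/=; congr (_%:C); apply/eqP.
rewrite eq_le opnormZ_le/=.
have [->|a0] := eqVneq a 0; first by rewrite nrm0 mul0r opnorm_ge0.
have na0 : 0 < nrm a.
  by rewrite lt_neqAle nrm_ge0 andbT eq_sym; apply: contra a0 => /eqP/nrm0_eq0/eqP.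
rewrite mulrC -ler_pdivlMr// -{1}(scale1r A) -(mulVf a0) -scalerA.
rewrite (le_trans (opnormZ_le _ _))// mulrC ler_wpM2l ?opnorm_ge0//.
by rewrite -(ler_pM2r na0) mulVf ?gt_eqF// -lecR rmorphM/= -!nrmE -normrM mulVf// normr1.
Qed.

Lemma opnorm0_eq0 (A : bop) : (opnorm A)%:C = 0 -> A = 0.
Proof.
move=> /(@complexI R) A0; apply: bopE => x; apply: nrm0_eq0; apply/eqP.
by rewrite eq_le nrm_ge0 andbT (le_trans (le_opnorm _ _))// A0 mul0r.
Qed.

HB.instance Definition _ := Lmodule_isNormed.Build R[i] bop
  opnormD opnormZ opnorm0_eq0.

Lemma nrm_bop (A : bop) : nrm A = opnorm A.
Proof. by []. Qed.

End BoundedOperators.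

Section OperatorAlgebra.
Variable (R : realType).

Lemma bid_subproof (V : normedModType R[i]) : idfun \in @bop_pred R V V.
Proof. by apply/asboolP; split => //; exists 1 => x; rewrite mul1r. Qed.

Definition bid (V : normedModType R[i]) : bop V V := Bop (bid_subproof V).

Lemma bcomp_subproof (U V W : normedModType R[i]) (B : bop V W) (A : bop U V) :
  B \o A \in @bop_pred R U W.
Proof.
apply/asboolP; split; first by move=> a x y; rewrite /= !linearP.
exists (opnorm B * opnorm A) => x; rewrite (le_trans (le_opnorm _ _))// -mulrA.
by rewrite ler_wpM2l ?opnorm_ge0// le_opnorm.
Qed.

Definition bcomp (U V W : normedModType R[i]) (B : bop V W) (A : bop U V) :
  bop U W := Bop (bcomp_subproof B A).

Definition spectrum (V : normedModType R[i]) (A : bop V V) : set R[i] :=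
  [set l | ~ exists B, bcomp B (l *: bid V - A) = bid V /\
                       bcomp (l *: bid V - A) B = bid V].

(* (l - A)^-1, for l outside the spectrum of A; 0 otherwise. *)
Definition resolvent (V : normedModType R[i]) (A : bop V V) (l : R[i]) :
    bop V V :=
  xget 0 [set B | bcomp B (l *: bid V - A) = bid V /\
                  bcomp (l *: bid V - A) B = bid V].

End OperatorAlgebra.

Section FunctionalCalculus.
Variable (R : realType).

Definition cis (t : R) : R[i] := cos t +i* sin t.

Definition integralC (a b : R) (g : R -> R[i]) : R[i] :=
  (\int[lebesgue_measure]_(t in `[a, b]) complex.Re (g t)) +i*
  (\int[lebesgue_measure]_(t in `[a, b]) complex.Im (g t)).

(* The contour integral of g along the positively oriented circle of centre c
   and radius rho. *)
Definition circle_integral (c : R[i]) (rho : R) (g : R[i] -> R[i]) : R[i] :=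
  integralC 0 (2 * pi)
    (fun t => g (c + rho%:C * cis t) * ('i * rho%:C * cis t)).

Definition right_half_plane : set R[i] := [set l | 0 < complex.Re l].

(* The principal branch; this formula, with arg l = atan (Im l / Re l), is only
   meaningful for l in the right half-plane. *)
Definition cpow (l : R[i]) (a : R) : R[i] :=
  (nrm l `^ a)%:C * cis (a * atan (complex.Im l / complex.Re l)).

(* Riesz-Dunford calculus for a function f holomorphic on the right half-plane:
     B = (2 i pi)^-1 \oint f(l) (l - A)^-1 dl,
   where the contour lies in the right half-plane and winds once around the
   spectrum of A. Circles suffice, since every compact subset of the right
   half-plane lies inside some circle contained in it, and by Cauchy's theorem
   B does not depend on the circle. The L(V)-valued integral is the weak
   (Pettis) one, tested against all continuous linear functionals on L(V). *)
Definition is_funcalc (V : normedModType R[i]) (f : R[i] -> R[i])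
    (A B : bop V V) : Prop :=
  exists (c : R[i]) (rho : R),
    [/\ 0 < rho,
        [set l | nrm (l - c) <= rho] `<=` right_half_plane,
        spectrum A `<=` [set l | nrm (l - c) < rho] &
        forall phi : bop (bop V V) R[i]^o,
          phi B = (2 * 'i * pi%:C)^-1 *
                  circle_integral c rho (fun l => f l * phi (resolvent A l))].

Definition funcalc (V : normedModType R[i]) (f : R[i] -> R[i]) (A : bop V V) :
  bop V V := xget 0 [set B | is_funcalc f A B].

Definition opow (V : normedModType R[i]) (A : bop V V) (a : R) : bop V V :=
  funcalc (fun l => cpow l a) A.

End FunctionalCalculus.

Section HilbertOperators.
Variable (R : realType).

(* Existence is the Riesz representation theorem. *)
Definition adjoint (H Y : hilbertType R) (A : bop H Y) : bop Y H :=
  xget 0 [set B : bop Y H | forall x y, inner (A x) y = inner x (B y)].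

Definition positive_op (H : hilbertType R) (A : bop H H) : Prop :=
  forall x, 0 <= inner (A x) x.

Lemma Mop_subproof (H : hilbertType R) (S : bop H H) :
  (fun X : bop H H => bcomp (adjoint S) (bcomp X S))
    \in @bop_pred R (bop H H) (bop H H).
Proof.
apply/asboolP; split.
  by move=> a X Y; apply: bopE => x; exact: (linearP (adjoint S)).
exists (opnorm (adjoint S) * opnorm S) => X; rewrite !nrm_bop.
apply: opnorm_le; first by rewrite !mulr_ge0 ?opnorm_ge0.
move=> x /=; rewrite (le_trans (le_opnorm _ _))// -!mulrA.
rewrite ler_wpM2l ?opnorm_ge0// (le_trans (le_opnorm _ _))//.
by rewrite mulrCA ler_wpM2l ?opnorm_ge0// le_opnorm.
Qed.

(* X |-> S^* X S *)
Definition Mop (H : hilbertType R) (S : bop H H) :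
  bop (bop H H) (bop H H) := Bop (Mop_subproof S).

Definition hypercontraction (H : hilbertType R) (gamma : R) (S : bop H H) :
    Prop :=
  nrm S <= 1 /\
  forall r : R, 0 < r < 1 ->
    positive_op (opow (bid (bop H H) - Mop (r%:C *: S)) gamma (bid H)).

Definition admissible (H Y : hilbertType R) (beta : R) (F : bop H Y)
    (T : bop H H) : Prop :=
  exists2 M : R, 0 < M & forall x : H,
    (\sum_(0 <= n <oo)
       ((1 + n%:R) `^ beta * nrm (F (iter n T x)) ^+ 2)%:E
     <= (M * nrm x ^+ 2)%:E)%E.

End HilbertOperators.

(* Main.v *)
Require Import Defs.
From HB Require Import structures.
From mathcomp Require Import all_boot all_order all_algebra sesquilinear.
From mathcomp Require Import all_classical all_reals all_analysis.
From mathcomp Require Import complex.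
From mathcomp Require Import ring lra.

(** The idea is that of a reproducing kernel thesis for a Hankel operator between
    two weighted Bergman spaces, where boundedness follows from the size of the
    symbol alone.

    All powers are first turned into binomial series: if |N| < 1 then (1 - N)^a is
    the sum of the nbin (- a) n N^n ([opow_binseries]). The contour integral may be
    moved to a circle centred at 1, because circles around the spectrum deform into
    each other ([circle_homotopy], [circle_integral_indep]); there the resolvent is
    a geometric series and the Fourier coefficients of l^a are known
    ([cpow_fourierE]).

    If F is admissible, the n-th coefficient of F (1 - conj(z) T)^(- beta - 1) x is
    of order (1 + n)^beta |F T^n x| and the Cauchy-Schwarz inequality gives the
    resolvent bound ([admissible_resolvent_bound]).

    Conversely, let r < 1, let S be r times the adjoint of T, F' the adjoint of F,
    and D = (1 - M_S)^gamma (I), which is nonnegative by hypercontractivity; write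
    [u, v] for the form of D. As (1 - M_S)^(- gamma) undoes the power,

      <x, y> = sum_k nbin gamma k [S^k x, S^k y]          ([defect_sum]),

    so that the sum over n of the <x, S^n F' g_n> becomes the Hankel form
    sum_(n,k) nbin gamma k [S^k x, S^(n+k) F' g_n]. Put a = gamma + beta + 1. The
    moments of (1 - t)^(a - 2) are, up to a constant, the reciprocals of the nbin a m,
    hence the Hankel form is a multiple of the integral over the disc of

      [f(z), (1 - z S)^(- a) F' g(conj z)] (1 - |z|^2)^(a - 2),

    with f(z) = (1 - z S)^(- gamma) x and g(z) = sum_n g_n z^n. In the defect form the
    factor (1 - z S)^(- gamma) of the kernel costs only (1 - |z|^2)^(- gamma / 2)
    ([dform_binseries_le]) and the remaining factor (1 - z S)^(- beta - 1) F' is the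
    adjoint of the operator of the resolvent bound, so the kernel has size
    (1 - |z|^2)^(- a / 2). The Cauchy-Schwarz inequality then separates the integral
    into the norms of f and g with weights (1 - |z|^2)^(gamma - 2) and
    (1 - |z|^2)^(beta - 1), whose squares are at most constant multiples of |x|^2
    and of the sum of the |g_n|^2 / nbin (beta + 1) n ([hankel_le]). Testing with
    g_n = nbin (beta + 1) n F (r T)^n x bounds the weighted sum of the
    |F (r T)^n x|^2 uniformly in r ([weighted_sum_bound]), and r tends to 1.

    The integral over the disc is never formed: averages over roots of unity take
    the place of the angular variable, and in the radial variable inequalities
    between derivatives are compared through explicit incomplete beta functions. *)

Set Implicit Arguments.
Unset Strict Implicit.
Unset Printing Implicit Defensive.

Import Order.TTheory GRing.Theory Num.Theory.

Local Open Scope classical_set_scope.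
Local Open Scope ring_scope.
Local Open Scope complex_scope.

(** * Differentiation of real functions *)

Section RealDerivatives.
Variable R : realType.
Implicit Types (f g : R -> R) (x a b : R).

(** The rules below are stated for [fun y => f y + g y] and the like, the form in
    which derivatives of explicit expressions are met. *)
Lemma is_derive1D f g x a b : is_derive x 1 f a -> is_derive x 1 g b ->
  is_derive x 1 (fun y => f y + g y) (a + b).
Proof. by move=> df dg; exact: is_deriveD. Qed.

Lemma is_derive1B f g x a b : is_derive x 1 f a -> is_derive x 1 g b ->
  is_derive x 1 (fun y => f y - g y) (a - b).
Proof. by move=> df dg; exact: is_deriveB. Qed.

Lemma is_derive1N f x a : is_derive x 1 f a -> is_derive x 1 (fun y => - f y) (- a).
Proof. by move=> df; exact: is_deriveN. Qed.

Lemma is_derive1M f g x a b : is_derive x 1 f a -> is_derive x 1 g b ->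
  is_derive x 1 (fun y => f y * g y) (a * g x + f x * b).
Proof.
move=> df dg; have := @is_deriveM _ _ f g x 1 a b df dg.
by rewrite /GRing.scale/= addrC (mulrC (g x)).
Qed.

Lemma is_derive1Z f (k x a : R) : is_derive x 1 f a ->
  is_derive x 1 (fun y => k * f y) (k * a).
Proof. by move=> df; exact: is_deriveZ. Qed.

Lemma is_derive1_cst (k x : R) : is_derive x 1 (fun=> k) 0.
Proof. exact: is_derive_cst. Qed.

Lemma is_derive1_id x : is_derive x 1 (fun y : R => y) 1.
Proof. exact: is_derive_id. Qed.

Lemma is_derive1X x n : is_derive x 1 (fun y : R => y ^+ n) (n%:R * x ^+ n.-1).
Proof.
have := @is_deriveX _ _ (fun y : R => y) n x 1 1 (is_derive1_id x).
by rewrite exprfctE /GRing.scale/= mulr1.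
Qed.

Lemma is_derive1_fcomp f g x a b : is_derive (g x) 1 f a -> is_derive x 1 g b ->
  is_derive x 1 (fun y => f (g y)) (a * b).
Proof. by move=> df dg; exact: is_derive1_comp. Qed.

Lemma is_derive1_sum (I : eqType) (r : seq I) (f : I -> R -> R) (f' : I -> R) x :
  (forall i, is_derive x 1 (f i) (f' i)) ->
  is_derive x 1 (fun y => \sum_(i <- r) f i y) (\sum_(i <- r) f' i).
Proof.
move=> df; elim: r => [|i r IH].
  rewrite big_nil; under eq_fun do rewrite big_nil; exact: is_derive1_cst.
by rewrite big_cons; under eq_fun do rewrite big_cons; exact: is_derive1D.
Qed.

Lemma is_derive1_continuous f x a : is_derive x 1 f a -> {for x, continuous f}.
Proof. by move=> df; apply/differentiable_continuous/derivable1_diffP. Qed.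

Lemma is_derive1_powR_1B x p : x < 1 ->
  is_derive x 1 (fun y => (1 - y) `^ p) (- (p * (1 - x) `^ (p - 1))).
Proof.
move=> x1.
have d1 : is_derive x 1 (fun y => 1 - y) (0 - 1).
  exact: (@is_derive1B (fun=> 1) (fun y => y) x 0 1 (is_derive1_cst _ _) (is_derive1_id _)).
have d2 : is_derive (1 - x) 1 (fun y => y `^ p) (p * (1 - x) `^ (p - 1)).
  by apply: is_derive1_powR; rewrite subr_gt0.
have := @is_derive1_fcomp (fun y => y `^ p) (fun y => 1 - y) x _ _ d2 d1.
by rewrite sub0r mulrN1.
Qed.

Lemma is_derive1_nincr f (f' : R -> R) (a b : R) : a <= b ->
  (forall x, a < x < b -> is_derive x 1 f (f' x)) ->
  (forall x, a < x < b -> f' x <= 0) ->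
  {within `[a, b], continuous f} -> f b <= f a.
Proof.
move=> ab df f'0 cf.
apply: (@ler0_derive1_le_cc _ f a b) => //; rewrite ?in_itv/= ?lexx ?ab//.
- by move=> x; rewrite in_itv/= => /df d.
- by move=> x; rewrite in_itv/= => xab; have d := df _ xab; rewrite derive1E derive_val f'0.
Qed.

End RealDerivatives.

(** * Coefficients of the binomial series *)

Section NegativeBinomial.
Variable R : realType.
Implicit Types (a b x : R) (n k : nat).

(** The coefficient of x^n in the expansion of (1 - x)^(- a). *)
Definition nbin a n : R := \prod_(j < n) ((a + j%:R) / j.+1%:R).

Lemma nbin_0 a : nbin a 0 = 1. Proof. by rewrite /nbin big_ord0. Qed.

Lemma nbinS a n : nbin a n.+1 = nbin a n * ((a + n%:R) / n.+1%:R).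
Proof. by rewrite /nbin big_ord_recr. Qed.

Lemma nbinS_mul a n : n.+1%:R * nbin a n.+1 = (a + n%:R) * nbin a n.
Proof. by rewrite nbinS; field; rewrite addrC natr1 pnatr_eq0. Qed.

Lemma nbin0E n : nbin 0 n = (n == 0%N)%:R.
Proof.
case: n => [|n]; first by rewrite nbin_0.
by rewrite /nbin big_ord_recl/= add0r mul0r mul0r.
Qed.

Lemma nbin_ge0 a n : 0 <= a -> 0 <= nbin a n.
Proof. by move=> a0; apply: prodr_ge0 => j _; rewrite divr_ge0// addr_ge0. Qed.

Lemma nbin_gt0 a n : 0 < a -> 0 < nbin a n.
Proof. by move=> a0; apply: prodr_gt0 => j _; rewrite divr_gt0// ltr_pwDl. Qed.

Lemma ler_norm_nbin a n : `|nbin a n| <= nbin `|a| n.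
Proof.
elim: n => [|n IH]; first by rewrite !nbin_0 normr1.
rewrite !nbinS normrM ler_pM// normrM (ger0_norm (_ : 0 <= n.+1%:R^-1)) ?invr_ge0//.
by rewrite ler_wpM2r ?invr_ge0// (le_trans (ler_normD _ _))// (ger0_norm (ler0n _ _)).
Qed.

(** Vandermonde's identity, (1 - x)^(- a) (1 - x)^(- b) = (1 - x)^(- (a + b)). The
    recurrence [nbinS_mul] is the differential equation of (1 - x)^(- a), and
    splitting the factor n.+1 as k + (n.+1 - k) is Leibniz' rule. *)
Lemma nbin_conv a b n :
  \sum_(k < n.+1) nbin a k * nbin b (n - k) = nbin (a + b) n.
Proof.
elim: n => [|n IH]; first by rewrite big_ord_recl big_ord0 !nbin_0 mulr1 addr0.
have n1 : n.+1%:R != 0 :> R by rewrite pnatr_eq0.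
apply: (mulfI n1); rewrite nbinS_mul -IH !mulr_sumr.
transitivity (\sum_(k < n.+2) k%:R * nbin a k * nbin b (n.+1 - k)
     + \sum_(k < n.+2) nbin a k * ((n.+1 - k)%:R * nbin b (n.+1 - k))).
  rewrite -big_split/=; apply: eq_bigr => k _.
  have -> : n.+1%:R = k%:R + (n.+1 - k)%:R :> R.
    by rewrite -natrD subnKC// -ltnS.
  by ring.
rewrite big_ord_recl/= !mul0r add0r [X in _ + X]big_ord_recr/= subnn mul0r mulr0.
rewrite addr0 -big_split/=; apply: eq_bigr => k _.
rewrite /bump/= add1n subSS nbinS_mul subSn ?nbinS_mul; last by rewrite -ltnS.
rewrite (_ : n%:R = k%:R + (n - k)%:R :> R); last by rewrite -natrD subnKC// -ltnS.
by ring.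
Qed.

(** Times (1 - x)^a, the partial sum decreases from 1: by the differential equation
    its derivative reduces to a single term, which is nonpositive. *)
Lemma nbin_psum_le a x n : 0 <= a -> 0 <= x < 1 ->
  \sum_(k < n) nbin a k * x ^+ k <= (1 - x) `^ (- a).
Proof.
move=> a0 /andP[x0 x1].
rewrite powRN -div1r ler_pdivlMr ?powR_gt0 ?subr_gt0//.
pose s (y : R) := \sum_(k < n) nbin a k * y ^+ k.
pose s' (y : R) := \sum_(k < n) nbin a k * (k%:R * y ^+ k.-1).
have ds (y : R) : is_derive y 1 s (s' y).
  by apply: is_derive1_sum => k; apply: is_derive1Z; exact: is_derive1X.
pose u (y : R) := s y * (1 - y) `^ a.
have du (y : R) : y < 1 -> is_derive y 1 u
    (s' y * (1 - y) `^ a + s y * - (a * (1 - y) `^ (a - 1))).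
  by move=> y1; apply: is_derive1M => //; exact: is_derive1_powR_1B.
have s1 (y : R) : (1 - y) * s' y - a * s y = - (n%:R * nbin a n * y ^+ n.-1).
  rewrite /s /s'; elim: n {s s' ds u du} => [|n IH].
    by rewrite !big_ord0 !mul0r; ring.
  rewrite !big_ord_recr/= nbinS_mul.
  transitivity (- (n%:R * nbin a n * y ^+ n.-1) +
     nbin a n * ((1 - y) * (n%:R * y ^+ n.-1) - a * y ^+ n)).
    by rewrite -IH; ring.
  by case: n {IH} => [|n] /=; rewrite ?exprS; ring.
have u0 : u 0 <= 1.
  rewrite /u /s subr0 powR1 mulr1; case: n {s s' ds u du s1} => [|n].
    by rewrite big_ord0.
  rewrite big_ord_recl/= big1 ?addr0 ?nbin_0 ?mulr1// => i _.
  by rewrite expr0n/= mulr0.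
apply: le_trans u0; apply: (@is_derive1_nincr _ u (fun y =>
   s' y * (1 - y) `^ a + s y * - (a * (1 - y) `^ (a - 1)))) => //.
- by move=> y /andP[_ yx]; apply: du; exact: lt_trans x1.
- move=> y /andP[y0 yx] /=; have y1 : 0 < 1 - y by rewrite subr_gt0 (lt_trans yx).
  have -> : (1 - y) `^ a = (1 - y) * (1 - y) `^ (a - 1).
    rewrite -{2}(powRr1 (ltW y1)) -powRD; last by rewrite (gt_eqF y1) implybT.
    by congr (_ `^ _); ring.

  move: (s1 y); set P := _ `^ _ => s1y.
  have -> : s' y * ((1 - y) * P) + s y * - (a * P) = ((1 - y) * s' y - a * s y) * P.
    by move: (s y) (s' y) P => u1 u2 u3; ring.
  rewrite s1y mulNr oppr_le0 !mulr_ge0 ?powR_ge0 ?nbin_ge0 ?exprn_ge0//; exact: ltW.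
- apply: continuous_in_subspaceT => y; rewrite inE/= in_itv/= => /andP[_ yx].
  apply: is_derive1_continuous; apply: du; exact: le_lt_trans x1.
Qed.

(** One index serves for all n, so that series of operators of norm at most q
    converge uniformly. *)
Lemma nbin_tail a (q e : R) : 0 <= q < 1 -> 0 < e ->
  exists m0 : nat, forall m n, (m0 <= m)%N ->
    \sum_(m <= k < n) `|nbin a k| * q ^+ k <= e.
Proof.
move=> q01 e0; have /andP[q0 q1] := q01.
pose w k := nbin `|a| k * q ^+ k.
have w0 k : 0 <= w k by rewrite mulr_ge0 ?nbin_ge0 ?exprn_ge0.
have nw : nondecreasing_seq (series w).
  by apply/nondecreasing_seqP => n; rewrite !seriesEnat/= big_nat_recr//= lerDl.
have cw : cvgn (series w).
  apply: nondecreasing_is_cvgn => //.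
  exists ((1 - q) `^ (- `|a|)) => _ [n _ <-].
  by rewrite seriesEord/=; exact: nbin_psum_le.
have /cvgrPdist_lt/(_ _ e0) [m0 _ hm0] := cw.
exists m0 => m n m0m.
have [nm|mn] := leqP n m; first by rewrite big_geq// ltW.
apply: (@le_trans _ _ (\sum_(m <= k < n) w k)).
  by apply: ler_sum_nat => k _; rewrite ler_wpM2r ?exprn_ge0 ?ler_norm_nbin.
have -> : \sum_(m <= k < n) w k = series w n - series w m.
  by rewrite sub_series_geq// ltnW.
apply: le_trans (ltW (hm0 m m0m)); apply: le_trans (ler_norm _).
by rewrite lerD2r; exact: nondecreasing_cvgn_le.
Qed.

Lemma powR_expR (y b : R) : 0 < y -> y `^ b = expR (b * ln y).
Proof. by move=> y0; rewrite /powR gt_eqF. Qed.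

Lemma powR1D_le_expR (y b : R) : 0 <= b -> 0 <= y ->
  (1 + y) `^ b <= expR (b * y).
Proof.
move=> b0 y0; rewrite powR_expR ?ltr_pwDl// ler_expR ler_wpM2l// le_ln1Dx//.
exact: lt_le_trans y0.
Qed.

Lemma expR_le_powR1B (x b : R) : 0 <= b -> x < 1 ->
  expR (b * x) <= (1 - x) `^ (- b).
Proof.
move=> b0 x1; rewrite powR_expR ?subr_gt0// ler_expR mulNr -mulrN ler_wpM2l//.
by rewrite lerNr le_ln1Dx// ltrN2.
Qed.

(** The coefficients grow like n^b. In both directions one factor 1 + b / n is
    compared with ((n + 1) / n)^b through 1 + x <= exp x; the shift by b makes the
    comparison from below valid factor by factor. *)
Lemma nbin_lower b n : 0 < b ->
  ((n.+1%:R + b) / (1 + b)) `^ b <= nbin (b + 1) n.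
Proof.
move=> b0; have b1 : 0 < 1 + b by rewrite addr_gt0.
elim: n => [|n IH]; first by rewrite nbin_0 divff ?gt_eqF// powR1.
rewrite nbinS -(natr1 n.+1); move: IH.
have -> : b + 1 + n%:R = n.+1%:R + b by rewrite -(natr1 n); ring.
have : 0 < n.+1%:R :> R by rewrite ltr0n.
move: (n.+1%:R : R) (nbin (b + 1) n) => y p y0 IH.
have n0 : 0 < y + b by rewrite addr_gt0.
have -> : (y + 1 + b) / (1 + b) = (y + b) / (1 + b) * (1 + (y + b)^-1).
  by field; rewrite !gt_eqF.
have V0 : 0 <= (y + b)^-1 by rewrite invr_ge0 ltW.
rewrite powRM; [|by rewrite divr_ge0// ltW|by rewrite addr_ge0].
apply: ler_pM; rewrite ?powR_ge0//.
apply: le_trans (powR1D_le_expR (ltW b0) V0) _.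
have e0 := expR_gt0 (- (b * (y + b)^-1)).
rewrite -[leLHS]invrK -expRN -[leRHS]invrK lef_pV2 ?posrE//; last first.
  by rewrite invr_gt0 divr_gt0.
apply: le_trans (expR_ge1Dx _).
by rewrite invf_div le_eqVlt; apply/orP; left; apply/eqP; field; rewrite gt_eqF.
Qed.

Lemma nbin_upper b n : 0 < b -> nbin (b + 1) n <= (1 + b) * (1 + n%:R) `^ b.
Proof.
move=> b0; have b1 : 0 < 1 + b by rewrite addr_gt0.
case: n => [|n].
  by rewrite nbin_0 addr0 powR1 mulr1 lerDl ltW.
have : nbin (b + 1) n.+1 <= (1 + b) * n.+1%:R `^ b.
  elim: n => [|n IH].
    by rewrite nbinS nbin_0 mul1r divr1 addr0 powR1 mulr1 addrC.
  rewrite nbinS -(natr1 n.+1); move: IH.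
  have : 0 < n.+1%:R :> R by rewrite ltr0n.
  have : 0 <= nbin (b + 1) n.+1 by rewrite nbin_ge0// addr_ge0// ltW.
  move: (n.+1%:R : R) (nbin (b + 1) n.+1) => y p p0 y0 IH.
  have y1 : 0 < y + 1 by rewrite addr_gt0.
  have -> : (y + 1) `^ b = y `^ b * (1 - (y + 1)^-1) `^ (- b).
    have -> : 1 - (y + 1)^-1 = y / (y + 1) by field; rewrite gt_eqF.
    rewrite powRN.
    have -> : (y / (y + 1)) `^ b = y `^ b / (y + 1) `^ b.
      rewrite powRM ?invr_ge0 ?(ltW y0) ?(ltW y1)//; congr (_ * _).
      by rewrite -(powR_inv1 (ltW y1)) -powRrM mulN1r powRN.
    by field; rewrite !gt_eqF// powR_gt0.
  have q0 : 0 <= (b + 1 + y) / (y + 1).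
    by rewrite divr_ge0// ltW// !addr_gt0.
  rewrite [leRHS]mulrA; apply: ler_pM => //.
  apply: le_trans (expR_le_powR1B (ltW b0) _); last first.
    by rewrite invf_lt1// ltrDr.
  apply: le_trans (expR_ge1Dx _).
  by rewrite le_eqVlt; apply/orP; left; apply/eqP; field; rewrite gt_eqF.
move=> h; apply: le_trans h _; rewrite ler_wpM2l ?(ltW b1)//.
by rewrite ge0_ler_powR ?nnegrE ?ltW ?ltrDr.
Qed.

End NegativeBinomial.

(** * Incomplete beta functions *)

Section IncompleteBeta.
Variable R : realType.
Implicit Types (b t : R) (m : nat).

(** The primitive of t^m (1 - t)^b that vanishes at 0; integration by parts lowers
    m. The closed form keeps a meaning at t = 1 whenever -1 < b, although the
    integrand may be unbounded there. *)
Fixpoint ibeta b m t : R :=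
  if m is k.+1 then (k.+1%:R * ibeta b k t - t ^+ k.+1 * (1 - t) `^ (b + 1))
                    / (k.+1%:R + b + 1)
  else (1 - (1 - t) `^ (b + 1)) / (b + 1).

Lemma ibeta0 b m : ibeta b m 0 = 0.
Proof.
elim: m => [|m IH] /=; first by rewrite subr0 powR1 subrr mul0r.
by rewrite IH mulr0 expr0n/= mul0r subrr mul0r.
Qed.

(** The moments of (1 - t)^b are reciprocals of binomial coefficients: this converts
    a power series with coefficients [nbin] into a weighted integral. *)
Lemma ibeta1 b m : -1 < b -> ibeta b m 1 = ((b + 1) * nbin (b + 2) m)^-1.
Proof.
move=> b1; have b0 : 0 < b + 1 by rewrite -ltrBlDr sub0r.
elim: m => [|m IH] /=.
  by rewrite nbin_0 subrr powR0 ?gt_eqF// subr0 mulr1 div1r.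
rewrite IH subrr powR0 ?gt_eqF// mulr0 subr0 nbinS.
have n0 : 0 < nbin (b + 2) m by rewrite nbin_gt0// (_ : 2 = 1 + 1)// addrA addr_gt0.
have k0 : 0 < b + 2 + m%:R.
  by rewrite ltr_wpDr// (_ : 2 = 1 + 1)// addrA addr_gt0.
have -> : m.+1%:R + b + 1 = b + 2 + m%:R by rewrite -natr1; ring.
have m0 : 0 < m.+1%:R :> R by rewrite ltr0n.
move: (m.+1%:R : R) m0 k0 n0 => y y0; move: (b + 2 + m%:R) (nbin _ _) => u v u0 v0.
by field; rewrite !gt_eqF.
Qed.

Lemma is_derive_ibeta b m t : -1 < b -> t < 1 ->
  is_derive t 1 (ibeta b m) (t ^+ m * (1 - t) `^ b).
Proof.
move=> b1 t1; have b0 : 0 < b + 1 by rewrite -ltrBlDr sub0r.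
have dp := @is_derive1_powR_1B R t (b + 1) t1; rewrite addrK in dp.
have t10 : 0 < 1 - t by rewrite subr_gt0.
have pS : (1 - t) `^ (b + 1) = (1 - t) `^ b * (1 - t).
  by rewrite powRD ?(gt_eqF t10) ?implybT// powRr1// ltW.
elim: m => [|m IH] /=.
  have := @is_derive1Z _ _ (b + 1)^-1 t _ (@is_derive1B _ (fun=> 1) _ t _ _ (is_derive1_cst 1 t) dp).
  rewrite sub0r opprK mulrA mulVf ?gt_eqF// expr0 => h.
  by under eq_fun do rewrite mulrC.
have := @is_derive1Z _ _ (m.+1%:R + b + 1)^-1 t _ (@is_derive1B _ _ _ t _ _
  (is_derive1Z m.+1%:R IH) (is_derive1M (@is_derive1X _ t m.+1) dp)).
rewrite pS /= exprS.
have -> : (m.+1%:R + b + 1)^-1 *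
   (m.+1%:R * (t ^+ m * (1 - t) `^ b) - (m.+1%:R * t ^+ m * ((1 - t) `^ b * (1 - t)) +
    t * t ^+ m * - ((b + 1) * (1 - t) `^ b))) = t * t ^+ m * (1 - t) `^ b.
  have k0 : 0 < m.+1%:R + b + 1 by rewrite -addrA ltr_wpDl.
  move: (m.+1%:R : R) k0 => y y0; move: (t ^+ m) ((1 - t) `^ b) => u v.
  by field; rewrite gt_eqF.
move=> h; under eq_fun do rewrite mulrC; exact: h.
Qed.

Lemma powR_1B_cvg0 (p : R) : 0 < p -> (1 - t) `^ p @[t --> 1^'-] --> (0 : R).
Proof.
move=> p0; apply/cvgrPdist_lt => e e0.
have d0 : 0 < e `^ p^-1 by rewrite powR_gt0.
near=> t.
have t1 : t < 1 by near: t; exact: nbhs_left_lt.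
have td : 1 - e `^ p^-1 < t.
  by near: t; apply: nbhs_left_gt; rewrite ltrBlDr ltrDl.
rewrite sub0r normrN ger0_norm ?powR_ge0//.
have -> : e = (e `^ p^-1) `^ p by rewrite -powRrM mulVf ?gt_eqF// powRr1// ltW.
by apply: gt0_ltr_powR; rewrite ?nnegrE ?subr_ge0 ?ltW// ltrBlDr addrC -ltrBlDr.
Unshelve. all: by end_near. Qed.

Lemma ibeta_cvg1 b m : -1 < b -> ibeta b m t @[t --> 1^'-] --> ibeta b m 1.
Proof.
move=> b1; have b0 : 0 < b + 1 by rewrite -ltrBlDr sub0r.
have c0 := powR_1B_cvg0 b0.
elim: m => [|m IH] /=.
  rewrite subrr powR0 ?gt_eqF//; apply: cvgM; last exact: cvg_cst.
  by apply: cvgB => //; exact: cvg_cst.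
rewrite subrr powR0 ?gt_eqF//; apply: cvgM; last exact: cvg_cst.
apply: cvgB; first by apply: cvgM => //; exact: cvg_cst.
apply: cvgM => //; apply: cvg_at_left_filter.
exact: exprn_continuous.
Qed.

(** Integration of f' <= g' over ]0, 1[. Only limits at 1 are required, because the
    derivatives may be unbounded there. *)
Lemma le_of_is_derive1 (f f' g g' : R -> R) (lf lg : R) :
  (forall t, t < 1 -> is_derive t 1 f (f' t)) ->
  (forall t, t < 1 -> is_derive t 1 g (g' t)) ->
  (forall t, 0 < t < 1 -> f' t <= g' t) -> f 0 = 0 -> g 0 = 0 ->
  f t @[t --> 1^'-] --> lf -> g t @[t --> 1^'-] --> lg -> lf <= lg.
Proof.
move=> df dg fg f0 g0 cf cg.
have dfg t : t < 1 -> is_derive t 1 (fun y => f y - g y) (f' t - g' t).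
  by move=> t1; apply: is_derive1B; [exact: df|exact: dg].
have le t : 0 < t < 1 -> f t <= g t.
  move=> /andP[t0 t1].
  rewrite -subr_le0 -[leRHS](subrr (f 0)) [in leRHS]f0 -{2}g0 -{1}f0.
  apply: (@is_derive1_nincr _ (fun y => f y - g y) (fun y => f' y - g' y)); first exact: ltW.
  - by move=> x /andP[x0 xt]; apply: dfg; exact: lt_trans t1.
  - by move=> x /andP[x0 xt]; rewrite subr_le0 fg// x0 (lt_trans xt).
  - apply: continuous_in_subspaceT => y; rewrite inE/= in_itv/= => /andP[_ yx].
    by apply: is_derive1_continuous; apply: dfg; exact: le_lt_trans t1.
apply: (ler_cvg_to cf cg).
near=> t; apply: le; apply/andP; split.
  by near: t; apply: nbhs_left_gt.
by near: t; exact: nbhs_left_lt.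
Unshelve. all: by end_near. Qed.

End IncompleteBeta.

(** * Norms, convergence and algebra of bounded operators *)

Section Norms.
Variable R : realType.

Lemma gt0c (x : R) : (0 < x%:C :> R[i]) = (0 < x).
Proof. exact: (ltcR 0 x). Qed.

Lemma nrmN (V : normedZmodType R[i]) (x : V) : nrm (- x) = nrm x.
Proof. by rewrite /nrm normrN. Qed.

Lemma nrmBC (V : normedZmodType R[i]) (x y : V) : nrm (x - y) = nrm (y - x).
Proof. by rewrite -nrmN opprB. Qed.

Lemma nrmB (V : normedZmodType R[i]) (x y : V) : nrm (x - y) <= nrm x + nrm y.
Proof. by rewrite -(nrmN y) nrmD. Qed.

Lemma nrm_tri (V : normedZmodType R[i]) (y x z : V) :
  nrm (x - z) <= nrm (x - y) + nrm (y - z).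
Proof. by apply: le_trans (nrmD _ _); rewrite addrA subrK. Qed.

Lemma nrm_sum (V : normedZmodType R[i]) (I : Type) (r : seq I) (P : pred I) (f : I -> V) :
  nrm (\sum_(i <- r | P i) f i) <= \sum_(i <- r | P i) nrm (f i).
Proof.
elim/big_ind2: _ => [|x a y b xa yb|//]; first by rewrite nrm0.
by rewrite (le_trans (nrmD _ _))// lerD.
Qed.

Lemma nrmM (a b : R[i]) : nrm (a * b) = nrm a * nrm b.
Proof. by apply: (@complexI R); rewrite rmorphM/= -!nrmE normrM. Qed.

Lemma nrmV (a : R[i]) : nrm a^-1 = (nrm a)^-1.
Proof. by apply: (@complexI R); rewrite -nrmE normfV nrmE fmorphV. Qed.

Lemma nrmX (a : R[i]) n : nrm (a ^+ n) = nrm a ^+ n.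
Proof. by apply: (@complexI R); rewrite rmorphXn/= -!nrmE normrX. Qed.

Lemma nrmR (x : R) : nrm (x%:C : R[i]) = `|x|.
Proof. by rewrite /nrm normc_def/= expr0n addr0 sqrtr_sqr. Qed.

Lemma nrm1 : nrm (1 : R[i]) = 1.
Proof. by rewrite /nrm normr1. Qed.

Lemma nrmi : nrm ('i : R[i]) = 1.
Proof. by rewrite /nrm normc_def/= expr0n add0r expr1n sqrtr1. Qed.

Lemma nrm_conj (z : R[i]) : nrm z^* = nrm z.
Proof. by rewrite /nrm norm_conjC. Qed.

Lemma nrm_sqr (z : R[i]) : nrm z ^+ 2 = complex.Re z ^+ 2 + complex.Im z ^+ 2.
Proof. by rewrite /nrm normc_def/= sqr_sqrtr// addr_ge0// sqr_ge0. Qed.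

Lemma Re_le_nrm (z : R[i]) : `|complex.Re z| <= nrm z.
Proof.
rewrite -(ler_pXn2r (ltn0Sn 1)) ?nnegrE ?nrm_ge0// nrm_sqr real_normK ?num_real//.
by rewrite lerDl sqr_ge0.
Qed.

Lemma Im_le_nrm (z : R[i]) : `|complex.Im z| <= nrm z.
Proof.
rewrite -(ler_pXn2r (ltn0Sn 1)) ?nnegrE ?nrm_ge0// nrm_sqr [X in X <= _]real_normK ?num_real//.
by rewrite lerDr sqr_ge0.
Qed.

Lemma nrm_le_ReIm (z : R[i]) : nrm z <= `|complex.Re z| + `|complex.Im z|.
Proof.
rewrite -(ler_pXn2r (ltn0Sn 1)) ?nnegrE ?nrm_ge0 ?addr_ge0// nrm_sqr.
by rewrite sqrrD !real_normK ?num_real// addrAC lerDl mulrn_wge0// mulr_ge0.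
Qed.

End Norms.

Section Convergence.
Variable R : realType.

(** Convergence in norm, with radii in [R] rather than in [R[i]]. *)
Definition nrm_cvg (V : normedModType R[i]) (u : nat -> V) (l : V) :=
  forall e : R, 0 < e -> exists N, forall n, (N <= n)%N -> nrm (u n - l) <= e.

Definition nrm_cauchy (V : normedModType R[i]) (u : nat -> V) :=
  forall e : R, 0 < e -> exists N, forall m n, (N <= m)%N -> (m <= n)%N ->
    nrm (u n - u m) <= e.

Definition nrm_complete (V : normedModType R[i]) :=
  forall u : nat -> V, nrm_cauchy u -> exists l, nrm_cvg u l.

Lemma nrm_complete_complete (V : completeNormedModType R[i]) : nrm_complete V.
Proof.
move=> u cu.
have : cvg (u @ \oo).
  apply/cauchy_cvgP/cauchy_ballP => e e0.
  have eE : e = (complex.Re e)%:C by rewrite RRe_real// gtr0_real.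
  have re0 : 0 < complex.Re e by rewrite -gt0c -eE.
  have [N hN] := cu (complex.Re e / 4) (divr_gt0 re0 (ltr0n _ 4)).
  have key m : (N <= m)%N -> nrm (u m - u N) <= complex.Re e / 4 by exact: hN.
  near=> x y.
  suff h : nrm (x - y) < complex.Re e.
    by rewrite -ball_normE/= nrmE eE ltcR.
  have hx : nrm (x - u N) <= complex.Re e / 4.
    near: x; exists N => // m /= Nm; exact: key.
  have hy : nrm (u N - y) <= complex.Re e / 4.
    rewrite nrmBC; near: y; exists N => // m /= Nm; exact: key.
  apply: le_lt_trans (nrm_tri (u N) _ _) _.
  by apply: le_lt_trans (lerD hx hy) _; lra.
move=> /cvgrPdist_le cl; exists (lim (u @ \oo)) => e e0.
have [|N _ hN] := cl e%:C; first by rewrite gt0c.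
exists N => n Nn; have := hN n Nn.
by rewrite nrmE lecR nrmBC.
Unshelve. all: by end_near. Qed.

Variable V : normedModType R[i].
Implicit Types (u v : nat -> V) (l : V).

Lemma nrm_cvg_unique u l l' : nrm_cvg u l -> nrm_cvg u l' -> l = l'.
Proof.
move=> cl cl'; apply/eqP; rewrite -subr_eq0; apply/eqP/nrm0_eq0.
apply/eqP; rewrite eq_le nrm_ge0 andbT; apply/ler_addgt0Pl => e e0.
have e2 : 0 < e / 2 by rewrite divr_gt0.
have [N hN] := cl _ e2; have [N' hN'] := cl' _ e2.
rewrite addr0; apply: le_trans (nrm_tri (u (maxn N N')) _ _) _.
rewrite [leRHS](splitr e) lerD// ?hN' ?leq_maxr//.
by rewrite nrmBC hN// leq_maxl.
Qed.

Lemma nrm_cvg_cst l : nrm_cvg (fun=> l) l.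
Proof. by move=> e e0; exists 0%N => n _; rewrite subrr nrm0 ltW. Qed.

Lemma nrm_cvgD u v l m : nrm_cvg u l -> nrm_cvg v m -> nrm_cvg (fun n => u n + v n) (l + m).
Proof.
move=> cl cm e e0; have e2 : 0 < e / 2 by rewrite divr_gt0.
have [N hN] := cl _ e2; have [N' hN'] := cm _ e2.
exists (maxn N N') => n; rewrite geq_max => /andP[n1 n2].
rewrite opprD addrACA (le_trans (nrmD _ _))// (splitr e).
by rewrite lerD ?hN ?hN'.
Qed.

Lemma nrm_cvg_le u l (c : R) m : nrm_cvg u l -> (forall n, (m <= n)%N -> nrm (u n) <= c) ->
  nrm l <= c.
Proof.
move=> cl uc; apply/ler_addgt0Pl => e e0; have [N hN] := cl _ e0.
rewrite -(subrK (u (maxn N m)) l) (le_trans (nrmD _ _))// lerD ?uc ?leq_maxr//.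
by rewrite nrmBC hN// leq_maxl.
Qed.

Lemma nrm_cvg_map (W : normedModType R[i]) u l (f : V -> W) (C : R) :
  (forall x, nrm (f x - f l) <= C * nrm (x - l)) -> nrm_cvg u l ->
  nrm_cvg (f \o u) (f l).
Proof.
move=> fC cl e e0; have C1 : 0 < `|C| + 1 by rewrite ltr_wpDl.
have [N hN] := cl (e / (`|C| + 1)) (divr_gt0 e0 C1).
exists N => n Nn; apply: le_trans (fC _) _.
apply: (@le_trans _ _ ((`|C| + 1) * nrm (u n - l))).
  by rewrite ler_wpM2r ?nrm_ge0// (le_trans (ler_norm C))// lerDl.
by rewrite mulrC -ler_pdivlMr// hN.
Qed.

End Convergence.

Section BopAlgebra.
Variable R : realType.
Implicit Types U V W : normedModType R[i].

Lemma bopD V W (A B : bop V W) x : (A + B) x = A x + B x. Proof. by []. Qed.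
Lemma bopB V W (A B : bop V W) x : (A - B) x = A x - B x. Proof. by []. Qed.
Lemma bopN V W (A : bop V W) x : (- A) x = - A x. Proof. by []. Qed.
Lemma bopZ V W a (A : bop V W) x : (a *: A) x = a *: A x. Proof. by []. Qed.
Lemma bop0 V W x : (0 : bop V W) x = 0. Proof. by []. Qed.

Lemma bop_sum V W (I : Type) (r : seq I) (P : pred I) (f : I -> bop V W) x :
  (\sum_(i <- r | P i) f i) x = \sum_(i <- r | P i) f i x.
Proof. by elim/big_rec2: _ => [//|i y A _ <-]. Qed.

Lemma bcompDl U V W (A B : bop V W) (C : bop U V) :
  bcomp (A + B) C = bcomp A C + bcomp B C.
Proof. exact: bopE. Qed.
Lemma bcompDr U V W (A : bop V W) (B C : bop U V) :
  bcomp A (B + C) = bcomp A B + bcomp A C.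
Proof. by apply: bopE => x; exact: linearD. Qed.
Lemma bcompZl U V W a (A : bop V W) (C : bop U V) :
  bcomp (a *: A) C = a *: bcomp A C.
Proof. exact: bopE. Qed.
Lemma bcompZr U V W a (A : bop V W) (C : bop U V) :
  bcomp A (a *: C) = a *: bcomp A C.
Proof. by apply: bopE => x; exact: linearZ. Qed.
Lemma bcompBl U V W (A B : bop V W) (C : bop U V) :
  bcomp (A - B) C = bcomp A C - bcomp B C.
Proof. exact: bopE. Qed.
Lemma bcompBr U V W (A : bop V W) (B C : bop U V) :
  bcomp A (B - C) = bcomp A B - bcomp A C.
Proof. by apply: bopE => x; exact: linearB. Qed.
Lemma bcompA U V W X (A : bop W X) (B : bop V W) (C : bop U V) :
  bcomp A (bcomp B C) = bcomp (bcomp A B) C.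
Proof. exact: bopE. Qed.
Lemma bcomp1l V W (A : bop V W) : bcomp (bid W) A = A.
Proof. exact: bopE. Qed.
Lemma bcomp1r V W (A : bop V W) : bcomp A (bid V) = A.
Proof. exact: bopE. Qed.
Lemma bcomp_suml U V W (I : Type) (r : seq I) (P : pred I) (f : I -> bop V W) (C : bop U V) :
  bcomp (\sum_(i <- r | P i) f i) C = \sum_(i <- r | P i) bcomp (f i) C.
Proof. by elim/big_rec2: _ => [|i y A _ <-]; [exact: bopE|rewrite bcompDl]. Qed.
Lemma bcomp_sumr U V W (I : Type) (r : seq I) (P : pred I) (f : I -> bop U V) (C : bop V W) :
  bcomp C (\sum_(i <- r | P i) f i) = \sum_(i <- r | P i) bcomp C (f i).
Proof.
elim/big_rec2: _ => [|i y A _ <-]; last by rewrite bcompDr.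
by apply: bopE => x; exact: linear0.
Qed.

Lemma nrm_bcomp U V W (A : bop V W) (B : bop U V) :
  nrm (bcomp A B) <= nrm A * nrm B.
Proof.
rewrite !nrm_bop; apply: opnorm_le; first by rewrite mulr_ge0 ?opnorm_ge0.
move=> x; rewrite (le_trans (le_opnorm A (B x)))// -mulrA ler_wpM2l ?opnorm_ge0//.
exact: le_opnorm.
Qed.

Lemma nrm_app V W (A : bop V W) x : nrm (A x) <= nrm A * nrm x.
Proof. by rewrite nrm_bop; exact: le_opnorm. Qed.

Lemma nrm_bid_le1 V : nrm (bid V) <= 1.
Proof. by rewrite nrm_bop; apply: opnorm_le => // x; rewrite mul1r. Qed.

Lemma bop_nrm_cvg_app V W (A : bop V W) (u : nat -> V) l : nrm_cvg u l -> nrm_cvg (A \o u) (A l).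
Proof. by apply: (@nrm_cvg_map _ _ _ _ _ _ (nrm A)) => x; rewrite -linearB nrm_app. Qed.

Lemma nrm_cvg_bop_app V W (A : nat -> bop V W) B (x : V) :
  nrm_cvg A B -> nrm_cvg (fun n => A n x) (B x).
Proof.
apply: (@nrm_cvg_map _ _ _ _ _ (fun A : bop V W => A x) (nrm x)) => C.
by rewrite mulrC -bopB nrm_app.
Qed.

Lemma nrm_complete_bop V W : nrm_complete W -> nrm_complete (bop V W).
Proof.
move=> cW A cA.
have pt x : exists l, nrm_cvg (fun n => A n x) l.
  apply: cW => e e0; have x1 : 0 < nrm x + 1 by rewrite ltr_wpDl ?nrm_ge0.
  have [N hN] := cA (e / (nrm x + 1)) (divr_gt0 e0 x1).
  exists N => m n Nm mn; rewrite -bopB (le_trans (nrm_app _ _))//.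
  apply: (@le_trans _ _ (nrm (A n - A m) * (nrm x + 1))).
    by rewrite ler_wpM2l ?nrm_ge0// lerDl.
  by rewrite -ler_pdivlMr// hN.
have /choice[B hB] := pt.
have Blin : linear B.
  move=> a x y; apply: (@nrm_cvg_unique _ _ (fun n => A n (a *: x + y))); first exact: hB.
  have -> : (fun n => A n (a *: x + y)) = (fun n => a *: A n x + A n y).
    by apply/funext => n; rewrite linearP.
  apply: nrm_cvgD => //; apply: (@nrm_cvg_map _ _ _ _ _ (fun z : W => a *: z) (nrm a)) => // z.
  by rewrite -scalerBr nrmZ.
have unif e : 0 < e -> exists N, forall n x, (N <= n)%N -> nrm (A n x - B x) <= e * nrm x.
  move=> e0; have [N hN] := cA _ e0; exists N => n x Nn.
  have c1 : nrm_cvg (fun m => A n x - A m x) (A n x - B x).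
    apply: nrm_cvgD; first exact: nrm_cvg_cst.
    apply: (@nrm_cvg_map _ _ _ _ _ (fun z : W => - z) 1 _ (hB x)) => z.
    by rewrite -opprD nrmN mul1r.
  apply: (nrm_cvg_le c1 (m := n)) => m nm.
  by rewrite -bopB (le_trans (nrm_app _ _))// ler_wpM2r ?nrm_ge0// nrmBC hN.
have Bbd : B \in @bop_pred R V W.
  apply/asboolP; split => //; have [N hN] := unif 1 ltr01.
  exists (1 + nrm (A N)) => x; rewrite -(subrK (A N x) (B x)) (le_trans (nrmD _ _))//.
  by rewrite mulrDl lerD ?nrm_app// nrmBC hN.
exists (Bop Bbd) => e e0; have [N hN] := unif _ e0.
by exists N => n Nn; rewrite nrm_bop; apply: opnorm_le => [|x]; [exact: ltW|exact: hN].
Qed.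

Fixpoint bpow V (N : bop V V) n : bop V V :=
  if n is k.+1 then bcomp N (bpow N k) else bid V.

Lemma bpowD V (N : bop V V) m n : bpow N (m + n) = bcomp (bpow N m) (bpow N n).
Proof. by elim: m => [|m IH] /=; rewrite ?bcomp1l// IH bcompA. Qed.

Lemma bpowSr V (N : bop V V) n : bcomp (bpow N n) N = bpow N n.+1.
Proof. by rewrite -(addn1 n) bpowD /= bcomp1r. Qed.

Lemma bpowZ V (N : bop V V) a n : bpow (a *: N) n = a ^+ n *: bpow N n.
Proof.
elim: n => [|n IH] /=; first by rewrite expr0 scale1r.
by rewrite IH bcompZr bcompZl scalerA exprSr.
Qed.

Lemma bpow_app V (N : bop V V) n x : bpow N n x = iter n N x.
Proof. by elim: n => [//|n IH] /=; rewrite IH. Qed.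

Lemma nrm_bpow V (N : bop V V) n : nrm (bpow N n) <= nrm N ^+ n.
Proof.
elim: n => [|n IH] /=; first by rewrite expr0 nrm_bid_le1.
by rewrite (le_trans (nrm_bcomp _ _))// exprS ler_wpM2l ?nrm_ge0.
Qed.

End BopAlgebra.

(** * Binomial series of an operator *)

Section BinomialSeries.
Variables (R : realType) (V : normedModType R[i]).
Hypothesis cV : nrm_complete V.
Implicit Types (a b q e : R) (N : bop V V) (m n k : nat).

Definition binsum a N m : bop V V :=
  \sum_(0 <= k < m) (nbin a k)%:C *: bpow N k.

(** (1 - N)^(- a), when the norm of N is less than 1. *)
Definition binseries a N : bop V V := xget 0 [set B | nrm_cvg (binsum a N) B].

Lemma nrm_binsum_tail a N q m n : nrm N <= q -> (m <= n)%N ->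
  nrm (binsum a N n - binsum a N m) <= \sum_(m <= k < n) `|nbin a k| * q ^+ k.
Proof.
move=> Nq mn; rewrite /binsum (big_cat_nat (n := m))//= addrAC subrr add0r.
apply: le_trans (nrm_sum _ _ _) _; apply: ler_sum => k _.
rewrite nrmZ nrmR ler_wpM2l// (le_trans (nrm_bpow _ _))//.
by rewrite lerXn2r ?nnegrE ?(le_trans _ Nq) ?nrm_ge0.
Qed.

Lemma binseriesP a N : nrm N < 1 -> nrm_cvg (binsum a N) (binseries a N).
Proof.
move=> N1; rewrite /binseries; case: xgetP => [B _ //|].
have [B hB] : exists B, nrm_cvg (binsum a N) B.
  apply: (nrm_complete_bop cV) => e e0.
  have [|m0 hm0] := @nbin_tail R a (nrm N) e _ e0; first by rewrite nrm_ge0.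
  exists m0 => m n m0m mn; apply: le_trans (hm0 m n m0m).
  exact: nrm_binsum_tail.
by move=> /(_ B).
Qed.

Lemma binseries_unif a q e : 0 <= q < 1 -> 0 < e -> exists m0, forall N m,
  nrm N <= q -> (m0 <= m)%N -> nrm (binsum a N m - binseries a N) <= e.
Proof.
move=> q1 e0; have [m0 hm0] := nbin_tail a q1 e0.
exists m0 => N m Nq m0m; rewrite nrmBC.
have N1 : nrm N < 1 by case/andP: q1 => _; exact: le_lt_trans.
have c : nrm_cvg (fun n => binsum a N n - binsum a N m) (binseries a N - binsum a N m).
  by apply: nrm_cvgD; [exact: binseriesP|exact: nrm_cvg_cst].
apply: (nrm_cvg_le c (m := m)) => n mn.
by apply: le_trans (hm0 m n m0m); exact: nrm_binsum_tail.
Qed.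

Lemma binseries_eq a N B : nrm N < 1 -> nrm_cvg (binsum a N) B -> binseries a N = B.
Proof. by move=> N1; exact: nrm_cvg_unique (binseriesP a N1). Qed.

Lemma nrm_binseries_le a N q : nrm N <= q -> q < 1 -> nrm (binseries a N) <= (1 - q) `^ (- `|a|).
Proof.
move=> Nq q1; have q0 : 0 <= q by apply: le_trans Nq; exact: nrm_ge0.
apply: (nrm_cvg_le (binseriesP a (le_lt_trans Nq q1)) (m := 0)) => n _.
have := nrm_binsum_tail a Nq (leq0n n); rewrite /binsum (big_geq (leqnn 0)) subr0 => /le_trans; apply.
have q01 : 0 <= q < 1 by rewrite q0.
apply: le_trans (nbin_psum_le n (normr_ge0 a) q01).
by rewrite big_mkord; apply: ler_sum => k _; rewrite ler_wpM2r ?exprn_ge0 ?ler_norm_nbin.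
Qed.

Lemma binseries0 N : nrm N < 1 -> binseries 0 N = bid V.
Proof.
move=> N1; apply: binseries_eq => // e e0; exists 1%N => n n0.
rewrite /binsum big_ltn// nbin_0 scale1r /= big_nat big1 ?addr0 ?subrr ?nrm0 ?ltW//.
by move=> [//|k] _; rewrite nbin0E scale0r.
Qed.

Lemma nbinN1 n : nbin (-1 : R) n.+2 = 0.
Proof. by rewrite /nbin big_ord_recl big_ord_recl /= addNr mul0r mul0r mulr0. Qed.

Lemma binseriesN1 N : nrm N < 1 -> binseries (-1) N = bid V - N.
Proof.
move=> N1; apply: binseries_eq => // e e0; exists 2%N => n n0.
rewrite /binsum big_ltn ?(ltn_trans _ n0)// big_ltn// big_nat big1 => [|[//|[//|k]] _]; last first.
  by rewrite nbinN1 scale0r.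
have -> : nbin (-1 : R) 1 = -1 by rewrite nbinS nbin_0 mul1r addr0 divr1.
rewrite nbin_0 scale1r /= bcomp1r addr0.
by rewrite (rmorphN1 (real_complex R)) scaleN1r subrr nrm0 ltW.
Qed.

Lemma sum_antidiag (W : zmodType) (F : nat -> nat -> W) m :
  \sum_(0 <= n < m) \sum_(j < n.+1) F j (n - j)%N =
  \sum_(0 <= j < m) \sum_(0 <= k < m - j) F j k.
Proof.
elim: m => [|m IH]; first by rewrite !big_geq.
rewrite big_nat_recr//= IH big_ord_recr/= addrA.
rewrite [in RHS]big_nat_recr//= subSnn big_nat1 subnn; congr (_ + _).
rewrite -(big_mkord xpredT (fun j => F j (m - j)%N)) -big_split/=.
rewrite big_nat [in RHS]big_nat; apply: eq_bigr => j /andP[_ jm].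
by rewrite subSn ?(ltnW jm)// big_nat_recr.
Qed.

(** The Cauchy product. Its truncation and the product of the truncations differ by
    terms of total degree at least m; enlarging the radius from q to q' < 1 bounds
    these by (q / q')^m times convergent series. *)
Lemma binseriesD a b N : nrm N < 1 -> bcomp (binseries a N) (binseries b N) = binseries (a + b) N.
Proof.
move=> N1; apply/esym/binseries_eq => //.
pose q := nrm N; pose q' := (1 + q) / 2.
have q0 : 0 <= q by exact: nrm_ge0.
have q'0 : 0 < q' by rewrite /q'; lra.
have q'1 : q' < 1 by rewrite /q' /q; lra.
have qq' : q < q' by rewrite /q' /q; lra.
have q'01 : 0 <= q' < 1 by rewrite ltW.
pose p := q / q'.
have p0 : 0 <= p by rewrite divr_ge0// ltW.
have p1 : p < 1 by rewrite ltr_pdivrMr// mul1r.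
pose C := (1 - q') `^ (- `|a|) * (1 - q') `^ (- `|b|).
have C0 : 0 <= C by rewrite mulr_ge0// powR_ge0.
(* The product of the partial sums runs over the square j, k < m, the partial
   sum of the product over the triangle j + k < m. *)
have key m : nrm (binsum (a + b) N m - bcomp (binsum a N m) (binsum b N m)) <= p ^+ m * C.
  have -> : binsum (a + b) N m = \sum_(0 <= j < m) \sum_(0 <= k < m - j)
      ((nbin a j)%:C * (nbin b k)%:C) *: bpow N (j + k).
    rewrite -(sum_antidiag (fun j k => ((nbin a j)%:C * (nbin b k)%:C) *: bpow N (j + k))).
    apply: eq_bigr => n _; rewrite -nbin_conv rmorph_sum/= scaler_suml.
    by apply: eq_bigr => j _; rewrite rmorphM/= subnKC// -ltnS.
  have -> : bcomp (binsum a N m) (binsum b N m) = \sum_(0 <= j < m) \sum_(0 <= k < m)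
      ((nbin a j)%:C * (nbin b k)%:C) *: bpow N (j + k).
    rewrite /binsum bcomp_suml; apply: eq_bigr => j _.
    rewrite bcomp_sumr; apply: eq_bigr => k _.
    by rewrite bcompZl bcompZr scalerA bpowD.
  rewrite nrmBC -sumrB.
  apply: le_trans (nrm_sum _ _ _) _.
  apply: (@le_trans _ _ (\sum_(0 <= j < m) \sum_(0 <= k < m)
     p ^+ m * ((nbin `|a| j * q' ^+ j) * (nbin `|b| k * q' ^+ k)))).
    rewrite big_nat [leRHS]big_nat; apply: ler_sum => j /andP[_ jm].
    rewrite (big_cat_nat (n := (m - j)%N))//= ?leq_subr// addrAC subrr add0r.
    rewrite [leRHS](big_cat_nat (n := (m - j)%N))//= ?leq_subr//.
    apply: (@le_trans _ _ (\sum_(m - j <= k < m)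
       p ^+ m * ((nbin `|a| j * q' ^+ j) * (nbin `|b| k * q' ^+ k)))); last first.
      rewrite lerDr; apply: sumr_ge0 => k _.
      by rewrite !mulr_ge0 ?nbin_ge0 ?exprn_ge0// ltW.
    apply: le_trans (nrm_sum _ _ _) _.
    rewrite big_nat [leRHS]big_nat; apply: ler_sum => k /andP[mjk km].
    rewrite nrmZ nrmM !nrmR.
    have -> : p ^+ m * (nbin `|a| j * q' ^+ j * (nbin `|b| k * q' ^+ k)) =
       (nbin `|a| j * nbin `|b| k) * (p ^+ m * q' ^+ (j + k)) by rewrite exprD; ring.
    apply: ler_pM; rewrite ?mulr_ge0 ?nrm_ge0//; first by rewrite ler_pM ?ler_norm_nbin.
    apply: le_trans (nrm_bpow _ _) _; rewrite -/q.
    have -> : q = p * q' by rewrite /p divfK// gt_eqF.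
    rewrite exprMn ler_wpM2r ?exprn_ge0 ?(ltW q'0)//.
    by rewrite ler_wiXn2l ?(ltW p1)// -leq_subLR.
  under eq_bigr do rewrite -mulr_sumr.
  rewrite -mulr_sumr ler_wpM2l ?exprn_ge0//.
  under eq_bigr do rewrite -mulr_sumr.
  rewrite -mulr_suml; apply: ler_pM.
  - by apply: sumr_ge0 => k _; rewrite !mulr_ge0 ?nbin_ge0 ?exprn_ge0// ltW.
  - by apply: sumr_ge0 => k _; rewrite !mulr_ge0 ?nbin_ge0 ?exprn_ge0// ltW.
  - by rewrite big_mkord; exact: nbin_psum_le.
  - by rewrite big_mkord; exact: nbin_psum_le.
move=> e e0.
have [A A0 hA] : exists2 A, 0 <= A & nrm (binseries a N) <= A.
  by exists (nrm (binseries a N)); [exact: nrm_ge0|].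
have [B B0 hB] : exists2 B, 0 <= B & nrm (binseries b N) <= B.
  by exists (nrm (binseries b N)); [exact: nrm_ge0|].
have e3 : 0 < e / 3 by rewrite divr_gt0.
have A1 : 0 < A + 1 by rewrite ltr_wpDl.
have B1 : 0 < B + 1 by rewrite ltr_wpDl.
have [ea [ea0 ea1 eaB]] : exists ea, [/\ 0 < ea, ea <= 1 & ea * (B + 1) <= e / 3].
  exists (Num.min 1 (e / 3 / (B + 1))); split.
  - by rewrite lt_min ltr01 (divr_gt0 e3 B1).
  - by rewrite ge_min lexx.
  - by rewrite -ler_pdivlMr// ge_min lexx orbT.
have [Na hNa] := binseriesP a N1 ea0.
have [Nb hNb] := binseriesP b N1 (divr_gt0 e3 A1).
have [Nc hNc] : exists Nc, forall m, (Nc <= m)%N -> p ^+ m * C <= e / 3.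
  have C1 : 0 < C + 1 by rewrite ltr_wpDl.
  have cp : p ^+ m @[m --> \oo] --> (0 : R) by apply: cvg_expr; rewrite ger0_norm.
  have /cvgrPdist_le /(_ (e / 3 / (C + 1)) (divr_gt0 e3 C1)) [Nc _ hNc] := cp.
  exists Nc => m /hNc; rewrite sub0r normrN ger0_norm ?exprn_ge0// => hm.
  apply: (@le_trans _ _ (p ^+ m * (C + 1))); first by rewrite ler_wpM2l ?exprn_ge0// lerDl.
  by rewrite -ler_pdivlMr.
exists (maxn Na (maxn Nb Nc)) => m; rewrite !geq_max => /and3P[ma mb mc].
have ha := hNa _ ma; have hb := hNb _ mb; have hc := hNc _ mc.
apply: le_trans (nrm_tri (bcomp (binsum a N m) (binsum b N m)) _ _) _.
have -> : e = e / 3 + (e / 3 + e / 3) by field.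
apply: lerD; first exact: le_trans (key m) hc.
have -> : bcomp (binsum a N m) (binsum b N m) - bcomp (binseries a N) (binseries b N) =
  bcomp (binsum a N m) (binsum b N m - binseries b N) + bcomp (binsum a N m - binseries a N) (binseries b N).
  by rewrite bcompBr bcompBl addrA subrK.
apply: le_trans (nrmD _ _) _; apply: lerD.
  apply: le_trans (nrm_bcomp _ _) _.
  have hA' : nrm (binsum a N m) <= A + 1.
    rewrite -(subrK (binseries a N) (binsum a N m)) (le_trans (nrmD _ _))// addrC.
    by apply: lerD => //; exact: le_trans ha ea1.
  apply: le_trans (ler_pM (nrm_ge0 _) (nrm_ge0 _) hA' hb) _.
  by rewrite mulrC divfK// gt_eqF.
apply: le_trans (nrm_bcomp _ _) _.
apply: le_trans eaB.
apply: ler_pM; rewrite ?nrm_ge0//.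
by apply: le_trans hB _; rewrite lerDl.
Qed.

Lemma binseries_inv N : nrm N < 1 ->
  bcomp (binseries 1 N) (bid V - N) = bid V /\ bcomp (bid V - N) (binseries 1 N) = bid V.
Proof.
move=> N1; have <- := binseriesN1 N1; split.
  by rewrite (binseriesD 1 (-1) N1) subrr binseries0.
by rewrite (binseriesD (-1) 1 N1) addNr binseries0.
Qed.

End BinomialSeries.

(** * Integrals with a parameter and complex paths *)

Section RealIntegrals.
Variable R : realType.
Notation mu := (@lebesgue_measure R).
Implicit Types (f g F : R -> R) (a b : R).

Lemma cont_integrable f a b : continuous f -> mu.-integrable `[a, b] (EFin \o f).
Proof.
move=> cf; apply: continuous_compact_integrable; first exact: segment_compact.
exact: continuous_subspaceT.
Qed.

Lemma Rint_FTC f F a b : a < b -> (forall t : R, is_derive t 1 F (f t)) -> continuous f ->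
  \int[mu]_(t in `[a, b]) f t = F b - F a.
Proof.
move=> ab dF cf; rewrite /Rintegral.
have cF t : {for t, continuous F} by exact: is_derive1_continuous (dF t).
rewrite (@continuous_FTC2 _ f F a b ab) ?fine//.
- exact: continuous_subspaceT.
- split.
  + by move=> t _; have := dF t => d.
  + by apply: cvg_at_right_filter; exact: cF.
  + by apply: cvg_at_left_filter; exact: cF.
- by move=> t _; have d := dF t; rewrite derive1E derive_val.
Qed.

Lemma Rint_bound f a b (M : R) : a <= b -> continuous f ->
  (forall t, a <= t <= b -> `|f t| <= M) ->
  `|\int[mu]_(t in `[a, b]) f t| <= M * (b - a).
Proof.
move=> ab cf fM.
have mI : measurable (`[a, b] : set (measurableTypeR R)) by exact: measurable_itv.
apply: le_trans (le_normr_Rintegral mI (cont_integrable a b cf)) _.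
have cn : continuous (fun t => `|f t|) by move=> t; apply: cvg_norm; exact: cf.
have ci := @cont_integrable _ a b cn.
have cc := @cont_integrable (fun=> M) a b (fun=> cvg_cst _).
apply: (@le_trans _ _ (\int[mu]_(t in `[a, b]) M)).
  by apply: le_Rintegral; [exact: mI|exact: ci|exact: cc|move=> t; rewrite /= in_itv => /fM].
rewrite Rintegral_cst//=; rewrite lebesgue_measure_itv/= lte_fin.
by case: ltP => // h; rewrite -?EFinD//= (le_anti (_ : a <= b <= a)) ?subrr ?mulr0 ?ab.
Qed.

(** Differentiation under the integral sign: near s the derivative is dominated by a
    constant, by compactness. *)
Lemma Rint_param_cst (U DU : R -> R -> R) a b s0 s1 :
  (forall s t : R, is_derive s 1 (U^~ t) (DU s t)) ->
  continuous (fun p : R * R => DU p.1 p.2) ->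
  (forall s, continuous (U s)) ->
  (forall s, \int[mu]_(t in `[a, b]) DU s t = 0) ->
  \int[mu]_(t in `[a, b]) U s0 t = \int[mu]_(t in `[a, b]) U s1 t.
Proof.
move=> dU cDU cU I0.
pose I s := \int[mu]_(t in `[a, b]) U s t.
suff dI s : is_derive (s : R) 1 I 0 by exact: (is_derive_0_is_cst s0 s1 dI).
have mI : measurable (`[a, b] : set (measurableTypeR R)) by exact: measurable_itv.
have [M hM] : exists M : R, forall x y, s - 1 < x < s + 1 -> a <= y <= b ->
    `|DU x y| <= M.
  have cK : compact (`[s - 1, s + 1] `*` `[a, b] : set (R * R)).
    by apply: compact_setX; exact: segment_compact.
  have cI := continuous_compact (continuous_subspaceT cDU) cK.
  have [M [_ hM]] := compact_bounded cI.
  exists (M + 1) => x y /andP[x1 x2] yab.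
  apply: (hM (M + 1)); first by rewrite ltrDl.
  exists (x, y) => //; split; rewrite /= in_itv//=.
  by rewrite !ltW.
have dP x y : partial1of2 U x y = DU x y.
  by have d := dU x y; rewrite /partial1of2 derive1E derive_val.
have h1 : s - 1 < s < s + 1 by rewrite ltrBlDr ltrDl ltr01.
have M0 : 0 <= `|M| by [].
have e1 : forall x : R, `]s - 1, s + 1[%classic x -> mu.-integrable `[a, b] (EFin \o U x).
  by move=> x _; exact: cont_integrable.
have e2 : forall x y : R, `]s - 1, s + 1[%classic x -> `[a, b]%classic y -> derivable (U^~ y) x 1.
  by move=> x y _ _; have d := dU x y.
have e3 : mu.-integrable `[a, b] (EFin \o (fun=> `|M|)).
  by apply: cont_integrable => t; exact: cvg_cst.
have e4 : forall x y : R, `]s - 1, s + 1[%classic x -> `[a, b]%classic y -> `|partial1of2 U x y| <= `|M|.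
  move=> x y; rewrite /= !in_itv/= => h yab; rewrite dP.
  by apply: le_trans (hM _ _ h yab) (ler_norm _).
have Is : `]s - 1, s + 1[%classic s by rewrite /= in_itv.
have D := @derivable_under_integral R _ _ mu U `[a, b] mI s (s - 1) (s + 1) Is e1 e2 (fun=> `|M|) (fun=> M0) e3 e4.
have E := @differentiation_under_integral R _ _ mu U `[a, b] mI s (s - 1) (s + 1) Is e1 e2 (fun=> `|M|) (fun=> M0) e3 e4.
apply: DeriveDef; first exact: D.
rewrite -derive1E E -[RHS](I0 s); apply: eq_Rintegral => t _; exact: dP.
Qed.

End RealIntegrals.

Section ComplexPaths.
Variable R : realType.
Local Notation re := (@complex.Re R).
Local Notation im := (@complex.Im R).

(** Derivatives and continuity of complex-valued maps are taken componentwise, which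
    brings them under the theorems on real functions. *)
Definition cder (u : R -> R[i]) (s : R) (d : R[i]) :=
  is_derive s 1 (fun x => re (u x)) (re d) /\ is_derive s 1 (fun x => im (u x)) (im d).

Definition ccont (T : topologicalType) (u : T -> R[i]) (x : T) :=
  {for x, continuous (fun y => re (u y))} /\ {for x, continuous (fun y => im (u y))}.

Implicit Types (u v : R -> R[i]) (s : R).

Lemma cReD (a b : R[i]) : re (a + b) = re a + re b. Proof. by case: a b => ? ? []. Qed.
Lemma cImD (a b : R[i]) : im (a + b) = im a + im b. Proof. by case: a b => ? ? []. Qed.
Lemma cReN (a : R[i]) : re (- a) = - re a. Proof. by case: a. Qed.
Lemma cImN (a : R[i]) : im (- a) = - im a. Proof. by case: a. Qed.
Lemma cReM (a b : R[i]) : re (a * b) = re a * re b - im a * im b.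
Proof. by case: a b => ? ? []. Qed.
Lemma cImM (a b : R[i]) : im (a * b) = re a * im b + im a * re b.
Proof. by case: a b => ? ? []. Qed.

Lemma cder_cst s (c : R[i]) : cder (fun=> c) s 0.
Proof. by split; exact: is_derive1_cst. Qed.

Lemma cder_eq u s d d' : cder u s d -> d = d' -> cder u s d'.
Proof. by move=> ? <-. Qed.

Lemma cderD u v s d e : cder u s d -> cder v s e -> cder (fun x => u x + v x) s (d + e).
Proof.
move=> [u1 u2] [v1 v2]; split.
  by rewrite cReD; under eq_fun do rewrite cReD; exact: is_derive1D.
by rewrite cImD; under eq_fun do rewrite cImD; exact: is_derive1D.
Qed.

Lemma cderM u v s d e : cder u s d -> cder v s e ->
  cder (fun x => u x * v x) s (d * v s + u s * e).
Proof.
move=> [u1 u2] [v1 v2]; split.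
  have -> : re (d * v s + u s * e) =
     (re d * re (v s) + re (u s) * re e) - (im d * im (v s) + im (u s) * im e).
    by rewrite cReD !cReM; ring.
  by under eq_fun do rewrite cReM; apply: is_derive1B; exact: is_derive1M.
have -> : im (d * v s + u s * e) =
   (re d * im (v s) + re (u s) * im e) + (im d * re (v s) + im (u s) * re e).
  by rewrite cImD !cImM; ring.
by under eq_fun do rewrite cImM; apply: is_derive1D; exact: is_derive1M.
Qed.

Lemma cder_real (x : R -> R) s d : is_derive s 1 x d -> cder (fun y => (x y)%:C) s d%:C.
Proof. by move=> dx; split => //=; exact: is_derive1_cst. Qed.

Lemma cder_comp u (x : R -> R) s d x' : cder u (x s) d -> is_derive s 1 x x' ->
  cder (fun y => u (x y)) s (d * x'%:C).
Proof.
move=> [u1 u2] dx; split.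
  by rewrite cReM/= mulr0 subr0; exact: (@is_derive1_fcomp _ (fun y => re (u y))).
by rewrite cImM/= mulr0 add0r; exact: (@is_derive1_fcomp _ (fun y => im (u y))).
Qed.

Lemma cder_cis s : cder (@cis R) s ('i * cis s).
Proof.
split; rewrite ?cReM ?cImM /=.
  by rewrite mul0r mul1r sub0r; exact: is_derive_cos.
by rewrite mul0r mul1r add0r; exact: is_derive_sin.
Qed.

Lemma cder_ccont u s d : cder u s d -> ccont u s.
Proof. by move=> [u1 u2]; split; [exact: is_derive1_continuous u1|exact: is_derive1_continuous u2]. Qed.

Section Continuity.
Variables (T : topologicalType).
Implicit Types (f g : T -> R[i]) (x : T).

Lemma ccont_cst x (c : R[i]) : ccont (fun=> c) x.
Proof. by split; exact: cvg_cst. Qed.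

Lemma ccontD f g x : ccont f x -> ccont g x -> ccont (fun y => f y + g y) x.
Proof.
move=> [f1 f2] [g1 g2]; split; rewrite /prop_for.
  by under eq_fun do rewrite cReD; exact: cvgD.
by under eq_fun do rewrite cImD; exact: cvgD.
Qed.

Lemma ccontN f x : ccont f x -> ccont (fun y => - f y) x.
Proof.
move=> [f1 f2]; split; rewrite /prop_for.
  by under eq_fun do rewrite cReN; exact: cvgN.
by under eq_fun do rewrite cImN; exact: cvgN.
Qed.

Lemma ccontM f g x : ccont f x -> ccont g x -> ccont (fun y => f y * g y) x.
Proof.
move=> [f1 f2] [g1 g2]; split; rewrite /prop_for.
  by under eq_fun do rewrite cReM; apply: cvgB; exact: cvgM.
by under eq_fun do rewrite cImM; apply: cvgD; exact: cvgM.
Qed.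

Lemma ccont_real (r : T -> R) x : {for x, continuous r} -> ccont (fun y => (r y)%:C) x.
Proof. by move=> cr; split => //=; exact: cvg_cst. Qed.

Lemma ccont_nrm f x (e : R) : ccont f x -> 0 < e -> \forall y \near x, nrm (f y - f x) < e.
Proof.
move=> [/cvgrPdist_lt f1 /cvgrPdist_lt f2] e0.
have e2 : 0 < e / 2 by rewrite divr_gt0.
have := f1 _ e2; have := f2 _ e2; apply: filterS2 => y h2 h1.
apply: le_lt_trans (nrm_le_ReIm _) _.
rewrite cReD cReN cImD cImN (distrC (re _)) (distrC (im _)) (splitr e).
exact: ltrD.
Qed.

Lemma ccontP f x : (forall e : R, 0 < e -> \forall y \near x, nrm (f y - f x) <= e) -> ccont f x.
Proof.
move=> h; split; apply/cvgrPdist_le => e e0; apply: filterS (h e e0) => y.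
  by apply: le_trans; rewrite distrC -cReN -cReD; exact: Re_le_nrm.
by apply: le_trans; rewrite distrC -cImN -cImD; exact: Im_le_nrm.
Qed.

End Continuity.

Lemma ccont_comp (S T : topologicalType) (u : T -> R[i]) (x : S -> T) (s : S) :
  ccont u (x s) -> {for s, continuous x} -> ccont (fun y => u (x y)) s.
Proof.
move=> [u1 u2] cx; split; rewrite /prop_for.
  exact: (@continuous_comp _ _ _ x (fun y => re (u y)) s cx u1).
exact: (@continuous_comp _ _ _ x (fun y => im (u y)) s cx u2).
Qed.

Lemma ccont_cis s : ccont (@cis R) s.
Proof. exact: cder_ccont (cder_cis s). Qed.

Section Integral.
Variables (a b : R).
Implicit Types (g : R -> R[i]).

Definition ccontT g := forall t, ccont g t.

Lemma ccontT_re g : ccontT g -> continuous (fun t => re (g t)).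
Proof. by move=> cg t; have [] := cg t. Qed.

Lemma ccontT_im g : ccontT g -> continuous (fun t => im (g t)).
Proof. by move=> cg t; have [] := cg t. Qed.

Let mI : measurable (`[a, b] : set (measurableTypeR R)).
Proof. exact: measurable_itv. Qed.

Lemma eq_integralC g h : g =1 h -> integralC a b g = integralC a b h.
Proof. by move=> /funext ->. Qed.

Lemma complex_ext (x y : R[i]) : re x = re y -> im x = im y -> x = y.
Proof. by case: x y => ? ? [? ?] /= -> ->. Qed.

Lemma integralCD g h : ccontT g -> ccontT h ->
  integralC a b (fun t => g t + h t) = integralC a b g + integralC a b h.
Proof.
move=> cg ch; apply: complex_ext; rewrite ?cReD ?cImD /integralC/=.
  under eq_Rintegral do rewrite cReD.
  by rewrite RintegralD//; apply: cont_integrable; exact: ccontT_re.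
under eq_Rintegral do rewrite cImD.
by rewrite RintegralD//; apply: cont_integrable; exact: ccontT_im.
Qed.

Lemma integralCZ (c : R[i]) g : ccontT g ->
  integralC a b (fun t => c * g t) = c * integralC a b g.
Proof.
move=> cg.
have ir : (lebesgue_measure : measure (measurableTypeR R) R).-integrable `[a, b]
    (EFin \o (fun t => re (g t))).
  by apply: cont_integrable; exact: ccontT_re.
have ii : (lebesgue_measure : measure (measurableTypeR R) R).-integrable `[a, b]
    (EFin \o (fun t => im (g t))).
  by apply: cont_integrable; exact: ccontT_im.
have zr k : continuous (fun t => k * re (g t)).
  by move=> t; apply: cvgM; [exact: cvg_cst|exact: ccontT_re].
have zi k : continuous (fun t => k * im (g t)).
  by move=> t; apply: cvgM; [exact: cvg_cst|exact: ccontT_im].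
apply: complex_ext; rewrite ?cReM ?cImM /integralC/=.
  under eq_Rintegral do rewrite cReM.
  by rewrite RintegralB ?RintegralZl//; apply: cont_integrable.
under eq_Rintegral do rewrite cImM.
by rewrite RintegralD ?RintegralZl//; apply: cont_integrable.
Qed.

Lemma integralC_bound g (M : R) : a <= b -> ccontT g ->
  (forall t, nrm (g t) <= M) -> nrm (integralC a b g) <= 2 * (M * (b - a)).
Proof.
move=> ab cg gM; apply: le_trans (nrm_le_ReIm _) _.
rewrite mulr_natl mulr2n; apply: lerD; apply: Rint_bound => //.
- exact: ccontT_re.
- by move=> t _; apply: le_trans (gM t); exact: Re_le_nrm.
- exact: ccontT_im.
- by move=> t _; apply: le_trans (gM t); exact: Im_le_nrm.
Qed.

Lemma integralC_FTC g G : a < b -> (forall t, cder G t (g t)) -> ccontT g ->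
  integralC a b g = G b - G a.
Proof.
move=> ab dG cg; apply: complex_ext; rewrite ?cReD ?cImD ?cReN ?cImN /integralC/=.
  apply: (@Rint_FTC _ _ (fun t => re (G t))) => //.
    by move=> t; have [] := dG t.
  exact: ccontT_re.
apply: (@Rint_FTC _ _ (fun t => im (G t))) => //.
  by move=> t; have [] := dG t.
exact: ccontT_im.
Qed.

Lemma integralC_param_cst (U DU : R -> R -> R[i]) s0 s1 :
  (forall s t : R, cder (U^~ t) s (DU s t)) ->
  (forall p : R * R, ccont (fun p : R * R => DU p.1 p.2) p) ->
  (forall s, ccontT (U s)) ->
  (forall s, integralC a b (DU s) = 0) ->
  integralC a b (U s0) = integralC a b (U s1).
Proof.
move=> dU cDU cU I0; apply: complex_ext; rewrite /integralC/=.
  apply: (@Rint_param_cst _ (fun s t => re (U s t)) (fun s t => re (DU s t))).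
  - by move=> s t; have [] := dU s t.
  - by move=> p; have [] := cDU p.
  - by move=> s; exact: ccontT_re.
  - by move=> s; have := congr1 re (I0 s).
apply: (@Rint_param_cst _ (fun s t => im (U s t)) (fun s t => im (DU s t))).
- by move=> s t; have [] := dU s t.
- by move=> p; have [] := cDU p.
- by move=> s; exact: ccontT_im.
- by move=> s; have := congr1 im (I0 s).
Qed.

End Integral.
End ComplexPaths.

(** * Resolvents and complex powers along paths *)

Section Caratheodory.
Variable R : realType.
Local Notation re := (@complex.Re R).
Local Notation im := (@complex.Im R).

(** Caratheodory's form of the chain rule: k plays the role of the complex difference
    quotient of the function that takes w to u. *)
Lemma cder_caratheodory (u w k : R -> R[i]) (s : R) (d : R[i]) :
  (forall x, u x - u s = (w x - w s) * k x) -> cder w s d -> ccont k s ->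
  cder u s (d * k s).
Proof.
move=> E [/is_derive1_caratheodory[g1 [G1 c1 e1]] /is_derive1_caratheodory[g2 [G2 c2 e2]]].
move=> [k1 k2]; split; apply/is_derive1_caratheodory.
  exists (fun x => g1 x * re (k x) - g2 x * im (k x)); split.
  - move=> x; have := congr1 re (E x); rewrite cReM !cReD !cImD !cReN !cImN G1 G2 => ->.
    by ring.
  - by apply: cvgB; exact: cvgM.
  - by rewrite cReM e1 e2.
exists (fun x => g1 x * im (k x) + g2 x * re (k x)); split.
- move=> x; have := congr1 im (E x); rewrite cImM !cReD !cImD !cReN !cImN G1 G2 => ->.
  by ring.
- by apply: cvgD; exact: cvgM.
- by rewrite cImM e1 e2.
Qed.

End Caratheodory.

Section Resolvent.
Variables (R : realType) (V : normedModType R[i]) (A : bop V V).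
Local Notation Rs := (resolvent A).

Lemma resolventP l : ~ spectrum A l ->
  bcomp (Rs l) (l *: bid V - A) = bid V /\ bcomp (l *: bid V - A) (Rs l) = bid V.
Proof.
rewrite /spectrum /= => /contrapT [B hB]; rewrite /resolvent.
by case: xgetP => [C _ //|]; move=> /(_ B).
Qed.

Lemma resolvent_ident l l0 : ~ spectrum A l -> ~ spectrum A l0 ->
  Rs l - Rs l0 = - (l - l0) *: bcomp (Rs l) (Rs l0).
Proof.
move=> /resolventP[h1 h2] /resolventP[h3 h4].
transitivity (bcomp (Rs l) (bcomp (l0 *: bid V - A) (Rs l0)) -
              bcomp (Rs l) (bcomp (l *: bid V - A) (Rs l0))).
  by rewrite h4 bcomp1r bcompA h1 bcomp1l.
rewrite -bcompBr -bcompBl.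
have -> : l0 *: bid V - A - (l *: bid V - A) = - (l - l0) *: bid V.
  by rewrite opprB addrA subrK -scalerBl opprB.
by rewrite bcompZl bcompZr bcomp1l.
Qed.

(** By the resolvent identity, |R(l)| <= |R(l0)| + |l - l0| |R(l)| |R(l0)|. *)
Lemma nrm_resolvent_near l l0 : ~ spectrum A l -> ~ spectrum A l0 ->
  nrm (l - l0) * nrm (Rs l0) <= 2^-1 -> nrm (Rs l) <= 2 * nrm (Rs l0).
Proof.
move=> hl hl0 h.
have E := resolvent_ident hl hl0.
have : nrm (Rs l) <= nrm (Rs l0) + nrm (Rs l) * (nrm (l - l0) * nrm (Rs l0)).
  rewrite -{1}(subrK (Rs l0) (Rs l)) E addrC (le_trans (nrmD _ _))// lerD2l.
  rewrite nrmZ nrmN mulrCA ler_wpM2l ?nrm_ge0// nrm_bcomp//.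
have : nrm (Rs l) * (nrm (l - l0) * nrm (Rs l0)) <= nrm (Rs l) * 2^-1.
  by rewrite ler_wpM2l ?nrm_ge0.
by move: (nrm (Rs l)) (nrm (Rs l0)) => x y; lra.
Qed.

Lemma resolvent_lipschitz l l0 : ~ spectrum A l -> ~ spectrum A l0 ->
  nrm (l - l0) * nrm (Rs l0) <= 2^-1 ->
  nrm (Rs l - Rs l0) <= nrm (l - l0) * (2 * nrm (Rs l0) ^+ 2).
Proof.
move=> hl hl0 h; rewrite resolvent_ident// nrmZ nrmN ler_wpM2l ?nrm_ge0//.
apply: le_trans (nrm_bcomp _ _) _.
by rewrite expr2 mulrA ler_wpM2r ?nrm_ge0// nrm_resolvent_near.
Qed.

(** The growth allowed to f covers bounded linear maps as well as X |-> phi (X X). *)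
Lemma ccont_resolvent (T : topologicalType) (w : T -> R[i]) (x : T)
    (f : bop V V -> R[i]) (C : R) :
  (forall y, ~ spectrum A (w y)) -> ccont w x ->
  (forall X Y, nrm (f X - f Y) <= C * (1 + nrm X + nrm Y) * nrm (X - Y)) ->
  ccont (fun y => f (Rs (w y))) x.
Proof.
move=> hw cw fC; apply: ccontP => e e0.
pose r := nrm (Rs (w x)); have r0 : 0 <= r by exact: nrm_ge0.
pose K := `|C| * (1 + 2 * r + r); have K0 : 0 <= K by rewrite mulr_ge0// !addr_ge0// mulr_ge0.
have K1 : 0 < K * (2 * r ^+ 2) + 1 by rewrite ltr_wpDl// mulr_ge0// mulr_ge0// sqr_ge0.
have d1 : 0 < 2^-1 / (r + 1) by rewrite divr_gt0// ltr_wpDl.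
have := ccont_nrm cw d1; have := ccont_nrm cw (divr_gt0 e0 K1).
apply: filterS2 => y h2 h1.
have r1 : 0 < r + 1 by rewrite ltr_wpDl.
have h3 : nrm (w y - w x) * r <= 2^-1.
  apply: (@le_trans _ _ (nrm (w y - w x) * (r + 1))).
    by rewrite ler_wpM2l ?nrm_ge0// lerDl.
  by rewrite -ler_pdivlMr// ltW.
apply: le_trans (fC _ _) _.
apply: (@le_trans _ _ (K * (nrm (w y - w x) * (2 * r ^+ 2)))).
  apply: (@le_trans _ _ (K * nrm (Rs (w y) - Rs (w x)))).
    rewrite ler_wpM2r ?nrm_ge0//.
    apply: (@le_trans _ _ (`|C| * (1 + nrm (Rs (w y)) + r))).
      by rewrite ler_wpM2r ?ler_norm// !addr_ge0// nrm_ge0.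
    rewrite ler_wpM2l// lerD2r lerD2l.
    exact: nrm_resolvent_near.
  by rewrite ler_wpM2l//; exact: resolvent_lipschitz.
rewrite mulrCA; apply: (@le_trans _ _ (nrm (w y - w x) * (K * (2 * r ^+ 2) + 1))).
  by rewrite ler_wpM2l ?nrm_ge0// lerDl.
by rewrite -ler_pdivlMr// ltW.
Qed.

Variable phi : bop (bop V V) R[i]^o.

Lemma ccont_phi_resolvent (T : topologicalType) (w : T -> R[i]) (x : T) (C : bop V V) :
  (forall y, ~ spectrum A (w y)) -> ccont w x ->
  ccont (fun y => phi (bcomp (Rs (w y)) C)) x.
Proof.
move=> hw cw; apply: (@ccont_resolvent _ w x (fun X => phi (bcomp X C)) (nrm phi * nrm C)) => // X Y.
have -> : phi (bcomp X C) - phi (bcomp Y C) = phi (bcomp (X - Y) C).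
  by rewrite bcompBl linearB.
apply: le_trans (nrm_app phi _) _; rewrite -!mulrA ler_wpM2l ?nrm_ge0//.
apply: le_trans (nrm_bcomp _ _) _; rewrite mulrC ler_wpM2l ?nrm_ge0//.
by rewrite ler_peMl ?nrm_ge0// -addrA lerDl addr_ge0 ?nrm_ge0.
Qed.

Lemma cder_resolvent (w : R -> R[i]) s d :
  (forall x, ~ spectrum A (w x)) -> cder w s d ->
  cder (fun x => phi (Rs (w x))) s (d * - phi (bcomp (Rs (w s)) (Rs (w s)))).
Proof.
move=> hw dw; apply: (@cder_caratheodory _ _ w (fun x => - phi (bcomp (Rs (w x)) (Rs (w s))))) => //.
  move=> x; rewrite -[LHS]/(phi _ - phi _) -linearB resolvent_ident// linearZ/=.
  by rewrite mulrN -mulNr.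
by apply: ccontN; apply: ccont_phi_resolvent => //; exact: cder_ccont dw.
Qed.

Lemma ccont_resolvent_sq (T : topologicalType) (w : T -> R[i]) (x : T) :
  (forall y, ~ spectrum A (w y)) -> ccont w x ->
  ccont (fun y => phi (bcomp (Rs (w y)) (Rs (w y)))) x.
Proof.
move=> hw cw; apply: (@ccont_resolvent _ w x (fun X => phi (bcomp X X)) (nrm phi)) => // X Y.
have -> : phi (bcomp X X) - phi (bcomp Y Y) = phi (bcomp (X - Y) X + bcomp Y (X - Y)).
  by rewrite bcompBl bcompBr addrA subrK linearB.
apply: le_trans (nrm_app phi _) _; rewrite -!mulrA ler_wpM2l ?nrm_ge0//.
apply: le_trans (nrmD _ _) _.
apply: le_trans (lerD (nrm_bcomp _ _) (nrm_bcomp _ _)) _.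
rewrite (mulrC (nrm (X - Y))) -mulrDl ler_wpM2r ?nrm_ge0//.
by rewrite -addrA lerDr.
Qed.

End Resolvent.

Section ComplexPower.
Variable R : realType.
Local Notation re := (@complex.Re R).
Local Notation im := (@complex.Im R).

Definition logmod (z : R[i]) : R := ln (re z ^+ 2 + im z ^+ 2) / 2.
Definition argp (z : R[i]) : R := atan (im z / re z).

Lemma cpowE (z : R[i]) a : 0 < re z ->
  cpow z a = (expR (a * logmod z))%:C * cis (a * argp z).
Proof.
move=> z0; rewrite /cpow /argp; congr (_%:C * _).
have zn : 0 < nrm z by apply: lt_le_trans (Re_le_nrm z); rewrite normr_gt0 gt_eqF.
rewrite powR_expR// /logmod -nrm_sqr expr2 lnM ?posrE//; congr (expR (a * _)).
by field.
Qed.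

Section Path.
Variables (w : R -> R[i]) (s : R) (d : R[i]).
Hypothesis w0 : forall x, 0 < re (w x).
Hypothesis dw : cder w s d.

Let N := re (w s) ^+ 2 + im (w s) ^+ 2.

Let N0 : 0 < N.
Proof. by rewrite /N ltr_wpDr ?sqr_ge0// exprn_gt0. Qed.

Lemma is_derive_logmod :
  is_derive s 1 (fun x => logmod (w x)) ((re (w s) * re d + im (w s) * im d) / N).
Proof.
have [d1 d2] := dw.
have h := is_derive1D (is_derive1M d1 d1) (is_derive1M d2 d2).
have h1 : is_derive s 1 (fun x => re (w x) ^+ 2 + im (w x) ^+ 2)
   (2 * (re (w s) * re d + im (w s) * im d)).
  have <- : re d * re (w s) + re (w s) * re d + (im d * im (w s) + im (w s) * im d) =
      2 * (re (w s) * re d + im (w s) * im d) by ring.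
  exact: h.
have h2 := @is_derive1_fcomp _ (@ln R) (fun x => re (w x) ^+ 2 + im (w x) ^+ 2) s N^-1 _ (is_derive1_ln N0) h1.
have -> : (re (w s) * re d + im (w s) * im d) / N =
    2^-1 * (N^-1 * (2 * (re (w s) * re d + im (w s) * im d))).
  by field; rewrite gt_eqF.
by under eq_fun do rewrite /logmod mulrC; exact: is_derive1Z h2.
Qed.

Lemma is_derive_argp :
  is_derive s 1 (fun x => argp (w x)) ((re (w s) * im d - im (w s) * re d) / N).
Proof.
have [d1 d2] := dw; have x0 := w0 s.
have dV : is_derive (re (w s)) 1 (fun x : R => x^-1) (- (re (w s)) ^- 2).
  have := @is_deriveV R id (re (w s)) 1 1.
  by rewrite /GRing.scale/= mulr1; apply; rewrite gt_eqF.
have h := is_derive1M d2 (@is_derive1_fcomp _ (fun x => x^-1) (fun x => re (w x)) s _ _ dV d1).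
have h2 := @is_derive1_fcomp _ (@atan R) (fun x => im (w x) * (re (w x))^-1) s _ _ (is_derive1_atan _) h.
rewrite /argp.
have E : (re (w s) * im d - im (w s) * re d) / N =
  (1 + (im (w s) / re (w s)) ^+ 2)^-1 * (im d * (re (w s))^-1 + im (w s) * (- re (w s) ^- 2 * re d)).
  move: N0 x0; rewrite /N; move: (re (w s)) (im (w s)) (re d) (im d) => x y x' y' N0' x0.
  by field; rewrite !gt_eqF// -exprMn// ltr_wpDr// ?sqr_ge0// exprn_gt0.
by rewrite E.
Qed.

(** Along a path in the half-plane the principal logarithm has derivative w' / w. *)
Lemma cder_cpow a : cder (fun x => cpow (w x) a) s (a%:C * cpow (w s) a / w s * d).
Proof.
have E : (fun x => cpow (w x) a) = (fun x => (expR (a * logmod (w x)))%:C * cis (a * argp (w x))).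
  by apply/funext => x; rewrite cpowE.
rewrite E cpowE//.
have h1 := cder_real (@is_derive1_fcomp _ (@expR R) (fun x => a * logmod (w x)) s _ _ (is_derive_expR _) (is_derive1Z a is_derive_logmod)).
have h2 := @cder_comp _ (@cis R) (fun x => a * argp (w x)) s _ _ (cder_cis _) (is_derive1Z a is_derive_argp).
apply: cder_eq (cderM h1 h2) _.
have ws : w s != 0 by apply: contraTneq (w0 s) => ->; rewrite ltxx.
have key : d / w s = ((re (w s) * re d + im (w s) * im d) / N)%:C +
   'i * ((re (w s) * im d - im (w s) * re d) / N)%:C.
  apply: (mulIf ws); rewrite divfK//.
  apply: complex_ext; rewrite ?cReM ?cImM ?cReD ?cImD ?cReM ?cImM /=.
    by move: N0; rewrite /N => N1; field; rewrite gt_eqF.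
  by move: N0; rewrite /N => N1; field; rewrite gt_eqF.
rewrite -(mulrA _ (w s)^-1 d) (mulrC _ d) key !(rmorphM (real_complex R))/=.
move: (expR _)%:C (cis _) (_ + _)%:C (_ - _)%:C (N^-1)%:C a%:C => e c p q n b.
by ring.
Qed.

End Path.

Lemma ccont_cpow (T : topologicalType) (w : T -> R[i]) (x : T) a :
  (forall y, 0 < re (w y)) -> ccont w x -> ccont (fun y => cpow (w y) a) x.
Proof.
move=> w0 [c1 c2].
have -> : (fun y => cpow (w y) a) = (fun y => (expR (a * logmod (w y)))%:C * cis (a * argp (w y))).
  by apply/funext => y; rewrite cpowE.
have x0 := w0 x.
have cN : {for x, continuous (fun y => re (w y) ^+ 2 + im (w y) ^+ 2)}.
  by apply: cvgD; rewrite /=; under eq_fun do rewrite expr2; exact: cvgM.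
have cL : {for x, continuous (fun y => logmod (w y))}.
  apply: cvgM; last exact: cvg_cst.
  apply: (@continuous_comp _ _ _ _ (@ln R) x cN).
  by apply: continuous_ln; rewrite ltr_wpDr ?sqr_ge0// exprn_gt0.
have cA : {for x, continuous (fun y => argp (w y))}.
  apply: (@continuous_comp _ _ _ (fun y => im (w y) / re (w y)) (@atan R) x).
    by apply: cvgM => //; apply: cvgV => //; rewrite gt_eqF.
  exact: continuous_atan.
have cZ (f : T -> R) : {for x, continuous f} -> {for x, continuous (fun y => a * f y)}.
  by move=> cf; apply: cvgM => //; exact: cvg_cst.
apply: ccontM.
  apply: ccont_real; apply: (@continuous_comp _ _ _ _ (@expR R) x (cZ _ cL)).
  exact: continuous_expR.
exact: (@ccont_comp _ _ _ (@cis R) _ x (@ccont_cis _ _) (cZ _ cA)).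
Qed.

End ComplexPower.

(** * Homotopy of circles *)

Section Circles.
Variable R : realType.
Local Notation re := (@complex.Re R).
Local Notation im := (@complex.Im R).
Implicit Types (s t : R).

Lemma nrm_cis t : nrm (cis t) = 1.
Proof.
apply/eqP; rewrite -(@eqrXn2 _ 2) ?nrm_ge0 ?ler01// nrm_sqr/= expr1n.
by rewrite cos2Dsin2.
Qed.

Lemma cisD s t : cis (s + t) = cis s * cis t.
Proof. by apply: complex_ext; rewrite ?cReM ?cImM/= ?cosD ?sinD// addrC. Qed.

Lemma cis0 : cis 0 = 1 :> R[i].
Proof. by apply: complex_ext; rewrite /= ?cos0 ?sin0. Qed.

Lemma cisX t n : cis t ^+ n = cis (n%:R * t).
Proof.
elim: n => [|n IH]; first by rewrite mul0r cis0.
by rewrite exprS IH -cisD -natr1; congr cis; ring.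
Qed.

Lemma cisV t : (cis t)^-1 = cis (- t).
Proof.
have h : cis t * cis (- t) = 1 by rewrite -cisD subrr cis0.
have t0 : cis t != 0 by apply: contra_eq_neq h => ->; rewrite mul0r eq_sym oner_neq0.
by apply: (mulfI t0); rewrite h mulfV.
Qed.

Lemma cis2pi : cis (2 * pi) = 1 :> R[i].
Proof. by rewrite mulr_natl; apply: complex_ext; rewrite /= ?cos2pi ?sin2pi. Qed.

Lemma cisN2pi n : cis (- (n%:R * (2 * pi))) = 1 :> R[i].
Proof. by rewrite -cisV -cisX cis2pi expr1n invr1. Qed.

Lemma ccont_path (T : topologicalType) (c : T -> R[i]) (r t : T -> R) (x : T) :
  ccont c x -> {for x, continuous r} -> {for x, continuous t} ->
  ccont (fun y => c y + (r y)%:C * cis (t y)) x.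
Proof.
move=> cc cr ct; apply: ccontD => //; apply: ccontM; first exact: ccont_real.
exact: (@ccont_comp _ _ _ (@cis R) t x (@ccont_cis _ _) ct).
Qed.

Lemma cder_circle (c : R[i]) (r t : R) :
  cder (fun y => c + r%:C * cis y) t (r%:C * ('i * cis t)).
Proof.
apply: cder_eq (cderD (cder_cst _ _) (cderM (cder_cst _ _) (cder_cis t))) _.
by rewrite add0r mul0r add0r.
Qed.

Lemma integralC_loop (g G : R -> R[i]) : (forall t, cder G t (g t)) -> ccontT g ->
  G (2 * pi) = G 0 -> integralC 0 (2 * pi) g = 0.
Proof.
move=> dG cg G0.
have pi2 : 0 < 2 * pi :> R by apply: mulr_gt0 => //; exact: pi_gt0.
by rewrite (integralC_FTC pi2 dG cg) G0 subrr.
Qed.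

Section Homotopy.
Variables (D : set R[i]) (G G1 : R[i] -> R[i]).
Hypothesis dG : forall (w : R -> R[i]) s d, (forall x, D (w x)) -> cder w s d ->
  cder (fun x => G (w x)) s (G1 (w s) * d).
Hypothesis cG : forall (T : topologicalType) (w : T -> R[i]) x,
  (forall y, D (w y)) -> ccont w x -> ccont (fun y => G (w y)) x.
Hypothesis cG1 : forall (T : topologicalType) (w : T -> R[i]) x,
  (forall y, D (w y)) -> ccont w x -> ccont (fun y => G1 (w y)) x.

Variables (c0 c1 : R[i]) (r0 r1 : R).
Hypothesis HD : forall (p : R) t, 0 <= p <= 1 ->
  D (c0 + p%:C * (c1 - c0) + (r0 + p * (r1 - r0))%:C * cis t).

Let sg s : R := sin s ^+ 2.
Let sg' s : R := 2 * sin s * cos s.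
Let C s : R[i] := c0 + (sg s)%:C * (c1 - c0).
Let r s : R := r0 + sg s * (r1 - r0).
Let w s t : R[i] := C s + (r s)%:C * cis t.
Let ws s t : R[i] := (sg' s)%:C * (c1 - c0) + (sg' s * (r1 - r0))%:C * cis t.

Let sg01 s : 0 <= sg s <= 1.
Proof. by rewrite sqr_ge0/= -(cos2Dsin2 s) lerDr sqr_ge0. Qed.

Let wD s t : D (w s t).
Proof. exact: HD (sg01 s). Qed.

Let dsg s : is_derive s 1 sg (sg' s).
Proof.
have := @is_derive1_fcomp _ (fun x => x ^+ 2) (@sin R) s _ _ (is_derive1X _ 2) (is_derive_sin s).
by rewrite /= expr1.
Qed.

Let dw s t : cder (w^~ t) s (ws s t).
Proof.
have dr : is_derive s 1 r (sg' s * (r1 - r0)).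
  have := is_derive1D (is_derive1_cst r0 s) (is_derive1M (dsg s) (is_derive1_cst (r1 - r0) s)).
  by rewrite mulr0 addr0 add0r.
apply: cder_eq (cderD (cderD (cder_cst _ _) (cderM (cder_real (dsg s)) (cder_cst _ _)))
  (cderM (cder_real dr) (cder_cst _ _))) _.
by rewrite add0r !mulr0 !addr0.
Qed.

Let U s t : R[i] := G (w s t) * ('i * (r s)%:C * cis t).
Let DU s t : R[i] := G1 (w s t) * ws s t * ('i * (r s)%:C * cis t) +
   G (w s t) * ('i * (sg' s * (r1 - r0))%:C * cis t).

(** The circles are interpolated linearly with weight sin^2 s, which makes the
    deformation smooth for all real s while staying between the two circles. The
    s-derivative of the integrand G(w) dw/dt is the t-derivative of G(w) dw/ds, which
    integrates to 0 around the circle. *)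
Lemma circle_homotopy : circle_integral c0 r0 G = circle_integral c1 r1 G.
Proof.
have -> : circle_integral c0 r0 G = integralC 0 (2 * pi) (U 0).
  by rewrite /circle_integral /U /w /C /r /sg sin0 expr0n/= !mul0r !addr0.
have -> : circle_integral c1 r1 G = integralC 0 (2 * pi) (U (pi / 2)).
  rewrite /circle_integral /U /w /C /r /sg sin_pihalf expr1n !mul1r.
  by rewrite !(addrC _ (_ - _)) !subrK.
have csg : continuous sg by move=> s; exact: is_derive1_continuous (dsg s).
have csg' : continuous sg'.
  move=> s; apply: cvgM; last exact: continuous_cos.
  by apply: cvgM; [exact: cvg_cst|exact: continuous_sin].
have cr : continuous r.
  by move=> s; apply: cvgD; [exact: cvg_cst|apply: cvgM; [exact: csg|exact: cvg_cst]].
have cf (f : R -> R) : continuous f -> continuous (fun p : R * R => f p.1).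
  by move=> h p; apply: (@continuous_comp _ _ _ fst f p); [exact: cvg_fst|exact: h].
have c2 (p : R * R) : {for p, continuous (fun p : R * R => p.2)} by exact: cvg_snd.
have cW (p : R * R) : ccont (fun p : R * R => w p.1 p.2) p.
  apply: ccont_path => //; last exact: cf.
  apply: ccontD; first exact: ccont_cst.
  by apply: ccontM; [apply: ccont_real; exact: cf|exact: ccont_cst].
have cWs (p : R * R) : ccont (fun p : R * R => ws p.1 p.2) p.
  apply: (@ccont_path _ _ (fun p : R * R => sg' p.1 * (r1 - r0))) => //.
    by apply: ccontM; [apply: ccont_real; exact: cf|exact: ccont_cst].
  by apply: cvgM; [exact: cf|exact: cvg_cst].
have cE (f : R -> R) (p : R * R) : continuous f -> ccont (fun p : R * R => 'i * (f p.1)%:C * cis p.2) p.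
  move=> h; apply: ccontM; last exact: (@ccont_comp _ _ _ (@cis R) snd p (@ccont_cis _ _)).
  by apply: ccontM; [exact: ccont_cst|apply: ccont_real; exact: cf].
have cDU (p : R * R) : ccont (fun p : R * R => DU p.1 p.2) p.
  apply: ccontD.
    apply: ccontM; last exact: cE.
    by apply: ccontM => //; exact: (cG1 (w := fun p : R * R => w p.1 p.2)).
  apply: ccontM; first exact: (cG (w := fun p : R * R => w p.1 p.2)).
  by apply: (cE (fun s => sg' s * (r1 - r0))) => s; apply: cvgM; [exact: csg'|exact: cvg_cst].
have dwt s t : cder (w s) t ((r s)%:C * ('i * cis t)) by exact: cder_circle.
have cslice (f : R -> R -> R[i]) s : (forall p : R * R, ccont (fun p : R * R => f p.1 p.2) p) ->
    ccontT (f s).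
  move=> h t; apply: (@ccont_comp _ _ _ (fun p : R * R => f p.1 p.2) (fun y => (s, y)) t (h (s, t))).
  rewrite /prop_for /continuous_at.
  by apply: (@cvg_pair _ _ _ (nbhs t) (nbhs s) (nbhs t) _ _ _ (fun=> s) id); [exact: cvg_cst|exact: cvg_id].
apply: (@integralC_param_cst _ _ _ U DU).
- move=> s t; rewrite /U /DU.
  have dG' := dG (fun x => wD x t) (dw s t).
  have dr : is_derive s 1 r (sg' s * (r1 - r0)).
    have := is_derive1D (is_derive1_cst r0 s) (is_derive1M (dsg s) (is_derive1_cst (r1 - r0) s)).
    by rewrite mulr0 addr0 add0r.
  have dE := cderM (cderM (cder_cst s 'i) (cder_real dr)) (cder_cst s (cis t)).
  apply: cder_eq (cderM dG' dE) _.
  by rewrite mul0r add0r mulr0 addr0.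
- exact: cDU.
- move=> s; apply: cslice => p; apply: ccontM; last exact: cE.
  exact: (cG (w := fun p : R * R => w p.1 p.2)).
- move=> s; apply: (@integralC_loop (DU s) (fun t => G (w s t) * ws s t)).
  + move=> t; have dG' := dG (wD s) (dwt s t).
    have dws : cder (ws s) t ((sg' s * (r1 - r0))%:C * ('i * cis t)) by exact: cder_circle.
    apply: cder_eq (cderM dG' dws) _.
    rewrite /DU; move: (G1 _) (G _) (ws s t) (r s)%:C (_ * _)%:C (cis t) => g1 g x y z u.
    by ring.
  + exact: cslice.
  + by rewrite /w /ws cis2pi cis0.
Qed.

End Homotopy.

End Circles.

(** * Fourier coefficients of the power function *)

Section TaylorCoefficients.
Variable R : realType.
Local Notation re := (@complex.Re R).
Local Notation im := (@complex.Im R).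
Implicit Types (s t r a : R).

Lemma Re_circle1 r t : `|r| < 1 -> 0 < re (1 + r%:C * cis t).
Proof.
move=> r1; rewrite cReD cReM/= mul0r subr0 -ltrBlDl sub0r.
have h : `|r * cos t| <= `|r|.
  by rewrite normrM ler_piMr// ler_norml cos_geN1 cos_le1.
by have := le_lt_trans h r1; rewrite ltr_norml => /andP[].
Qed.

Lemma i_neq0 : 'i != 0 :> R[i].
Proof. by apply/eqP => /(congr1 im)/= /eqP; rewrite oner_eq0. Qed.

Lemma realC_neq0 (x : R) : (x%:C != 0 :> R[i]) = (x != 0).
Proof. by rewrite -(inj_eq (@complexI R)). Qed.

Lemma cpow1 a : cpow 1 a = 1 :> R[i].
Proof. by rewrite /cpow nrm1 powR1 /= mul0r atan0 mulr0 cis0 mul1r. Qed.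

Lemma integralC_cst (c : R[i]) : integralC 0 (2 * pi) (fun=> c) = (2 * pi)%:C * c.
Proof.
have pi2 : 0 < 2 * pi :> R by rewrite mulr_gt0 ?pi_gt0.
rewrite (@integralC_FTC _ _ _ (fun=> c) (fun t => t%:C * c))//.
- by rewrite mul0r subr0.
- move=> t; apply: cder_eq (cderM (cder_real (is_derive1_id t)) (cder_cst _ _)) _.
  by rewrite mul1r mulr0 addr0.
- by move=> t; exact: ccont_cst.
Qed.

Lemma ccontV (T : topologicalType) (f : T -> R[i]) (x : T) :
  f x != 0 -> ccont f x -> ccont (fun y => (f y)^-1) x.
Proof.
move=> fx0 [c1 c2].
have N0 : re (f x) ^+ 2 + im (f x) ^+ 2 != 0.
  by rewrite -nrm_sqr sqrf_eq0; apply: contra fx0 => /eqP/nrm0_eq0/eqP.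
have reV (z : R[i]) : re z^-1 = re z / (re z ^+ 2 + im z ^+ 2) by case: z.
have imV (z : R[i]) : im z^-1 = - (im z / (re z ^+ 2 + im z ^+ 2)) by case: z.
have cN : {for x, continuous (fun y => re (f y) ^+ 2 + im (f y) ^+ 2)}.
  by apply: cvgD; rewrite /=; under eq_fun do rewrite expr2; exact: cvgM.
split; rewrite /prop_for.
  by under eq_fun do rewrite reV; apply: cvgM => //; exact: cvgV.
by under eq_fun do rewrite imV; apply: cvgN; apply: cvgM => //; exact: cvgV.
Qed.

Variables (a rho : R).
Hypothesis rho01 : 0 <= rho < 1.

Let pi2 : 0 < 2 * pi :> R. Proof. by rewrite mulr_gt0 ?pi_gt0. Qed.

Definition cpow_fourier m : R[i] :=
  integralC 0 (2 * pi) (fun t => cpow (1 + rho%:C * cis t) a * cis (- (m%:R * t))).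

Let rho1 : `|rho| < 1.
Proof. by case/andP: rho01 => r0 r1; rewrite ger0_norm. Qed.

(** The mean value property: as the circle of radius rho sin s shrinks to its centre
    the average does not change. *)
Lemma cpow_fourier0 : cpow_fourier 0 = (2 * pi)%:C.
Proof.
pose r s : R := rho * sin s.
pose w s t : R[i] := 1 + (r s)%:C * cis t.
pose r' s : R := rho * cos s.
have r1 s : `|r s| < 1.
  apply: le_lt_trans rho1; rewrite normrM ler_piMr// ler_norml.
  by rewrite sin_geN1 sin_le1.
have w0 s t : 0 < re (w s t) by exact: Re_circle1.
pose U s t : R[i] := cpow (w s t) a.
pose DU s t : R[i] := a%:C * cpow (w s t) a / w s t * ((r' s)%:C * cis t).
have wn0 s t : w s t != 0 by apply: contraTneq (w0 s t) => ->; rewrite ltxx.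
have -> : cpow_fourier 0 = integralC 0 (2 * pi) (U (pi / 2)).
  apply: eq_integralC => t; rewrite mul0r oppr0 cis0 mulr1.
  by rewrite /U /w /r sin_pihalf mulr1.
have -> : (2 * pi)%:C = integralC 0 (2 * pi) (U 0).
  rewrite -[LHS]mulr1 -integralC_cst; apply: eq_integralC => t.
  by rewrite /U /w /r sin0 mulr0 mul0r addr0 cpow1.
have cf (f : R -> R) : continuous f -> continuous (fun p : R * R => f p.1).
  by move=> h p; apply: (@continuous_comp _ _ _ fst f p); [exact: cvg_fst|exact: h].
have c2 (p : R * R) : {for p, continuous (fun p : R * R => p.2)} by exact: cvg_snd.
have cr : continuous r.
  by move=> s; apply: cvgM; [exact: cvg_cst|exact: continuous_sin].
have cr' : continuous r'.
  by move=> s; apply: cvgM; [exact: cvg_cst|exact: continuous_cos].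
have cW (p : R * R) : ccont (fun p : R * R => w p.1 p.2) p.
  by apply: ccont_path => //; [exact: ccont_cst|exact: cf].
have cP (p : R * R) : ccont (fun p : R * R => U p.1 p.2) p.
  exact: (@ccont_cpow _ _ (fun p : R * R => w p.1 p.2)).
have cDU (p : R * R) : ccont (fun p : R * R => DU p.1 p.2) p.
  apply: ccontM.
    apply: ccontM; last exact: (@ccontV _ (fun p : R * R => w p.1 p.2)).
    by apply: ccontM => //; exact: ccont_cst.
  apply: ccontM; first by apply: ccont_real; exact: cf.
  exact: (@ccont_comp _ _ _ (@cis R) snd p (@ccont_cis _ _)).
have cslice (f : R -> R -> R[i]) s : (forall p : R * R, ccont (fun p : R * R => f p.1 p.2) p) ->
    ccontT (f s).
  move=> h t; apply: (@ccont_comp _ _ _ (fun p : R * R => f p.1 p.2) (fun y => (s, y)) t (h (s, t))).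
  rewrite /prop_for /continuous_at.
  by apply: (@cvg_pair _ _ _ (nbhs t) (nbhs s) (nbhs t) _ _ _ (fun=> s) id); [exact: cvg_cst|exact: cvg_id].
apply: (@integralC_param_cst _ _ _ U DU) => //.
- move=> s t; apply: cder_cpow => //.
  have dr : is_derive s 1 r (r' s) by exact: (is_derive1Z rho (is_derive_sin s)).
  apply: cder_eq (cderD (cder_cst _ _) (cderM (cder_real dr) (cder_cst _ _))) _.
  by rewrite add0r mulr0 addr0.
- by move=> s; exact: cslice.
- move=> s; have [r0|r0] := eqVneq (r s) 0.
    pose K := a%:C * cpow 1 a * (r' s)%:C.
    have E t : DU s t = K * cis t.
      by rewrite /DU /w r0 mul0r addr0 divr1 /K mulrA.
    apply: (@integralC_loop _ (DU s) (fun t => K * cis t / 'i)).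
    + move=> t; apply: cder_eq (cderM (cderM (cder_cst _ _) (cder_cis _)) (cder_cst _ _)) _.
      by rewrite E mul0r add0r mulr0 addr0; field; exact: i_neq0.
    + exact: cslice.
    + by rewrite cis2pi cis0.
  pose k := (r' s)%:C / ((r s)%:C * 'i).
  apply: (@integralC_loop _ (DU s) (fun t => U s t * k)).
  + move=> t.
    have dP := cder_cpow (w0 s) (cder_circle 1 (r s) t) a.
    apply: cder_eq (cderM dP (cder_cst _ k)) _.
    rewrite mulr0 addr0 /DU /k -/(w s t).
    by field; rewrite i_neq0 wn0 realC_neq0 r0.
  + exact: cslice.
  + by rewrite /U /w cis2pi cis0.
Qed.

(** With w = 1 + rho e^(it) and f = w^a, the derivative of w f e^(- i (m + 1) t)
    integrates to 0 around the circle; since w f' = a f w', this relates two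
    consecutive coefficients. *)
Lemma cpow_fourierS m :
  m.+1%:R%:C * cpow_fourier m.+1 = ((a - m%:R) * rho)%:C * cpow_fourier m.
Proof.
pose w t : R[i] := 1 + rho%:C * cis t.
have w0 t : 0 < re (w t) by exact: Re_circle1.
have wn0 t : w t != 0 by apply: contraTneq (w0 t) => ->; rewrite ltxx.
pose f t : R[i] := cpow (w t) a.
pose e n t : R[i] := cis (- (n%:R * t)).
have cw t : ccont w t by exact: cder_ccont (cder_circle _ _ _).
have cf t : ccont f t by exact: (@ccont_cpow _ _ w).
have de n t : cder (e n) t ('i * e n t * (- n%:R)%:C).
  apply: (@cder_comp _ (@cis R) (fun t => - (n%:R * t)) t _ _ (cder_cis _)).
  by apply: is_derive1N; have := is_derive1Z n%:R (is_derive1_id t); rewrite mulr1.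
have ce n t : ccont (e n) t by exact: cder_ccont (de n t).
have cfe n : ccontT (fun t => f t * e n t) by move=> t; exact: ccontM.
have eS t : cis t * e m.+1 t = e m t.
  by rewrite /e -cisD; congr cis; rewrite -natr1; ring.
pose c1 := 'i * ((a - m%:R) * rho)%:C : R[i]; pose c2 := - 'i * m.+1%:R%:C : R[i].
have cc c n : ccontT (fun t => c * (f t * e n t)).
  by move=> t; apply: ccontM; [exact: ccont_cst|exact: cfe].
have : integralC 0 (2 * pi) (fun t => c1 * (f t * e m t) + c2 * (f t * e m.+1 t)) = 0.
  apply: (@integralC_loop _ _ (fun t => w t * f t * e m.+1 t)).
  - move=> t; have dw := cder_circle 1 rho t.
    apply: cder_eq (cderM (cderM dw (cder_cpow w0 dw a)) (de m.+1 t)) _.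
    rewrite -[1 + rho%:C * cis t]/(w t) -/(f t) -eS /c1 /c2 -natr1.
    rewrite !(rmorphN (real_complex R), rmorphM (real_complex R), rmorphD (real_complex R)) /=.
    have := wn0 t; rewrite /w; move: (f t) (cis t) (e _ t) (rho%:C) (a%:C) (m%:R%:C).
    by move=> F c E r A M r0; rewrite rmorph1; field.
  - by move=> t; apply: ccontD; exact: cc.
  - by rewrite /f /w /e cis2pi cis0 mulr0 oppr0 cis0 cisN2pi.
rewrite integralCD; [|exact: cc|exact: cc].
rewrite !integralCZ; [|exact: cfe|exact: cfe].
rewrite /c1 /c2 -!mulrA -/(cpow_fourier m) -/(cpow_fourier m.+1) mulNr -mulrBr => /eqP.
by rewrite mulf_eq0 (negPf i_neq0) /= subr_eq0 => /eqP ->.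
Qed.

Lemma cpow_fourierE m : cpow_fourier m = (2 * pi * nbin (- a) m * (- rho) ^+ m)%:C.
Proof.
elim: m => [|m IH]; first by rewrite cpow_fourier0 nbin_0 !mulr1.
have m0 : m.+1%:R%:C != 0 :> R[i] by rewrite realC_neq0 pnatr_eq0.
apply: (mulfI m0); rewrite cpow_fourierS IH -!(rmorphM (real_complex R)); congr (_%:C).
transitivity (2 * pi * (- rho) ^+ m.+1 * (m.+1%:R * nbin (- a) m.+1)); last by ring.
by rewrite nbinS_mul exprS; ring.
Qed.

End TaylorCoefficients.

(** * Operator powers as binomial series *)

Section OperatorPower.
Variable R : realType.
Local Notation re := (@complex.Re R).
Local Notation im := (@complex.Im R).
Variable V : normedModType R[i].
Hypothesis cV : nrm_complete V.

Lemma nspectrum (A B : bop V V) l :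
  bcomp B (l *: bid V - A) = bid V -> bcomp (l *: bid V - A) B = bid V ->
  ~ spectrum A l.
Proof. by move=> h1 h2; apply; exists B. Qed.

Section NearIdentity.
Variable N : bop V V.
Hypothesis N1 : nrm N < 1.
Let A := bid V - N.
Local Notation Rs := (resolvent A).

Lemma spectrum_near1 l : nrm N < nrm (l - 1) -> ~ spectrum A l.
Proof.
move=> Nl; pose u := l - 1.
have u0 : u != 0.
  by apply: contraTneq Nl => h; rewrite -/u h nrm0 -leNgt nrm_ge0.
have M1 : nrm (- u^-1 *: N) < 1.
  by rewrite nrmZ nrmN nrmV mulrC ltr_pdivrMr ?mul1r// (le_lt_trans _ Nl)// nrm_ge0.
have [h1 h2] := binseries_inv cV M1.
have E : l *: bid V - A = u *: (bid V - - u^-1 *: N).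
  rewrite scalerBr scalerA mulrN mulfV// scaleN1r opprK /A opprB /u scalerBl scale1r.
  by rewrite addrA addrAC.
apply: (@nspectrum _ (u^-1 *: binseries 1 (- u^-1 *: N))).
  by rewrite E bcompZl bcompZr scalerA mulVf// scale1r.
by rewrite E bcompZl bcompZr scalerA mulfV// scale1r.
Qed.

Variable rho : R.
Hypothesis Nrho : nrm N < rho.

Let rho0 : 0 < rho. Proof. exact: le_lt_trans (nrm_ge0 N) Nrho. Qed.

Let u t : R[i] := rho%:C * cis t.

Let nu t : nrm (u t) = rho.
Proof. by rewrite /u nrmM nrm_cis mulr1 nrmR gtr0_norm. Qed.

Let u0 t : u t != 0.
Proof. by apply: contraTneq rho0 => h; rewrite -(nu t) h nrm0 ltxx. Qed.

Lemma nspectrum_circle1 t : ~ spectrum A (1 + u t).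
Proof. by apply: spectrum_near1; rewrite addrC addKr nu. Qed.

Lemma resolvent_step t : u t *: Rs (1 + u t) = bid V - bcomp N (Rs (1 + u t)).
Proof.
have [_] := resolventP (@nspectrum_circle1 t).
have -> : (1 + u t) *: bid V - A = u t *: bid V + N.
  by rewrite /A scalerDl scale1r opprB addrC addrA subrK addrC.
by rewrite bcompDl bcompZl bcomp1l => <-; rewrite addrK.
Qed.

Lemma nrm_resolvent_circle1 t : nrm (Rs (1 + u t)) <= (rho - nrm N)^-1.
Proof.
have h : rho * nrm (Rs (1 + u t)) <= 1 + nrm N * nrm (Rs (1 + u t)).
  rewrite -(nu t) -nrmZ resolvent_step (le_trans (nrmB _ _))// lerD ?nrm_bid_le1//.
  exact: nrm_bcomp.
by rewrite -[leRHS]mul1r ler_pdivlMr ?subr_gt0// mulrC mulrBl lerBlDr.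
Qed.

(** The geometric expansion of the resolvent at infinity, with its remainder. *)
Lemma resolvent_neumann t m :
  u t *: Rs (1 + u t) = \sum_(0 <= n < m) (- (u t)^-1) ^+ n *: bpow N n +
    (- (u t)^-1) ^+ m *: bcomp (bpow N m) (u t *: Rs (1 + u t)).
Proof.
elim: m => [|m IH].
  by rewrite big_geq// add0r expr0 scale1r /= bcomp1l.
rewrite [LHS]IH big_nat_recr//= -addrA; congr (_ + _).
rewrite [in LHS]resolvent_step bcompBr bcomp1r scalerBr exprSr; congr (_ + _).
rewrite -scalerA -scalerN; congr (_ *: _).
rewrite bcompZr scalerA mulNr mulVf// scaleN1r bcompA; congr (- bcomp _ _).
by rewrite bpowSr.
Qed.

Variables (a : R) (phi : bop (bop V V) R[i]^o).
Hypothesis rho1 : rho < 1.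

Let f t : R[i] := cpow (1 + u t) a.
Let e n t : R[i] := cis (- (n%:R * t)).

Let w0 t : 0 < re (1 + u t).
Proof. by apply: Re_circle1; rewrite gtr0_norm. Qed.

Let nrm_f t : nrm (f t) <= 2 `^ `|a| + (1 - rho) `^ (- `|a|).
Proof.
have b0 : 0 < 1 - rho by rewrite subr_gt0.
have lo : 1 - rho <= nrm (1 + u t).
  rewrite lerBlDr -(nu t) -[leLHS](@nrm1 R) -{1}(addrK (u t) 1).
  exact: nrmB.
have hi : nrm (1 + u t) <= 2.
  by rewrite (le_trans (nrmD _ _))// nrm1 nu (_ : 2 = 1 + 1)// lerD2l ltW.
have pos : 0 < nrm (1 + u t) by exact: lt_le_trans lo.
rewrite /f /cpow nrmM nrm_cis mulr1 nrmR ger0_norm ?powR_ge0//.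
have [a0|a0] := leP 0 a.
  rewrite ger0_norm// (le_trans (_ : _ <= 2 `^ a))// ?lerDl ?powR_ge0//.
  by rewrite ge0_ler_powR ?nnegrE// ltW.
rewrite ltr0_norm// opprK (le_trans (_ : _ <= (1 - rho) `^ a))// ?lerDr ?powR_ge0//.
rewrite -(opprK a) !(powRN _ (- a)) lef_pV2 ?posrE ?powR_gt0//.
by rewrite ge0_ler_powR ?nnegrE ?oppr_ge0// ltW.
Qed.

(** On a circle centred at 1 the Fourier coefficients of l^a turn the expansion of the
    resolvent into the binomial series; the remainder is of order (|N| / rho)^m. *)
Lemma circle_integral_power :
  circle_integral 1 rho (fun l => cpow l a * phi (Rs l)) =
  2 * 'i * pi%:C * phi (binseries (- a) N).
Proof.
have rho01 : 0 <= rho < 1 by rewrite ltW.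
pose J := circle_integral 1 rho (fun l => cpow l a * phi (Rs l)).
have cw t : ccont (fun t => 1 + u t) t by exact: cder_ccont (cder_circle _ _ _).
have cu t : ccont u t.
  by apply: ccontM; [exact: ccont_cst|exact: ccont_cis].
have cf t : ccont f t by exact: (@ccont_cpow _ _ (fun t => 1 + u t)).
have ce n t : ccont (e n) t.
  have dn := is_derive1N (is_derive1Z n%:R (is_derive1_id t)).
  exact: (cder_ccont (@cder_comp _ (@cis R) (fun t => - (n%:R * t)) t _ _ (cder_cis _) dn)).
have cfe n : ccontT (fun t => f t * e n t) by move=> t; exact: ccontM.
have cR (C : bop V V) t : ccont (fun t => phi (bcomp C (Rs (1 + u t)))) t.
  apply: (@ccont_resolvent _ _ A _ (fun t => 1 + u t) t (fun X => phi (bcomp C X)) (nrm phi * nrm C)) => //.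
    by move=> y; exact: nspectrum_circle1.
  move=> X Y; rewrite -[phi _ - _]/(phi _ - phi _ : R[i]^o) -linearB -bcompBr.
  apply: le_trans (nrm_app phi _) _; rewrite -!mulrA ler_wpM2l ?nrm_ge0//.
  apply: le_trans (nrm_bcomp _ _) _; rewrite ler_wpM2l ?nrm_ge0//.
  by rewrite ler_peMl ?nrm_ge0// -addrA lerDl addr_ge0 ?nrm_ge0.
have uV t n : (- (u t)^-1) ^+ n = ((- rho^-1) ^+ n)%:C * e n t.
  have -> : - (u t)^-1 = (- rho^-1)%:C * cis (- t).
    by rewrite /u invfM cisV (rmorphN (real_complex R)) (fmorphV (real_complex R)) mulNr.
  by rewrite exprMn cisX (rmorphXn (real_complex R)) mulrN.
have J1 m : J = 2 * 'i * pi%:C * phi (binsum (- a) N m) +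
    integralC 0 (2 * pi) (fun t => 'i * ((- rho^-1) ^+ m)%:C * ((f t * e m t) * (u t * phi (bcomp (bpow N m) (Rs (1 + u t)))))).
  pose g t := \sum_(0 <= n < m) ('i * ((- rho^-1) ^+ n)%:C * phi (bpow N n)) * (f t * e n t).
  pose rem t := 'i * ((- rho^-1) ^+ m)%:C * ((f t * e m t) * (u t * phi (bcomp (bpow N m) (Rs (1 + u t))))).
  have E t : cpow (1 + u t) a * phi (Rs (1 + u t)) * ('i * rho%:C * cis t) = g t + rem t.
    have := congr1 phi (resolvent_neumann t m).
    rewrite linearD linear_sum bcompZr !linearZ/= => h.
    transitivity ('i * f t * (u t * phi (Rs (1 + u t)))).
      by rewrite /f /u; ring.
    rewrite [u t * _]h mulrDr /g /rem mulr_sumr; congr (_ + _).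
      apply: eq_bigr => n _; rewrite linearZ/= uV.
      by rewrite -[_ *: _]/(_ * _); ring.
    by rewrite uV -[_ *: _]/(_ * _) -[u t *: _]/(u t * _); ring.
  have cg k (c : nat -> R[i]) : ccontT (fun t => \sum_(0 <= n < k) c n * (f t * e n t)) /\
      integralC 0 (2 * pi) (fun t => \sum_(0 <= n < k) c n * (f t * e n t)) =
      \sum_(0 <= n < k) c n * cpow_fourier a rho n.
    elim: k => [|k [IH1 IH2]].
      rewrite big_geq//; split; first by move=> t; under eq_fun do rewrite big_geq//; exact: ccont_cst.
      rewrite -[RHS](mulr0 (2 * pi)%:C) -integralC_cst; apply: eq_integralC => t.
      by rewrite big_geq.
    have ck : ccontT (fun t => c k * (f t * e k t)).
      by move=> t; apply: ccontM; [exact: ccont_cst|exact: cfe].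
    have Ek : (fun t => \sum_(0 <= n < k.+1) c n * (f t * e n t)) =
       (fun t => \sum_(0 <= n < k) c n * (f t * e n t) + c k * (f t * e k t)).
      by apply/funext => t; rewrite big_nat_recr.
    rewrite Ek big_nat_recr//=; split; first by move=> t; exact: ccontD.
    by rewrite integralCD// integralCZ// IH2.
  have crem : ccontT rem.
    move=> t; apply: ccontM; first exact: ccont_cst.
    apply: ccontM; first exact: cfe.
    by apply: ccontM; [exact: cu|exact: cR].
  have [cg1 cg2] := cg m (fun n => 'i * ((- rho^-1) ^+ n)%:C * phi (bpow N n)).
  rewrite /J /circle_integral (eq_integralC _ _ E) integralCD//; congr (_ + _).
  rewrite cg2 /binsum linear_sum mulr_sumr; apply: eq_bigr => n _.
  rewrite cpow_fourierE// linearZ/= -[_ *: _]/(_ * _).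
  have -> : (2 * pi * nbin (- a) n * (- rho) ^+ n)%:C =
     2 * pi%:C * (nbin (- a) n)%:C * ((- rho) ^+ n)%:C :> R[i].
    by rewrite !(rmorphM (real_complex R)) rmorph_nat.
  have : ((- rho^-1) ^+ n)%:C * ((- rho) ^+ n)%:C = 1 :> R[i].
    by rewrite -(rmorphM (real_complex R)) -exprMn mulrNN mulVf ?gt_eqF// expr1n rmorph1.
  move: ((- rho^-1) ^+ n)%:C ((- rho) ^+ n)%:C => x y xy.
  rewrite -[RHS]mulr1 -xy.
  by move: (pi%:C) (phi _) => p X; ring.
pose K := 2 * ((2 `^ `|a| + (1 - rho) `^ (- `|a|)) * rho * (nrm phi * (rho - nrm N)^-1) * (2 * pi - 0)).
have K0 : 0 <= K.
  rewrite !mulr_ge0 ?addr_ge0 ?powR_ge0 ?nrm_ge0 ?invr_ge0 ?subr_ge0 ?(ltW rho0) ?(ltW Nrho)//.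
  by rewrite mulr_ge0 ?pi_ge0.
pose p := nrm N / rho.
have p0 : 0 <= p by rewrite divr_ge0 ?nrm_ge0 ?(ltW rho0).
have p1 : p < 1 by rewrite ltr_pdivrMr// mul1r.
have J2 m : nrm (J - 2 * 'i * pi%:C * phi (binsum (- a) N m)) <= K * p ^+ m.
  rewrite (J1 m) addrAC subrr add0r.
  apply: le_trans (integralC_bound (M := p ^+ m * ((2 `^ `|a| + (1 - rho) `^ (- `|a|)) * rho * (nrm phi * (rho - nrm N)^-1))) _ _ _) _.
  - by rewrite mulr_ge0 ?pi_ge0.
  - move=> t; apply: ccontM; first exact: ccont_cst.
    apply: ccontM; first exact: cfe.
    by apply: ccontM; [exact: cu|exact: cR].
  - move=> t; rewrite nrmM (nrmM 'i) (nrmM (f t * _)) (nrmM (f t)) (nrmM (u t)) nrmi mul1r nrmR /e nrm_cis mulr1 nu.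
    rewrite normrX normrN ger0_norm ?invr_ge0 ?(ltW rho0)//.
    have h : nrm (phi (bcomp (bpow N m) (Rs (1 + u t)))) <= nrm phi * (nrm N ^+ m * (rho - nrm N)^-1).
      apply: le_trans (nrm_app phi _) _; rewrite ler_wpM2l ?nrm_ge0//.
      apply: le_trans (nrm_bcomp _ _) _.
      by apply: ler_pM; rewrite ?nrm_ge0 ?nrm_bpow ?nrm_resolvent_circle1.
    apply: (@le_trans _ _ (rho^-1 ^+ m * ((2 `^ `|a| + (1 - rho) `^ (- `|a|)) * (rho * (nrm phi * (nrm N ^+ m * (rho - nrm N)^-1)))))).
      rewrite ler_wpM2l ?exprn_ge0 ?invr_ge0 ?(ltW rho0)//.
      apply: ler_pM; rewrite ?nrm_ge0 ?mulr_ge0 ?nrm_ge0 ?(ltW rho0)//.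
      by rewrite ler_wpM2l ?(ltW rho0).
    rewrite le_eqVlt; apply/orP; left; apply/eqP.
    by rewrite /p exprMn; ring.
  - rewrite le_eqVlt; apply/orP; left; apply/eqP.
    by rewrite /K; ring.
apply: (@nrm_cvg_unique R R[i]^o (fun m => 2 * 'i * pi%:C * phi (binsum (- a) N m))).
  move=> d d0; have K1 : 0 < K + 1 by rewrite ltr_wpDl.
  have cp : p ^+ m @[m --> \oo] --> (0 : R) by apply: cvg_expr; rewrite ger0_norm.
  have /cvgrPdist_le /(_ (d / (K + 1)) (divr_gt0 d0 K1)) [m0 _ hm0] := cp.
  exists m0 => m /hm0; rewrite sub0r normrN ger0_norm ?exprn_ge0// => hm.
  rewrite nrmBC; apply: le_trans (J2 m) _.
  apply: (@le_trans _ _ (p ^+ m * (K + 1))).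
    by rewrite mulrC ler_wpM2l ?exprn_ge0// lerDl.
  by rewrite -ler_pdivlMr.
apply: (@nrm_cvg_map _ _ _ _ _ (fun X => 2 * 'i * pi%:C * phi X : R[i]^o) (nrm (2 * 'i * pi%:C : R[i]) * nrm phi) _ (binseriesP cV (- a) N1)) => X.
rewrite -mulrBr nrmM -[leRHS]mulrA ler_wpM2l ?nrm_ge0//.
have -> : phi X - phi (binseries (- a) N) = phi (X - binseries (- a) N) by rewrite linearB.
exact: (nrm_app phi).
Qed.

End NearIdentity.

Lemma right_half_plane_circle (c : R[i]) rho t : 0 < rho ->
  [set l | nrm (l - c) <= rho] `<=` @right_half_plane R ->
  0 < re (c + rho%:C * cis t).
Proof.
move=> rho0 sub; apply: sub => /=.
by rewrite addrC addKr nrmM nrm_cis mulr1 nrmR gtr0_norm.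
Qed.

(** Cauchy's theorem: the interpolated circles stay in the half-plane and keep
    enclosing the spectrum, both conditions being convex in the centre and radius. *)
Lemma circle_integral_indep (A : bop V V) (a : R) (phi : bop (bop V V) R[i]^o)
    (c0 c1 : R[i]) (r0 r1 : R) : 0 < r0 -> 0 < r1 ->
  [set l | nrm (l - c0) <= r0] `<=` @right_half_plane R ->
  [set l | nrm (l - c1) <= r1] `<=` @right_half_plane R ->
  spectrum A `<=` [set l | nrm (l - c0) < r0] ->
  spectrum A `<=` [set l | nrm (l - c1) < r1] ->
  circle_integral c0 r0 (fun l => cpow l a * phi (resolvent A l)) =
  circle_integral c1 r1 (fun l => cpow l a * phi (resolvent A l)).
Proof.
move=> r00 r10 H0 H1 S0 S1.
pose D : set R[i] := [set l | 0 < re l /\ ~ spectrum A l].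
pose G1 l : R[i] := a%:C * cpow l a / l * phi (resolvent A l) -
  cpow l a * phi (bcomp (resolvent A l) (resolvent A l)).
apply: (@circle_homotopy _ D _ G1).
- move=> w s d Dw dw.
  have dP := cder_cpow (fun x => (Dw x).1) dw a.
  have dR := cder_resolvent phi (fun x => (Dw x).2) dw.
  apply: cder_eq (cderM dP dR) _; rewrite /G1.
  by move: (cpow _ _) (phi _ : R[i]) (phi _ : R[i]) => p q q'; ring.
- move=> T w x Dw cw; apply: ccontM.
    by apply: ccont_cpow => // y; have [] := Dw y.
  have := @ccont_phi_resolvent _ _ A phi T w x (bid V) (fun y => (Dw y).2) cw.
  by under eq_fun do rewrite bcomp1r.
- move=> T w x Dw cw.
  have cp := ccont_cpow a (fun y => (Dw y).1) cw.
  have c1' := @ccont_phi_resolvent _ _ A phi T w x (bid V) (fun y => (Dw y).2) cw.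
  have c1'' : ccont (fun y => phi (resolvent A (w y))) x.
    by move: c1'; under eq_fun do rewrite bcomp1r.
  have wx0 : w x != 0 by apply: contraTneq (Dw x).1 => ->; rewrite ltxx.
  apply: ccontD.
    apply: ccontM => //; apply: ccontM; last exact: ccontV.
    by apply: ccontM => //; exact: ccont_cst.
  apply: ccontN; apply: ccontM => //.
  exact: (ccont_resolvent_sq phi (fun y => (Dw y).2) cw).
- move=> p t /andP[p0 p1]; split.
    have h0 := right_half_plane_circle t r00 H0; have h1 := right_half_plane_circle t r10 H1.
    have -> : c0 + p%:C * (c1 - c0) + (r0 + p * (r1 - r0))%:C * cis t =
      (1 - p)%:C * (c0 + r0%:C * cis t) + p%:C * (c1 + r1%:C * cis t).
      rewrite !(rmorphD (real_complex R), rmorphM (real_complex R), rmorphN (real_complex R)) /= rmorph1.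
      by ring.
    rewrite cReD !cReM /= !mul0r !subr0.
    have [p1'|p1'] := eqVneq p 1; first by rewrite p1' subrr mul0r add0r mul1r.
    apply: ltr_wpDr; first by rewrite mulr_ge0// ltW.
    by rewrite mulr_gt0// subr_gt0 lt_neqAle p1' p1.
  (* A point of the spectrum lies inside both circles, hence inside their
     convex combination, and cannot be on it. *)
  move=> Sp; have := S0 _ Sp; have := S1 _ Sp => /=.
  set l := _ + _ * cis t => l1 l0.
  have : nrm (l - (c0 + p%:C * (c1 - c0))) = r0 + p * (r1 - r0).
    rewrite /l [_ + _ * cis t]addrC addrK nrmM nrm_cis mulr1 nrmR ger0_norm//.
    have -> : r0 + p * (r1 - r0) = (1 - p) * r0 + p * r1 by ring.
    by rewrite addr_ge0// mulr_ge0 ?subr_ge0// ltW.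
  have -> : l - (c0 + p%:C * (c1 - c0)) = (1 - p)%:C * (l - c0) + p%:C * (l - c1).
    rewrite (rmorphD (real_complex R)) (rmorphN (real_complex R)) rmorph1.
    by move: l {l1 l0} => l; ring.
  have := nrmD ((1 - p)%:C * (l - c0)) (p%:C * (l - c1)).
  rewrite !nrmM !nrmR (ger0_norm p0) ger0_norm ?subr_ge0// => h E.
  suff : (1 - p) * nrm (l - c0) + p * nrm (l - c1) < r0 + p * (r1 - r0).
    by rewrite -E ltNge h.
  have -> : r0 + p * (r1 - r0) = (1 - p) * r0 + p * r1 by ring.
  have [->|pn0] := eqVneq p 0; first by rewrite subr0 !mul1r !mul0r !addr0.
  apply: ler_ltD; first by rewrite ler_wpM2l ?subr_ge0// ltW.
  by rewrite ltr_pM2l// lt_neqAle eq_sym pn0.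
Qed.

Lemma two_ipi_neq0 : 2 * 'i * pi%:C != 0 :> R[i].
Proof. by rewrite !mulf_neq0 ?i_neq0 ?pnatr_eq0// realC_neq0 gt_eqF// pi_gt0. Qed.

Lemma disc1_right_half_plane rho : rho < 1 ->
  [set l | nrm (l - 1) <= rho] `<=` @right_half_plane R.
Proof.
move=> rho1 l /= h; rewrite /right_half_plane/=.
have := le_lt_trans (le_trans (Re_le_nrm _) h) rho1.
by rewrite ltr_norml cReD cReN/= ltrBrDr addNr => /andP[].
Qed.

(** The circles centred at 1 show that the power exists and what it is; any other
    admissible circle is homotopic to one of these. Functionals are all that a weak
    integral determines. *)
Lemma opow_binseries (N : bop V V) (a : R) (phi : bop (bop V V) R[i]^o) : nrm N < 1 ->
  phi (opow (bid V - N) a) = phi (binseries (- a) N).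
Proof.
move=> N1; have N0 := nrm_ge0 N.
pose rho := (1 + nrm N) / 2.
have rho1 : rho < 1 by rewrite /rho ltr_pdivrMr// mul1r ltrD2l.
have Nrho : nrm N < rho by rewrite /rho ltr_pdivlMr// mulr_natr mulr2n ltrD2r.
have rho0 : 0 < rho by exact: le_lt_trans Nrho.
have H1 := disc1_right_half_plane rho1.
have S1 : spectrum (bid V - N) `<=` [set l | nrm (l - 1) < rho].
  move=> l Sl /=; rewrite ltNge; apply/negP => h.
  exact: (spectrum_near1 (lt_le_trans Nrho h) Sl).
have fcB : is_funcalc (fun l => cpow l a) (bid V - N) (binseries (- a) N).
  exists 1, rho; split => // psi.
  by rewrite circle_integral_power// mulKf// two_ipi_neq0.
rewrite /opow /funcalc; case: xgetP => [B _ [c [r [r0 H0 S0 EB]]]|].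
  rewrite EB (circle_integral_indep a phi r0 rho0 H0 H1 S0 S1).
  by rewrite circle_integral_power// mulKf// two_ipi_neq0.
by move=> /(_ (binseries (- a) N)).
Qed.

End OperatorPower.

(** * Inner products, Riesz representation, adjoints *)

Section InnerProduct.
Variable R : realType.
Local Notation re := (@complex.Re R).
Local Notation im := (@complex.Im R).
Variable H : hilbertType R.
Implicit Types (x y z : H) (a : R[i]).

Lemma innerDl x y z : inner (x + y) z = inner x z + inner y z.
Proof. exact: linearDl. Qed.
Lemma innerDr x y z : inner x (y + z) = inner x y + inner x z.
Proof. exact: linearDr. Qed.
Lemma innerZl a x y : inner (a *: x) y = a * inner x y.
Proof. exact: linearZl_LR. Qed.
Lemma innerZr a x y : inner x (a *: y) = a^* * inner x y.
Proof. exact: linearZr_LR. Qed.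
Lemma innerC x y : inner y x = (inner x y)^*.
Proof. by rewrite (hermC inner y x) /= expr0 mul1r. Qed.

Definition rip x y : R := re (inner x y).

Lemma ripC x y : rip x y = rip y x.
Proof. by rewrite /rip (innerC x y); case: (inner x y). Qed.

Lemma ripDl x y z : rip (x + y) z = rip x z + rip y z.
Proof. by rewrite /rip innerDl cReD. Qed.
Lemma ripDr x y z : rip x (y + z) = rip x y + rip x z.
Proof. by rewrite ripC ripDl !(ripC x). Qed.
Lemma ripZl (t : R) x y : rip (t%:C *: x) y = t * rip x y.
Proof. by rewrite /rip innerZl cReM/= mul0r subr0. Qed.
Lemma ripZr (t : R) x y : rip x (t%:C *: y) = t * rip x y.
Proof. by rewrite ripC ripZl ripC. Qed.
Lemma ripNl x y : rip (- x) y = - rip x y.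
Proof. by rewrite /rip linearNl cReN. Qed.
Lemma ripNr x y : rip x (- y) = - rip x y.
Proof. by rewrite ripC ripNl ripC. Qed.
Lemma ripBl x y z : rip (x - y) z = rip x z - rip y z.
Proof. by rewrite ripDl ripNl. Qed.
Lemma ripBr x y z : rip x (y - z) = rip x y - rip x z.
Proof. by rewrite ripDr ripNr. Qed.
Lemma rip0l x : rip 0 x = 0.
Proof. by rewrite -(subrr 0) ripBl subrr. Qed.
Lemma ripxx x : rip x x = nrm x ^+ 2.
Proof. by rewrite /rip inner_norm nrmE -rmorphXn. Qed.
Lemma rip_iZl x y : rip ('i *: x) y = - im (inner x y).
Proof. by rewrite /rip innerZl cReM/= mul0r mul1r sub0r. Qed.

Lemma rip_suml (I : Type) (r : seq I) (P : pred I) (f : I -> H) y :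
  rip (\sum_(i <- r | P i) f i) y = \sum_(i <- r | P i) rip (f i) y.
Proof. by elim/big_rec2: _ => [|i a b _ <-]; [exact: rip0l|rewrite ripDl]. Qed.

Lemma rip_sumr (I : Type) (r : seq I) (P : pred I) (f : I -> H) y :
  rip y (\sum_(i <- r | P i) f i) = \sum_(i <- r | P i) rip y (f i).
Proof. by rewrite ripC rip_suml; apply: eq_bigr => i _; rewrite ripC. Qed.

Lemma nrmD_sqr x y : nrm (x + y) ^+ 2 = nrm x ^+ 2 + 2 * rip x y + nrm y ^+ 2.
Proof. by rewrite -!ripxx ripDl !ripDr (ripC y x); ring. Qed.

Lemma rip_CS x y : `|rip x y| <= nrm x * nrm y.
Proof.
suff key u v : rip u v <= nrm u * nrm v.
  by rewrite ler_norml key andbT lerNl -ripNl -(nrmN x) key.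
have [->|u0] := eqVneq u 0; first by rewrite rip0l nrm0 mul0r.
have [->|v0] := eqVneq v 0; first by rewrite ripC rip0l nrm0 mulr0.
have pos w : w != 0 -> 0 < nrm (w : H).
  by move=> w0; rewrite lt_neqAle nrm_ge0 andbT eq_sym; apply: contra w0 => /eqP/nrm0_eq0/eqP.
have nu := pos _ u0; have nv := pos _ v0.
have : 0 <= nrm ((nrm v)%:C *: u - (nrm u)%:C *: v) ^+ 2 by rewrite sqr_ge0.
rewrite nrmD_sqr ripNr ripZl ripZr nrmN !nrmZ !nrmR !ger0_norm ?nrm_ge0//.
move: (rip u v) (nrm u) (nrm v) nu nv => p m n m0 n0.
have mn : 0 < m * n by rewrite mulr_gt0.
rewrite (_ : _ + _ = 2 * (m * n) * (m * n - p)); last by ring.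
by rewrite pmulr_rge0 ?mulr_gt0// subr_ge0.
Qed.

Lemma inner_ext x y : (forall z, rip z x = rip z y) -> x = y.
Proof.
move=> h; apply/eqP; rewrite -subr_eq0; apply/eqP/nrm0_eq0/eqP.
by rewrite -sqrf_eq0 -ripxx ripBr h subrr.
Qed.

Lemma inner_ext_full (f g : H -> R[i]) :
  (forall x, f ('i *: x) = 'i * f x) -> (forall x, g ('i *: x) = 'i * g x) ->
  (forall x, re (f x) = re (g x)) -> f =1 g.
Proof.
move=> hf hg h x; apply: complex_ext; first exact: h.
have := h ('i *: x); rewrite hf hg !cReM/= !mul0r !mul1r !sub0r.
by move=> /oppr_inj.
Qed.

Lemma nrm_inner x y : nrm (inner x y) <= 2 * (nrm x * nrm y).
Proof.
apply: le_trans (nrm_le_ReIm _) _; rewrite mulr_natl mulr2n lerD ?rip_CS//.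
by rewrite -normrN -rip_iZl (le_trans (rip_CS _ _))// nrmZ nrmi mul1r.
Qed.

Lemma nrm_le_rip x (C : R) : 0 <= C -> (forall y, rip y x <= C * nrm y) -> nrm x <= C.
Proof.
move=> C0 h; have := h x; rewrite ripxx expr2.
have [->|x0] := eqVneq (nrm x) 0; first by [].
by rewrite ler_pM2r// lt_neqAle eq_sym x0 nrm_ge0.
Qed.

End InnerProduct.

Section Riesz.
Variable R : realType.
Local Notation re := (@complex.Re R).
Local Notation im := (@complex.Im R).
Variable H : hilbertType R.

(** The representing vector minimizes |x|^2 - 2 Re f(x): the parallelogram law makes
    minimizing sequences Cauchy, and the first variation vanishes at the limit. *)
Lemma riesz (f : H -> R[i]) (M : R) : linear_for *%R f ->
  (forall x, nrm (f x) <= M * nrm x) -> exists u : H, forall x, f x = inner x u.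
Proof.
move=> lf fM.
have fD x y : f (x + y) = f x + f y by have := lf 1 x y; rewrite scale1r mul1r.
have f0 : f 0 = 0 by have := fD 0 0; rewrite addr0 => /eqP; rewrite eq_sym -subr_eq0 addrK => /eqP.
have fZ a x : f (a *: x) = a * f x by have := lf a x 0; rewrite f0 !addr0.
pose J (x : H) : R := nrm x ^+ 2 - 2 * re (f x).
have reZ (t : R) x : re (f (t%:C *: x)) = t * re (f x) by rewrite fZ cReM/= mul0r subr0.
have Jlo x : - M ^+ 2 <= J x.
  rewrite /J; have h := le_trans (ler_norm _) (le_trans (Re_le_nrm (f x)) (fM x)).
  have := sqr_ge0 (nrm x - M); move: (nrm x) (re (f x)) h => n p h; nra.
have JE (x h : H) (t : R) : J (x + t%:C *: h) = J x + 2 * t * (rip x h - re (f h)) + t ^+ 2 * nrm h ^+ 2.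
  by rewrite /J nrmD_sqr fD cReD reZ ripZr nrmZ nrmR exprMn real_normK ?num_real//; ring.
have hI : has_inf (range J).
  by split; [exists (J 0), 0|exists (- M ^+ 2) => _ [x _ <-]].
pose m := inf (range J).
have mJ x : m <= J x by apply: ge_inf; [case: hI|exists x].
have pick n : exists x, J x < m + n.+1%:R^-1.
  have [|_ [x _ <-] hx] := @inf_adherent _ (range J) n.+1%:R^-1 _ hI; first by rewrite invr_gt0.
  by exists x.
have /choice[u hu] := pick.
have para x y : nrm (x - y) ^+ 2 <= 2 * (J x - m) + 2 * (J y - m).
  have := mJ (2^-1%:C *: (x + y)).
  have -> : J (2^-1%:C *: (x + y)) = nrm (x + y) ^+ 2 / 4 - (re (f x) + re (f y)).
    rewrite /J reZ fD cReD nrmZ nrmR ger0_norm ?invr_ge0// exprMn.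
    by rewrite (mulrC _ (nrm _ ^+ 2)); congr (_ * _ - _); field.
  rewrite nrmD_sqr => h; rewrite nrmD_sqr ripNr nrmN /J.
  by move: h; move: (nrm x ^+ 2) (nrm y ^+ 2) (rip x y) (re (f x)) (re (f y)) => *; lra.
have small (e : R) : 0 < e -> exists N, forall n, (N <= n)%N -> n.+1%:R^-1 <= e :> R.
  move=> e0; have /cvgrPdist_le /(_ _ e0) [N _ hN] := @cvg_harmonic R.
  exists N => n /hN; rewrite sub0r normrN ger0_norm// /harmonic invr_ge0//.
have cu : nrm_cauchy u.
  move=> e e0; have [N hN] := small (e ^+ 2 / 4) (divr_gt0 (exprn_gt0 _ e0) (ltr0n _ 4)).
  exists N => p n Np pn; rewrite -(@ler_pXn2r _ 2) ?nnegrE ?nrm_ge0 ?(ltW e0)//.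
  apply: le_trans (para _ _) _.
  have h1 := hu n; have h2 := hu p; have h3 := hN _ Np; have h4 := hN _ (leq_trans Np pn).
  by move: h1 h2 h3 h4; move: (J _) (J _) (n.+1%:R^-1) (p.+1%:R^-1) => *; lra.
have [v hv] := nrm_complete_complete cu.
(* The first variation of J at the limit vanishes. *)
have var h : rip v h = re (f h).
  apply/eqP; rewrite -subr_eq0; apply/negPn/negP => D0.
  set D := rip v h - re (f h) in D0.
  pose nh := nrm h ^+ 2; have nh0 : 0 <= nh by exact: sqr_ge0.
  pose t : R := - D / (nh + 1).
  have nh1 : 0 < nh + 1 by rewrite ltr_wpDl.
  have neg : 2 * t * D + t ^+ 2 * nh < 0.
    have -> : 2 * t * D + t ^+ 2 * nh = - (D ^+ 2 / (nh + 1)) * (2 - nh / (nh + 1)).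
      by rewrite /t; field; rewrite gt_eqF.
    rewrite mulNr oppr_lt0 mulr_gt0// ?divr_gt0 ?exprn_even_gt0//.
    by rewrite subr_gt0 ltr_pdivrMr//; lra.
  have lim (e : R) : 0 < e -> - e <= 2 * t * D + t ^+ 2 * nh.
    move=> e0; have k0 : 0 < 2 * `|t| * nrm h + 1 by rewrite ltr_wpDl// !mulr_ge0// nrm_ge0.
    have [N1 hN1] := hv (e / 2 / (2 * `|t| * nrm h + 1)) (divr_gt0 (divr_gt0 e0 (ltr0n _ 2)) k0).
    have [N2 hN2] := small (e / 2) (divr_gt0 e0 (ltr0n _ 2)).
    pose n := maxn N1 N2.
    have := hN1 n (leq_maxl _ _); rewrite ler_pdivlMr// => h1.
    have := hN2 n (leq_maxr _ _) => h2.
    have h3 := hu n; have := mJ (u n + t%:C *: h); rewrite JE -/nh => h4.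
    have h5 : 2 * t * (rip (u n) h - re (f h)) = 2 * t * D + 2 * (t * rip (u n - v) h).
      by rewrite /D ripBl; ring.
    have h6 : t * rip (u n - v) h <= `|t| * (nrm (u n - v) * nrm h).
      by rewrite (le_trans (ler_norm _))// normrM ler_wpM2l// rip_CS.
    have h7 := nrm_ge0 (u n - v).
    rewrite h5 in h4.
    move: h1 h6 h7; rewrite mulrDr mulr1 => h1 h6 h7.
    have h8 : nrm (u n - v) * (2 * `|t| * nrm h) = 2 * (`|t| * (nrm (u n - v) * nrm h)) by ring.
    rewrite h8 in h1.
    move: h1 h2 h3 h4 h6 h7.
    set x1 := `|t| * _; set x2 := t * rip _ _; set x3 := t ^+ 2 * nh; set x4 := 2 * t * D.
    set x5 := J _; set x6 := n.+1%:R^-1; set x7 := nrm _.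
    clearbody x1 x2 x3 x4 x5 x6 x7; by move=> *; lra.
  have := lim (- (2 * t * D + t ^+ 2 * nh) / 2); rewrite divr_gt0 ?oppr_gt0// => /(_ isT).
  move: neg; set X := _ + _; clearbody X; clear => neg lo.
  by move: neg; rewrite ltNge; apply/negP/negPn; move: lo; lra.
exists v; apply: (@inner_ext_full _ H) => x.
- exact: fZ.
- by rewrite innerZl.
- by rewrite -var ripC.
Qed.

End Riesz.

Section Adjoint.
Variable R : realType.
Local Notation re := (@complex.Re R).
Implicit Types H Y : hilbertType R.

Lemma adjointP H Y (A : bop H Y) x y : inner (A x) y = inner x (adjoint A y).
Proof.
suff [B hB] : exists B : bop Y H, forall x y, inner (A x) y = inner x (B y).
  by rewrite /adjoint; case: xgetP => [C _ /= -> //|/(_ B)].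
have [B hB] : exists B : Y -> H, forall x y, inner (A x) y = inner x (B y).
  suff /choice[B hB] : forall y, exists u, forall x, inner (A x) y = inner x u by exists B.
  move=> z; apply: (@riesz _ _ _ (2 * (nrm A * nrm z))).
    by move=> a u v /=; rewrite linearP innerDl innerZl.
  move=> u; apply: le_trans (nrm_inner _ _) _.
  by rewrite -mulrA ler_wpM2l// mulrAC ler_wpM2r ?nrm_ge0// nrm_app.
have lB : linear B.
  move=> a u v; apply: inner_ext => z.
  by rewrite /rip innerDr innerZr -!hB innerDr innerZr.
have bB : B \in @bop_pred R Y H.
  apply/asboolP; split => //; exists (nrm A) => u.
  apply: nrm_le_rip => [|z]; first by rewrite mulr_ge0 ?nrm_ge0.
  rewrite /rip -hB; apply: le_trans (ler_norm _) _.
  apply: le_trans (rip_CS _ _) _.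
  by rewrite mulrAC ler_wpM2r ?nrm_ge0// nrm_app.
by exists (Bop bB).
Qed.

Lemma adjoint_rip H Y (A : bop H Y) x y : rip (A x) y = rip x (adjoint A y).
Proof. by rewrite /rip adjointP. Qed.

Lemma adjoint_eq H Y (A : bop H Y) (B : bop Y H) :
  (forall x y, rip (A x) y = rip x (B y)) -> adjoint A = B.
Proof. by move=> h; apply: bopE => y; apply: inner_ext => x; rewrite -adjoint_rip h. Qed.

Lemma adjointK H Y (A : bop H Y) : adjoint (adjoint A) = A.
Proof. by apply: adjoint_eq => y x; rewrite ripC -adjoint_rip ripC. Qed.

Lemma adjointZ H Y (a : R[i]) (A : bop H Y) : adjoint (a *: A) = a^* *: adjoint A.
Proof.
apply: adjoint_eq => x y; rewrite /rip !bopZ innerZl innerZr adjointP.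
by congr (re (_ * _)); case: a => p q; apply: complex_ext => //=; rewrite opprK.
Qed.

Lemma nrm_adjoint_le H Y (A : bop H Y) : nrm (adjoint A) <= nrm A.
Proof.
rewrite [leLHS]nrm_bop; apply: opnorm_le => [|y]; first exact: nrm_ge0.
apply: nrm_le_rip => [|x]; first by rewrite mulr_ge0 ?nrm_ge0.
rewrite -adjoint_rip (le_trans (ler_norm _))// (le_trans (rip_CS _ _))//.
by rewrite mulrAC ler_wpM2r ?nrm_ge0// nrm_app.
Qed.

Lemma nrm_adjoint H Y (A : bop H Y) : nrm (adjoint A) = nrm A.
Proof. by apply/eqP; rewrite eq_le nrm_adjoint_le -{1}(adjointK A) nrm_adjoint_le. Qed.

End Adjoint.

(** * Powers and adjoints on Hilbert spaces *)

Section Functionals.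
Variable R : realType.

Lemma bev_subproof (V W : normedModType R[i]) (v : V) :
  (fun A : bop V W => A v) \in @bop_pred R (bop V W) W.
Proof.
apply/asboolP; split; first by move=> a A B.
by exists (nrm v) => A; rewrite mulrC nrm_app.
Qed.

Definition bev (V W : normedModType R[i]) (v : V) : bop (bop V W) W :=
  Bop (bev_subproof W v).

Lemma binner_subproof (H : hilbertType R) (y : H) :
  (fun x : H => inner x y : R[i]^o) \in @bop_pred R H R[i]^o.
Proof.
apply/asboolP; split; first by move=> a u v; rewrite /= innerDl innerZl.
by exists (2 * nrm y) => x; rewrite -mulrA (mulrC (nrm y)) nrm_inner.
Qed.

Definition binner (H : hilbertType R) (y : H) : bop H R[i]^o := Bop (binner_subproof y).

Lemma opow_binseries_bev (V : normedModType R[i]) (cV : nrm_complete V) (N : bop V V) (a : R)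
    (v : V) (psi : bop V R[i]^o) : nrm N < 1 ->
  psi (opow (bid V - N) a v) = psi (binseries (- a) N v).
Proof. exact: (@opow_binseries _ _ cV N a (bcomp psi (bev V v))). Qed.

Lemma opow_binseries_hilbert (H : hilbertType R) (N : bop H H) (a : R) : nrm N < 1 ->
  opow (bid H - N) a = binseries (- a) N.
Proof.
move=> N1; apply: bopE => x; apply: inner_ext => z.
have := opow_binseries_bev (@nrm_complete_complete _ H) a x (binner z) N1.
by rewrite /= ripC (ripC z) /rip => ->.
Qed.

End Functionals.

Section AdjointSeries.
Variable R : realType.
Variable H : hilbertType R.
Implicit Types (A B N : bop H H).

Lemma adjointD A B : adjoint (A + B) = adjoint A + adjoint B.
Proof. by apply: adjoint_eq => x y; rewrite !bopD ripDl ripDr !adjoint_rip. Qed.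

Lemma adjointN A : adjoint (- A) = - adjoint A.
Proof. by apply: adjoint_eq => x y; rewrite !bopN ripNl ripNr adjoint_rip. Qed.

Lemma adjoint0 : adjoint (0 : bop H H) = 0.
Proof. by apply: adjoint_eq => x y; rewrite !bop0 rip0l ripC rip0l. Qed.

Lemma adjointZr (t : R) A : adjoint (t%:C *: A) = t%:C *: adjoint A.
Proof. by apply: adjoint_eq => x y; rewrite !bopZ ripZl ripZr adjoint_rip. Qed.

Lemma adjoint_bcomp (U V W : hilbertType R) (A : bop V W) (B : bop U V) :
  adjoint (bcomp A B) = bcomp (adjoint B) (adjoint A).
Proof. by apply: adjoint_eq => x y /=; rewrite !adjoint_rip. Qed.

Lemma adjoint_bpow N n : adjoint (bpow N n) = bpow (adjoint N) n.
Proof.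
elim: n => [|n IH]; first by apply: adjoint_eq.
by rewrite -bpowSr adjoint_bcomp IH.
Qed.

Lemma adjoint_binsum a N m : adjoint (binsum a N m) = binsum a (adjoint N) m.
Proof.
rewrite /binsum; elim: m => [|m IH]; first by rewrite !big_geq// adjoint0.
by rewrite !big_nat_recr//= adjointD IH adjointZr adjoint_bpow.
Qed.

Lemma adjoint_binseries a N : nrm N < 1 -> adjoint (binseries a N) = binseries a (adjoint N).
Proof.
move=> N1; have cH := @nrm_complete_complete _ H.
apply/esym/(binseries_eq cH); first by rewrite nrm_adjoint.
move=> e /(binseriesP cH a N1) [m0 hm0]; exists m0 => m /hm0.
by rewrite -adjoint_binsum -adjointN -adjointD nrm_adjoint.
Qed.

End AdjointSeries.

(** * Averages over roots of unity *)

Section RootsOfUnity.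
Variable R : realType.
Local Notation re := (@complex.Re R).
Implicit Types (s : R) (M j p m : nat).

Definition rootu s M j : R[i] := s%:C * cis (2 * pi / M%:R * j%:R).

Lemma nrm_rootu s M j : nrm (rootu s M j) = `|s|.
Proof. by rewrite /rootu nrmM nrm_cis nrmR mulr1. Qed.

Lemma cis_neq1 (x : R) : 0 < x < 2 * pi -> cis x != 1.
Proof.
move=> /andP[x0 x2]; apply/eqP => /(congr1 re) /= c1.
have sn : 0 < sin (x / 2).
  by apply: sin_gt0_pi; rewrite divr_gt0//= ltr_pdivrMr// mulrC.
have : cos x = 1 - 2 * sin (x / 2) ^+ 2.
  have -> : x = x / 2 *+ 2 by rewrite -mulr_natr divfK// pnatr_eq0.
  rewrite cos_mulr2n; have -> : x / 2 *+ 2 / 2 = x / 2 by rewrite -[_ *+ 2]mulr_natr mulfK// pnatr_eq0.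
  by have := cos2Dsin2 (x / 2) => h; rewrite -[cos _ ^+ 2](addrK (sin (x / 2) ^+ 2)) h mulr2n; ring.
rewrite c1 => /eqP; rewrite -subr_eq0 opprB addrC subrK mulf_eq0 pnatr_eq0/= sqrf_eq0.
by rewrite gt_eqF.
Qed.

Lemma conjc_cis (x : R) : ((cis x)^*)%R = cis (- x).
Proof. by apply: complex_ext; rewrite /= ?cosN ?sinN. Qed.

Lemma conj_realM (x : R) (c : R[i]) : ((x%:C * c)^*)%R = x%:C * (c^*)%R.
Proof. by case: c => p q; apply: complex_ext; rewrite /= ?mul0r; ring. Qed.

Lemma geom_cis0 (x : R) M : cis x != 1 -> cis x ^+ M = 1 -> \sum_(j < M) cis x ^+ j = 0.
Proof.
move=> x1 xM; have := subrX1 (cis x) M; rewrite xM subrr => /esym/eqP.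
by rewrite mulf_eq0 subr_eq0 (negPf x1)/= => /eqP.
Qed.

(** A geometric sum. Averages over roots of unity replace angular integrals, and are
    exact on polynomials of degree less than M. *)
Lemma rootu_orth s M p m : (p < M)%N -> (m < M)%N ->
  \sum_(j < M) rootu s M j ^+ p * (rootu s M j ^+ m)^* =
  (M%:R * (if p == m then s ^+ (2 * p) else 0))%:C.
Proof.
move=> pM mM; have M0 : (0 < M)%N by exact: leq_ltn_trans pM.
have M0r : M%:R != 0 :> R by rewrite pnatr_eq0 -lt0n.
have E j : rootu s M j ^+ p * (rootu s M j ^+ m)^* =
   (s ^+ (p + m))%:C * cis (2 * pi / M%:R * (p%:R - m%:R) * j%:R).
  rewrite /rootu !exprMn !cisX -!(rmorphXn (real_complex R)) conj_realM conjc_cis.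
  rewrite mulrACA -(rmorphM (real_complex R)) -exprD -cisD; congr (_ * cis _).
  by ring.
under eq_bigr do rewrite E.
rewrite -mulr_sumr; case: eqP => [<-|/eqP pm].
  under eq_bigr do rewrite subrr mulr0 mul0r cis0.
  by rewrite sumr_const card_ord addnn -mul2n rmorphM /= rmorph_nat mulrC.
rewrite mulr0 rmorph0; apply/eqP; rewrite mulf_eq0; apply/orP; right; apply/eqP.
pose x : R := 2 * pi / M%:R * (p%:R - m%:R).
have xX j : cis (x * j%:R) = cis x ^+ j by rewrite cisX mulrC.
under eq_bigr do rewrite xX.
have small k : (0 < k < M)%N -> cis (2 * pi / M%:R * k%:R) != 1 :> R[i].
  move=> /andP[k0 kM]; apply: cis_neq1.
  have pp : 0 < 2 * pi / M%:R :> R by rewrite divr_gt0 ?mulr_gt0 ?pi_gt0 ?ltr0n.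
  rewrite mulr_gt0 ?ltr0n//= -[ltRHS](divfK M0r) ltr_pM2l// ltr_nat//.
have one k : cis (2 * pi / M%:R * k%:R) ^+ M = 1 :> R[i].
  rewrite cisX (_ : M%:R * _ = k%:R * (2 * pi)); last by field.
  by rewrite -cisX cis2pi expr1n.
have [lt|ge] := ltnP m p.
  have xE : x = 2 * pi / M%:R * (p - m)%:R by rewrite /x natrB// ltnW.
  rewrite xE; apply: geom_cis0; [apply: small|exact: one].
  by rewrite subn_gt0 lt/= (leq_ltn_trans _ pM)// leq_subr.
have lt : (p < m)%N by rewrite ltn_neqAle pm.
have xE : x = - (2 * pi / M%:R * (m - p)%:R) by rewrite /x natrB// -mulrN opprB.
rewrite xE; apply: geom_cis0.
  rewrite -cisV invr_eq1; apply: small.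
  by rewrite subn_gt0 lt/= (leq_ltn_trans _ mM)// leq_subr.
by rewrite -cisV exprVn one invr1.
Qed.

Variable H : hilbertType R.

(** The shift n comes from a factor conj(z)^n of the right-hand argument, which moves
    to the left-hand one as z^n. *)
Lemma inner_rootu (z : nat -> R[i]) (w : nat -> R) M (D : bop H H) L n Q (u v : nat -> H) :
  (forall p m, (p < M)%N -> (m < M)%N -> \sum_(j < M) z j ^+ p * (z j ^+ m)^* =
     (M%:R * (if p == m then w p else 0))%:C) ->
  (L + n <= Q)%N -> (Q <= M)%N ->
  \sum_(j < M) rip (D (\sum_(0 <= k < L) z j ^+ (k + n) *: u k))
                   (\sum_(0 <= m < Q) z j ^+ m *: v m) =
  M%:R * \sum_(0 <= k < L) w (k + n)%N * rip (D (u k)) (v (k + n)%N).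
Proof.
move=> orth LnQ QM.
have E j : rip (D (\sum_(0 <= k < L) z j ^+ (k + n) *: u k))
                   (\sum_(0 <= m < Q) z j ^+ m *: v m) =
  \sum_(0 <= k < L) \sum_(0 <= m < Q)
    re (z j ^+ (k + n) * (z j ^+ m)^* * inner (D (u k)) (v m)).
  rewrite linear_sum rip_suml; apply: eq_bigr => k _.
  rewrite rip_sumr; apply: eq_bigr => m _.
  by rewrite linearZ/= /rip innerZl innerZr mulrA.
under eq_bigr do rewrite E.
rewrite exchange_big mulr_sumr /=; apply: eq_big_nat => k /andP[_ kL].
have knQ : (k + n < Q)%N by apply: leq_trans LnQ; rewrite ltn_add2r.
rewrite exchange_big/=.
transitivity (\sum_(0 <= m < Q) M%:R * (if m == (k + n)%N then w (k + n)%N * rip (D (u k)) (v (k + n)%N) else 0)).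
  apply: eq_big_nat => m /andP[_ mQ].
  have reS (I : Type) (r : seq I) (g : I -> R[i]) : re (\sum_(i <- r) g i) = \sum_(i <- r) re (g i).
    by elim/big_rec2: _ => [//|i x y _ <-]; rewrite cReD.
  rewrite -reS -mulr_suml orth ?(leq_trans _ QM)// cReM/= mul0r subr0 -mulrA.
  by rewrite eq_sym; case: eqP => [->|_]; rewrite ?mul0r.
rewrite -mulr_sumr; congr (_ * _).
rewrite (bigD1_seq (k + n)%N) ?mem_index_iota ?iota_uniq//=.
by rewrite eqxx big1 ?addr0// => m /negPf ->.
Qed.

End RootsOfUnity.

(** * The defect form of a hypercontraction *)

Section Mop.
Variable R : realType.
Variable H : hilbertType R.
Variable S : bop H H.

Lemma nrm_Mop : nrm (Mop S) <= nrm S * nrm S.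
Proof.
rewrite [leLHS]nrm_bop; apply: opnorm_le => [|X]; first by rewrite mulr_ge0 ?nrm_ge0.
apply: le_trans (nrm_bcomp _ _) _; rewrite nrm_adjoint -mulrA ler_wpM2l ?nrm_ge0//.
by rewrite mulrC nrm_bcomp.
Qed.

Lemma rip_bpow_Mop k X x y :
  rip (bpow (Mop S) k X x) y = rip (X (bpow S k x)) (bpow S k y).
Proof.
elim: k x y => [//|k IH] x y.
have E u v : rip (adjoint S u) v = rip u (S v) by rewrite ripC -adjoint_rip ripC.
have Sr w : bpow S k.+1 w = bpow S k (S w) by rewrite -bpowSr.
by rewrite !Sr -IH -E.
Qed.

End Mop.

Section Defect.
Variable R : realType.
Local Notation re := (@complex.Re R).
Local Notation im := (@complex.Im R).
Variable H : hilbertType R.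
Variables (S : bop H H) (gamma : R).
Hypothesis S1 : nrm S < 1.
Hypothesis gamma0 : 0 < gamma.
Hypothesis hS : positive_op (opow (bid (bop H H) - Mop S) gamma (bid H)).

Let cH := @nrm_complete_complete R H.
Let cHH : nrm_complete (bop H H) := nrm_complete_bop cH.

Let M1 : nrm (Mop S) < 1.
Proof.
apply: le_lt_trans (nrm_Mop S) _; rewrite -[ltRHS]mulr1.
by rewrite ltr_pM ?nrm_ge0.
Qed.

(** (1 - M_S)^gamma (I), the square of the usual defect operator. *)
Definition defect : bop H H := binseries (- gamma) (Mop S) (bid H).
Definition dform (u v : H) : R := rip (defect u) v.
Local Notation b := dform.
Local Notation q u := (dform u u).

Lemma defect_ge0 x : 0 <= inner (defect x) x.
Proof.
have := opow_binseries_bev cHH gamma (bid H) (bcomp (binner x) (bev H x)) M1.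
by rewrite /= => E; rewrite /defect -E; exact: hS.
Qed.

Lemma dform_ge0 x : 0 <= q x.
Proof. by have := defect_ge0 x; rewrite lecE => /andP[_]. Qed.

Lemma dformDl u v w : b (u + v) w = b u w + b v w.
Proof. by rewrite /dform linearD ripDl. Qed.
Lemma dformDr u v w : b w (u + v) = b w u + b w v.
Proof. by rewrite /dform ripDr. Qed.
Lemma dformZl (t : R) u w : b (t%:C *: u) w = t * b u w.
Proof. by rewrite /dform linearZ/= ripZl. Qed.
Lemma dformZr (t : R) u w : b w (t%:C *: u) = t * b w u.
Proof. by rewrite /dform ripZr. Qed.
Lemma dformNr u w : b w (- u) = - b w u.
Proof. by rewrite /dform ripNr. Qed.
Lemma dformNl u w : b (- u) w = - b u w.
Proof. by rewrite /dform linearN ripNl. Qed.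

(** A form with a real quadratic form is Hermitian: for the real part it is enough to
    look at u + i v. *)
Lemma dform_sym u v : b u v = b v u.
Proof.
pose c : R[i] := 0 +i* 1.
have := ger0_Im (defect_ge0 (u + c *: v)).
have -> : defect (u + c *: v) = defect u + c *: defect v by rewrite linearD linearZ.
rewrite innerDl !innerDr !innerZl !innerZr.
have := ger0_Im (defect_ge0 u); have := ger0_Im (defect_ge0 v).
rewrite !cImD !cImM !cReM /dform /rip /=.
move: (inner _ _) (inner _ _) (inner _ _) (inner _ _) => [? ?] [? ?] [? ?] [? ?] /=.
by lra.
Qed.

Lemma dform_AMGM (mu : R) u v : 0 < mu -> b u v <= (mu * q u + mu^-1 * q v) / 2.
Proof.
move=> mu0; have := dform_ge0 (mu%:C *: u - v).
rewrite dformDl !dformDr !dformNl !dformNr !dformZl !dformZr (dform_sym v u) => h.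
rewrite -subr_ge0; move: h; move: (b u u) (b u v) (b v v) => x y z h.
have -> : (mu * x + mu^-1 * z) / 2 - y = (mu * mu * x - 2 * mu * y + z) / (2 * mu).
  by field; rewrite gt_eqF.
rewrite divr_ge0 ?mulr_ge0 ?(ltW mu0)//; apply: le_trans h _.
by rewrite le_eqVlt; apply/orP; left; apply/eqP; ring.
Qed.

Lemma dform_bound u v : `|b u v| <= nrm defect * (nrm u * nrm v).
Proof.
apply: le_trans (rip_CS _ _) _.
by rewrite mulrA ler_wpM2r ?nrm_ge0// nrm_app.
Qed.

Lemma dformCZ (c : R[i]) u v : b (c *: u) v = b u ((c^*)%R *: v).
Proof.
rewrite /dform linearZ/= /rip innerZl innerZr; congr (re (_ * _)).
by case: c => p p'; apply: complex_ext; rewrite //= opprK.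
Qed.

Lemma dform_cZ (c : R[i]) u : q (c *: u) = nrm c ^+ 2 * q u.
Proof.
rewrite dformCZ scalerA nrm_sqr -dformZr; congr (b _ (_ *: _)).
by case: c => p p'; apply: complex_ext; rewrite /= ?cReM ?cImM /=; ring.
Qed.

Lemma dform_near u v : `|q u - q v| <= nrm defect * (nrm (u - v) * (2 * nrm v + nrm (u - v))).
Proof.
have -> : q u - q v = b (u - v) (u - v) + b (u - v) v + b v (u - v).
  rewrite !dformDl !dformDr !dformNl !dformNr; ring.
apply: le_trans (ler_normD _ _) _; apply: le_trans (lerD (ler_normD _ _) (lexx _)) _.
apply: le_trans (lerD (lerD (dform_bound _ _) (dform_bound _ _)) (dform_bound _ _)) _.
by rewrite le_eqVlt; apply/orP; left; apply/eqP; ring.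
Qed.

Lemma dform_nrm_cvg_le (u : nat -> H) l (C : R) : nrm_cvg u l -> (forall n, q (u n) <= C) -> q l <= C.
Proof.
move=> cu uC; apply/ler_addgt0Pl => e e0.
pose A := nrm defect * (2 * nrm l + 1).
have A0 : 0 <= A by rewrite mulr_ge0 ?nrm_ge0// addr_ge0// mulr_ge0 ?nrm_ge0.
have A1 : 0 < A + 1 by rewrite ltr_wpDl.
have d0 : 0 < Num.min 1 (e / (A + 1)) by rewrite lt_min ltr01 divr_gt0.
have [N hN] := cu _ d0; have := hN N (leqnn _).
rewrite le_min => /andP[h1 h2].
have := dform_near (u N) l; rewrite distrC => h3.
have h4 : q l <= q (u N) + A * nrm (u N - l).
  rewrite -lerBlDl; apply: le_trans (ler_norm _) _; apply: le_trans h3 _.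
  rewrite /A -!mulrA ler_wpM2l ?nrm_ge0// mulrC ler_wpM2r ?nrm_ge0//.
  by rewrite lerD2l.
apply: le_trans h4 _; rewrite addrC; apply: lerD => //.
move: h2; rewrite ler_pdivlMr// => h2; apply: le_trans h2.
by rewrite mulrC ler_wpM2l ?nrm_ge0// lerDl.
Qed.

(** (1 - M_S)^(- gamma) maps the defect back to I, hence I is the sum of the operators
    nbin gamma k M_S^k (defect). *)
Lemma defect_sum (e : R) : 0 < e -> exists m0, forall m x y, (m0 <= m)%N ->
  `|\sum_(0 <= k < m) nbin gamma k * b (bpow S k x) (bpow S k y) - rip x y|
     <= e * (nrm x * nrm y).
Proof.
have E : binseries gamma (Mop S) defect = bid H.
  have := binseriesD cHH gamma (- gamma) M1; rewrite subrr binseries0// => E.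
  by rewrite -[LHS]/((bcomp (binseries gamma (Mop S)) (binseries (- gamma) (Mop S))) (bid H)) E.
move=> e0; have [m0 hm0] := nrm_cvg_bop_app defect (binseriesP cHH gamma M1) e0.
exists m0 => m x y /hm0; rewrite E => h.
have -> : \sum_(0 <= k < m) nbin gamma k * b (bpow S k x) (bpow S k y) - rip x y =
    rip ((binsum gamma (Mop S) m defect - bid H) x) y.
  rewrite bopB ripBl /binsum !bop_sum rip_suml; congr (_ - _).
  by apply: eq_bigr => k _; rewrite !bopZ ripZl rip_bpow_Mop.
apply: le_trans (rip_CS _ _) _; rewrite mulrA ler_wpM2r ?nrm_ge0//.
by apply: le_trans (nrm_app _ _) _; rewrite ler_wpM2r ?nrm_ge0.
Qed.

Lemma defect_sum_le m x :
  \sum_(0 <= k < m) nbin gamma k * q (bpow S k x) <= nrm x ^+ 2.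
Proof.
apply/ler_addgt0Pl => e e0.
have x1 : 0 < nrm x * nrm x + 1 by rewrite ltr_wpDl// mulr_ge0 ?nrm_ge0.
have [m0 hm0] := defect_sum (divr_gt0 e0 x1).
have := hm0 (maxn m m0) x x (leq_maxr _ _); rewrite ripxx => h.
apply: (@le_trans _ _ (\sum_(0 <= k < maxn m m0) nbin gamma k * q (bpow S k x))).
  rewrite [leRHS](big_cat_nat (n := m))//= ?leq_maxl// lerDl.
  by apply: sumr_ge0 => k _; rewrite mulr_ge0 ?dform_ge0 ?nbin_ge0// ltW.
rewrite -lerBlDr; apply: le_trans (ler_norm _) _; apply: le_trans h _.
rewrite mulrAC ler_pdivrMr// ler_wpM2l ?(ltW e0)//.
by rewrite lerDl.
Qed.

(** Cauchy-Schwarz between the weights nbin gamma k |z|^(2k), which sum up to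
    (1 - |z|^2)^(- gamma), and the expansion of the identity at v. *)
Lemma dform_binsum_le (z : R[i]) m v : 0 < nrm z < 1 ->
  q (binsum gamma (z *: S) m v) <= (1 - nrm z ^+ 2) `^ (- gamma) * nrm v ^+ 2.
Proof.
move=> /andP[z0 z1]; pose t := nrm z ^+ 2.
have t01 : 0 <= t < 1 by rewrite sqr_ge0 /t exprn_ilt1// ltW.
have t0 : 0 < t by rewrite exprn_gt0.
pose u k := bpow S k v.
have E : binsum gamma (z *: S) m v = \sum_(0 <= k < m) (nbin gamma k)%:C *: (z ^+ k *: u k).
  rewrite /binsum bop_sum; apply: eq_bigr => k _.
  by rewrite bopZ bpowZ.
have bsuml (I : Type) (s : seq I) (f : I -> H) w : b (\sum_(i <- s) f i) w = \sum_(i <- s) b (f i) w.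
  by rewrite /dform linear_sum rip_suml.
have bsumr (I : Type) (s : seq I) (f : I -> H) w : b w (\sum_(i <- s) f i) = \sum_(i <- s) b w (f i).
  by rewrite /dform rip_sumr.
have pair k l : b (z ^+ k *: u k) (z ^+ l *: u l) <= (t ^+ l * q (u k) + t ^+ k * q (u l)) / 2.
  have mu0 : 0 < t ^+ l / t ^+ k by rewrite divr_gt0// exprn_gt0.
  apply: le_trans (dform_AMGM _ _ mu0) _.
  rewrite !dform_cZ !nrmX -!exprM !(mulnC _ 2) !exprM -/t invf_div.
  by rewrite le_eqVlt; apply/orP; left; apply/eqP; field; rewrite !expf_neq0// gt_eqF.
pose A := \sum_(0 <= k < m) nbin gamma k * t ^+ k.
pose B := \sum_(0 <= k < m) nbin gamma k * q (u k).
have AB : q (binsum gamma (z *: S) m v) <= A * B.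
  rewrite E bsuml.
  apply: (@le_trans _ _ (\sum_(0 <= k < m) \sum_(0 <= l < m)
     nbin gamma k * nbin gamma l * ((t ^+ l * q (u k) + t ^+ k * q (u l)) / 2))).
    apply: ler_sum => k _; rewrite bsumr; apply: ler_sum => l _.
    rewrite dformZl dformZr mulrA ler_wpM2l ?pair// mulr_ge0// nbin_ge0// ltW//.
  have -> : \sum_(0 <= k < m) \sum_(0 <= l < m)
     nbin gamma k * nbin gamma l * ((t ^+ l * q (u k) + t ^+ k * q (u l)) / 2) =
    (\sum_(0 <= k < m) \sum_(0 <= l < m) nbin gamma k * q (u k) * (nbin gamma l * t ^+ l) +
     \sum_(0 <= k < m) \sum_(0 <= l < m) nbin gamma k * t ^+ k * (nbin gamma l * q (u l))) / 2.
    rewrite -big_split mulr_suml; apply: eq_bigr => k _.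
    rewrite -big_split mulr_suml; apply: eq_bigr => l _ /=.
    by field.
  have dist (f g : nat -> R) : \sum_(0 <= k < m) \sum_(0 <= l < m) f k * g l =
     (\sum_(0 <= k < m) f k) * (\sum_(0 <= l < m) g l).
    by rewrite mulr_suml; apply: eq_bigr => k _; rewrite mulr_sumr.
  rewrite (dist (fun k => nbin gamma k * q (u k)) (fun k => nbin gamma k * t ^+ k)).
  rewrite (dist (fun k => nbin gamma k * t ^+ k) (fun k => nbin gamma k * q (u k))) -/A -/B.
  by rewrite le_eqVlt; apply/orP; left; apply/eqP; field.
apply: le_trans AB _; apply: ler_pM.
- by apply: sumr_ge0 => k _; rewrite mulr_ge0 ?nbin_ge0 ?exprn_ge0 ?ltW.
- by apply: sumr_ge0 => k _; rewrite mulr_ge0 ?nbin_ge0 ?dform_ge0 ?ltW.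
- by rewrite /A big_mkord; apply: nbin_psum_le => //; exact: ltW.
- exact: defect_sum_le.
Qed.

Lemma nrm_zS (z : R[i]) : nrm z < 1 -> nrm (z *: S) <= nrm S.
Proof. by move=> z1; rewrite nrmZ ler_piMl ?nrm_ge0// ltW. Qed.

Lemma dform_binseries_le (z : R[i]) v : 0 < nrm z < 1 ->
  q (binseries gamma (z *: S) v) <= (1 - nrm z ^+ 2) `^ (- gamma) * nrm v ^+ 2.
Proof.
move=> z01; have /andP[z0 z1] := z01.
have zS1 : nrm (z *: S) < 1 by exact: le_lt_trans (nrm_zS z1) S1.
apply: (dform_nrm_cvg_le (nrm_cvg_bop_app v (binseriesP cH gamma zS1))) => n.
exact: dform_binsum_le.
Qed.

End Defect.

(** * Boundedness of a Hankel form *)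

Section SumLimits.
Variable R : realType.

Lemma cvg_sum_seq (I : Type) (r : seq I) (f : I -> R -> R) (l : I -> R) (F : set_system R) :
  Filter F -> (forall i, f i t @[t --> F] --> l i) ->
  (\sum_(i <- r) f i t) @[t --> F] --> \sum_(i <- r) l i.
Proof.
move=> FF cf; elim: r => [|i r IH].
  by rewrite big_nil; under eq_fun do rewrite big_nil; exact: cvg_cst.
by rewrite big_cons; under eq_fun do rewrite big_cons; exact: cvgD.
Qed.

End SumLimits.

Section Hankel.
Variable R : realType.
Local Notation re := (@complex.Re R).
Variables H Y : hilbertType R.
Variables (S : bop H H) (E : bop Y H) (beta gamma K : R).
Hypothesis S1 : nrm S < 1.
Hypothesis beta0 : 0 < beta.
Hypothesis gamma1 : 1 < gamma.
Hypothesis hS : positive_op (opow (bid (bop H H) - Mop S) gamma (bid H)).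
Hypothesis K0 : 0 <= K.
Hypothesis hK : forall (z : R[i]) y, nrm z < 1 ->
  nrm (binseries (beta + 1) (z *: S) (E y)) <= K * (1 - nrm z ^+ 2) `^ (- ((1 + beta) / 2)) * nrm y.

Let gamma0 : 0 < gamma. Proof. exact: lt_trans gamma1. Qed.
Let cH := @nrm_complete_complete R H.

Let a : R := gamma + (beta + 1).
Local Notation b := (dform S gamma).
Local Notation q u := (dform S gamma u u).

(** Split a as gamma + (beta + 1): hypercontractivity controls the first factor in the
    defect form, the hypothesis [hK] controls the second one in norm. *)
Lemma dform_kernel_le (z : R[i]) y : 0 < nrm z < 1 ->
  q (binseries a (z *: S) (E y)) <= K ^+ 2 * (1 - nrm z ^+ 2) `^ (- a) * nrm y ^+ 2.
Proof.
move=> z01; have /andP[z0 z1] := z01.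
have zS1 : nrm (z *: S) < 1 by exact: le_lt_trans (nrm_zS S z1) S1.
have -> : binseries a (z *: S) (E y) = binseries gamma (z *: S) (binseries (beta + 1) (z *: S) (E y)).
  by rewrite /a -(binseriesD cH).
apply: le_trans (dform_binseries_le S1 gamma0 hS _ z01) _.
have t1 : 0 < 1 - nrm z ^+ 2 by rewrite subr_gt0 exprn_ilt1 ?nrm_ge0.
have h : nrm (binseries (beta + 1) (z *: S) (E y)) ^+ 2 <=
    K ^+ 2 * (1 - nrm z ^+ 2) `^ (- (beta + 1)) * nrm y ^+ 2.
  have -> : K ^+ 2 * (1 - nrm z ^+ 2) `^ (- (beta + 1)) * nrm y ^+ 2 =
     (K * (1 - nrm z ^+ 2) `^ (- ((1 + beta) / 2)) * nrm y) ^+ 2.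
    rewrite !exprMn -(powR_mulrn 2 (powR_ge0 _ _)) -powRrM.
    by congr (_ * _ `^ _ * _); field.
  by rewrite ler_pXn2r ?nnegrE ?nrm_ge0 ?mulr_ge0 ?powR_ge0 ?nrm_ge0// hK.
apply: le_trans (ler_wpM2l (powR_ge0 _ _) h) _.
have -> : - a = - gamma + - (beta + 1) by rewrite /a opprD.
rewrite [in leRHS]powRD; last by rewrite (gt_eqF t1) implybT.
by rewrite le_eqVlt; apply/orP; left; apply/eqP; ring.
Qed.

(** Averages over roots of unity are exact on polynomials only, whence the truncation;
    the error e has to be uniform in z since the number of roots depends on m. *)
Lemma dform_kernel_binsum (e : R) : 0 < e -> exists m0, forall m (z : R[i]) y,
  (m0 <= m)%N -> 0 < nrm z < 1 ->
  q (binsum a (z *: S) m (E y)) <= (K ^+ 2 * (1 - nrm z ^+ 2) `^ (- a) + e) * nrm y ^+ 2.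
Proof.
move=> e0; pose C := (1 - nrm S) `^ (- `|a|) * nrm E.
pose A := nrm (defect S gamma) * nrm E * (2 * C + nrm E).
have C0 : 0 <= C by rewrite mulr_ge0 ?powR_ge0 ?nrm_ge0.
have A0 : 0 <= A by rewrite !mulr_ge0 ?nrm_ge0// addr_ge0 ?nrm_ge0// mulr_ge0.
have A1 : 0 < A + 1 by rewrite ltr_wpDl.
have d0 : 0 < Num.min 1 (e / (A + 1)) by rewrite lt_min ltr01 divr_gt0.
have S01 : 0 <= nrm S < 1 by rewrite nrm_ge0.
have [m0 hm0] := binseries_unif cH a S01 d0.
exists m0 => m z y m0m z01; have /andP[z0 z1] := z01.
have zS := nrm_zS S z1.
have := hm0 _ _ zS m0m; rewrite le_min => /andP[h1 h2].
set u' := binsum a _ m _; pose u := binseries a (z *: S) (E y).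
have nE := nrm_app E y.
have hu : nrm u <= C * nrm y.
  apply: le_trans (nrm_app _ _) _; rewrite /C -mulrA.
  apply: ler_pM; rewrite ?nrm_ge0//.
  exact: (nrm_binseries_le cH).
pose d := nrm (binsum a (z *: S) m - binseries a (z *: S)).
have d00 : 0 <= d by exact: nrm_ge0.
have hd : nrm (u' - u) <= d * (nrm E * nrm y).
  rewrite /u' /u -bopB; apply: le_trans (nrm_app _ _) _.
  by rewrite ler_wpM2l ?nrm_ge0.
have hd1 : nrm (u' - u) <= nrm E * nrm y.
  by apply: le_trans hd _; rewrite ler_piMl// mulr_ge0 ?nrm_ge0.
have near : q u' - q u <= A * d * nrm y ^+ 2.
  apply: le_trans (ler_norm _) _; apply: le_trans (dform_near _ _ _ _) _.
  have -> : A * d * nrm y ^+ 2 = nrm (defect S gamma) *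
     ((d * (nrm E * nrm y)) * (2 * (C * nrm y) + nrm E * nrm y)) by rewrite /A; ring.
  rewrite ler_wpM2l ?nrm_ge0//; apply: ler_pM; rewrite ?nrm_ge0//.
    by rewrite addr_ge0 ?mulr_ge0 ?nrm_ge0.
  by apply: lerD => //; rewrite ler_wpM2l.
have Ad : A * d <= e.
  move: h2; rewrite -/d ler_pdivlMr// => h2; apply: le_trans h2.
  by rewrite mulrC ler_wpM2l// lerDl.
rewrite mulrDl -lerBlDl.
apply: le_trans (_ : q u' - q u <= _).
  by rewrite lerD2l lerN2; exact: dform_kernel_le.
apply: le_trans near _; rewrite ler_wpM2r// sqr_ge0//.
Qed.

Variables (x : H) (g : nat -> Y) (L n0 : nat).

(* X and G are the angular averages of the forms of f and h on the circle
   |z|^2 = t, and Z that of the Hankel form; f is a truncation of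
   (1 - z S)^(- gamma) x. *)
Let bkn k n := b (bpow S k x) (bpow S (n + k) (E (g n))).

Let Z (t : R) := \sum_(0 <= n < n0) \sum_(0 <= k < L)
  nbin gamma k * nbin a (k + n) * t ^+ (k + n) * bkn k n.
Let X (t : R) := \sum_(0 <= k < L) nbin gamma k ^+ 2 * t ^+ k * q (bpow S k x).
Let G (t : R) := \sum_(0 <= n < n0) t ^+ n * nrm (g n) ^+ 2.

Let f (z : R[i]) : H := \sum_(0 <= k < L) z ^+ k *: ((nbin gamma k)%:C *: bpow S k x).
Let h (z : R[i]) : Y := \sum_(0 <= n < n0) z ^+ n *: g n.

Section FixedRadius.
Variable t : R.
Hypothesis t01 : 0 < t < 1.

Let s := Num.sqrt t.
Let s2 : s ^+ 2 = t. Proof. by rewrite sqr_sqrtr// ltW//; case/andP: t01. Qed.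
Let s0 : 0 < s. Proof. by rewrite sqrtr_gt0; case/andP: t01. Qed.
Let s1 : s < 1. Proof. by rewrite -sqrtr1 ltr_sqrt//; case/andP: t01. Qed.

Let z M j := rootu s M j.

Let nz M j : nrm (z M j) = s.
Proof. by rewrite /z nrm_rootu gtr0_norm. Qed.

Let orth M p m : (p < M)%N -> (m < M)%N ->
  \sum_(j < M) z M j ^+ p * ((z M j ^+ m)^*)%R = (M%:R * (if p == m then t ^+ p else 0))%:C.
Proof.
by move=> pM mM; rewrite rootu_orth//; case: eqP => // _; rewrite exprM s2.
Qed.

Let orthc M p m : (p < M)%N -> (m < M)%N ->
  \sum_(j < M) ((z M j)^*)%R ^+ p * ((((z M j)^*)%R ^+ m)^*)%R =
     (M%:R * (if p == m then t ^+ p else 0))%:C.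
Proof.
move=> pM mM; rewrite eq_sym.
have -> : (if m == p then t ^+ p else 0) = (if m == p then t ^+ m else 0) by case: eqP => // ->.
rewrite -orth//; apply: eq_bigr => j _.
have cX (c : R[i]) n : (c^*)%R ^+ n = ((c ^+ n)^*)%R by rewrite rmorphXn.
by rewrite !cX conjCK mulrC.
Qed.

Lemma dform_average M : (L <= M)%N -> \sum_(j < M) q (f (z M j)) = M%:R * X t.
Proof.
move=> LM.
have := @inner_rootu R H (z M) (fun p => t ^+ p) M (defect S gamma) L 0 L
   (fun k => (nbin gamma k)%:C *: bpow S k x) (fun k => (nbin gamma k)%:C *: bpow S k x)
   (@orth M).
rewrite addn0 leqnn => /(_ isT LM) h1.
rewrite /X; transitivity (M%:R * \sum_(0 <= k < L) t ^+ (k + 0) *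
    b ((nbin gamma k)%:C *: bpow S k x) ((nbin gamma (k + 0))%:C *: bpow S (k + 0) x)).
  rewrite -h1; apply: eq_bigr => j _; rewrite /dform /f; congr (rip (defect S gamma _) _).
  by apply: eq_bigr => k _; rewrite addn0.
congr (_ * _); apply: eq_bigr => k _.
by rewrite addn0 dformZl dformZr; ring.
Qed.

Lemma nrm_average M : (n0 <= M)%N ->
  \sum_(j < M) nrm (h ((z M j)^*)%R) ^+ 2 = M%:R * G t.
Proof.
move=> nM.
have := @inner_rootu R Y (fun j => ((z M j)^*)%R) (fun p => t ^+ p) M (bid Y) n0 0 n0 g g (@orthc M).
rewrite addn0 leqnn => /(_ isT nM) h1.
rewrite /G; transitivity (M%:R * \sum_(0 <= k < n0) t ^+ (k + 0) * rip (g k) (g (k + 0)%N)).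
  rewrite -h1; apply: eq_bigr => j _; rewrite -ripxx /h; congr (rip _ _).
  by rewrite /=; apply: eq_bigr => k _; rewrite addn0.
by congr (_ * _); apply: eq_bigr => k _; rewrite addn0 ripxx.
Qed.

Lemma hankel_average M m : (L + n0 <= m)%N -> (m <= M)%N ->
  \sum_(j < M) b (f (z M j)) (binsum a (z M j *: S) m (E (h ((z M j)^*)%R))) = M%:R * Z t.
Proof.
move=> Lnm mM.
have D j : b (f (z M j)) (binsum a (z M j *: S) m (E (h ((z M j)^*)%R))) =
  \sum_(0 <= n < n0) rip (defect S gamma (\sum_(0 <= k < L) z M j ^+ (k + n) *: ((nbin gamma k)%:C *: bpow S k x)))
     (\sum_(0 <= l < m) z M j ^+ l *: ((nbin a l)%:C *: bpow S l (E (g n)))).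
  rewrite /h linear_sum linear_sum /dform rip_sumr; apply: eq_bigr => n _.
  rewrite linearZ linearZ/= -/(b _ _).
  have -> : ((z M j)^*)%R ^+ n = ((z M j ^+ n)^*)%R by rewrite rmorphXn.
  rewrite -dformCZ /dform; congr (rip (defect S gamma _) _).
    rewrite /f scaler_sumr; apply: eq_bigr => k _.
    by rewrite [LHS]scalerA -exprD addnC.
  rewrite /binsum bop_sum; apply: eq_bigr => l _.
  by rewrite bopZ bpowZ bopZ scalerA mulrC -scalerA.
under eq_bigr do rewrite D.
rewrite exchange_big /Z mulr_sumr; apply: eq_big_nat => n /andP[_ nn0].
rewrite (@inner_rootu R H (z M) (fun p => t ^+ p) M (defect S gamma) L n m
  (fun k => (nbin gamma k)%:C *: bpow S k x) (fun l => (nbin a l)%:C *: bpow S l (E (g n)))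
  (@orth M))//; last first.
  by apply: leq_trans Lnm; rewrite leq_add2l ltnW.
congr (_ * _); apply: eq_bigr => k _.
by rewrite -/(b _ _) dformZl dformZr /bkn (addnC n k); ring.
Qed.

(** The average of the arithmetic-geometric mean inequality for the defect form, at the
    values of f and of the kernel applied to h. *)
Lemma hankel_average_le (mu : R) : 0 < mu ->
  Z t <= (mu * X t + mu^-1 * (K ^+ 2 * (1 - t) `^ (- a) * G t)) / 2.
Proof.
move=> mu0.
have t0 : 0 <= t by case/andP: t01 => /ltW.
have G0 : 0 <= G t.
  by apply: sumr_ge0 => k _; rewrite mulr_ge0 ?sqr_ge0 ?exprn_ge0.
apply/ler_addgt0Pl => e e0.
have d0 : 0 < e * mu * 2 / (G t + 1) by rewrite !divr_gt0 ?mulr_gt0// ltr_wpDl.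
have [m0 hm0] := dform_kernel_binsum d0.
pose m := (maxn m0 (L + n0)).+1; pose M := m.
have M0 : 0 < M%:R :> R by rewrite ltr0n.
have m0m : (m0 <= m)%N by rewrite /m leqW// leq_maxl.
have Lnm : (L + n0 <= m)%N by rewrite /m leqW// leq_maxr.
rewrite -(ler_pM2l M0) -(hankel_average Lnm (leqnn _)).
pose k1 := K ^+ 2 * (1 - t) `^ (- a) + e * mu * 2 / (G t + 1).
apply: (@le_trans _ _ (\sum_(j < M) (mu * q (f (z M j)) + mu^-1 * (k1 * nrm (h ((z M j)^*)%R) ^+ 2)) / 2)).
  apply: ler_sum => j _; apply: le_trans (dform_AMGM S1 hS _ _ mu0) _.
  rewrite ler_pM2r// lerD2l ler_wpM2l ?invr_ge0 ?(ltW mu0)//.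
  by have := hm0 m (z M j) (h ((z M j)^*)%R) m0m; rewrite nz s2; apply; rewrite s0 s1.
rewrite -mulr_suml big_split/= -!mulr_sumr dform_average ?nrm_average//; last 2 first.
- by apply: leq_trans Lnm; rewrite leq_addl.
- by apply: leq_trans Lnm; rewrite leq_addr.
have -> : (mu * (M%:R * X t) + mu^-1 * (k1 * (M%:R * G t))) / 2 =
  M%:R * ((mu * X t + mu^-1 * (k1 * G t)) / 2) by ring.
rewrite ler_pM2l// -lerBlDr.
have -> : (mu * X t + mu^-1 * (k1 * G t)) / 2 -
  (mu * X t + mu^-1 * (K ^+ 2 * (1 - t) `^ (- a) * G t)) / 2 = e * (G t / (G t + 1)).
  by rewrite /k1; field; rewrite !gt_eqF// ltr_wpDl.
rewrite ler_piMr ?(ltW e0)// ler_pdivrMr ?ltr_wpDl// mul1r lerDl//.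
Qed.

End FixedRadius.

(** The inequality [hankel_average_le] integrated against (1 - t)^(a - 2), with
    mu = lam (1 - t)^(gamma - a). This choice distributes the weight into
    (1 - t)^(gamma - 2) and (1 - t)^(beta - 1), which are integrable because 1 < gamma
    and 0 < beta; the moments cancel the coefficients nbin a. *)
Lemma hankel_truncated_le (lam : R) : 0 < lam ->
  (a - 1)^-1 * \sum_(0 <= n < n0) \sum_(0 <= k < L) nbin gamma k * bkn k n <=
  (lam / (gamma - 1) * \sum_(0 <= k < L) nbin gamma k * q (bpow S k x) +
   lam^-1 * K ^+ 2 / beta * \sum_(0 <= n < n0) nrm (g n) ^+ 2 / nbin (beta + 1) n) / 2.
Proof.
move=> lam0.
have a2 : -1 < a - 2 by have := beta0; have := gamma1; rewrite /a; lra.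
have g2 : -1 < gamma - 2 by have := gamma1; lra.
have b2 : -1 < beta - 1 by have := beta0; lra.
pose c k n := nbin gamma k * nbin a (k + n) * bkn k n.
pose f1 (t : R) : R := \sum_(0 <= n < n0) \sum_(0 <= k < L) c k n * ibeta (a - 2) (k + n) t.
pose f1' (t : R) : R := \sum_(0 <= n < n0) \sum_(0 <= k < L) c k n * (t ^+ (k + n) * (1 - t) `^ (a - 2)).
pose d1 k := lam / 2 * (nbin gamma k ^+ 2 * q (bpow S k x)).
pose d2 n := lam^-1 * K ^+ 2 / 2 * nrm (g n) ^+ 2.
pose g1 (t : R) : R := \sum_(0 <= k < L) d1 k * ibeta (gamma - 2) k t +
             \sum_(0 <= n < n0) d2 n * ibeta (beta - 1) n t.
pose g1' (t : R) : R := \sum_(0 <= k < L) d1 k * (t ^+ k * (1 - t) `^ (gamma - 2)) +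
              \sum_(0 <= n < n0) d2 n * (t ^+ n * (1 - t) `^ (beta - 1)).
have df (t : R) : t < 1 -> is_derive t 1 f1 (f1' t).
  move=> t1; apply: is_derive1_sum => n; apply: is_derive1_sum => k; apply: is_derive1Z.
  exact: is_derive_ibeta.
have dg (t : R) : t < 1 -> is_derive t 1 g1 (g1' t).
  move=> t1; apply: is_derive1D; apply: is_derive1_sum => k; apply: is_derive1Z; exact: is_derive_ibeta.
have le' (t : R) : 0 < t < 1 -> f1' t <= g1' t.
  move=> t01; have /andP[t0 t1] := t01.
  have u0 : 0 < 1 - t by rewrite subr_gt0.
  pose w (p : R) := (1 - t) `^ p.
  have wp p : 0 < w p by exact: powR_gt0.
  have wD p p' : w p * w p' = w (p + p').
    by rewrite /w [in RHS]powRD// (gt_eqF u0) implybT.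
  have wV p : (w p)^-1 = w (- p) by rewrite /w powRN.
  have mu0 : 0 < lam * w (gamma - a) by rewrite mulr_gt0.
  have := hankel_average_le t01 mu0.
  rewrite -(ler_pM2l (wp (a - 2))) => hZ.
  have -> : f1' t = w (a - 2) * Z t.
    rewrite /f1' /Z mulr_sumr; apply: eq_bigr => n _.
    rewrite mulr_sumr; apply: eq_bigr => k _.
    by rewrite /c -/(w _); ring.
  apply: le_trans hZ _.
  have -> : g1' t = lam / 2 * w (gamma - 2) * X t + lam^-1 * K ^+ 2 / 2 * w (beta - 1) * G t.
    rewrite /g1' /X /G !mulr_sumr; congr (_ + _); apply: eq_bigr => k _.
      by rewrite /d1 -/(w _); ring.
    by rewrite /d2 -/(w _); ring.
  have e1 : w (gamma - 2) = w (a - 2) * w (gamma - a) by rewrite wD; congr w; ring.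
  have e2 : w (beta - 1) = w (a - 2) * w (- (gamma - a)) * w (- a).
    by rewrite !wD; congr w; rewrite /a; ring.
  rewrite e1 e2 -/(w (- a)) invfM wV.
  by rewrite le_eqVlt; apply/orP; left; apply/eqP; ring.
have f10 : f1 0 = 0.
  by rewrite /f1 big1// => n _; rewrite big1// => k _; rewrite ibeta0 mulr0.
have g10 : g1 0 = 0.
  by rewrite /g1 !big1 ?addr0// => k _; rewrite ibeta0 mulr0.
have cf : f1 t @[t --> 1^'-] --> f1 1.
  apply: cvg_sum_seq => n; apply: cvg_sum_seq => k.
  by apply: cvgM; [exact: cvg_cst|exact: ibeta_cvg1].
have cg : g1 t @[t --> 1^'-] --> g1 1.
  apply: cvgD; apply: cvg_sum_seq => k.
    by apply: cvgM; [exact: cvg_cst|exact: ibeta_cvg1].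
  by apply: cvgM; [exact: cvg_cst|exact: ibeta_cvg1].
have := le_of_is_derive1 df dg le' f10 g10 cf cg.
have a1 : 0 < a by rewrite /a !addr_gt0.
have am1 : a - 1 != 0 by rewrite gt_eqF//; have := beta0; have := gamma1; rewrite /a; lra.
have gm1 : gamma - 1 != 0 by rewrite gt_eqF// subr_gt0.
have -> : f1 1 = (a - 1)^-1 * \sum_(0 <= n < n0) \sum_(0 <= k < L) nbin gamma k * bkn k n.
  rewrite /f1 mulr_sumr; apply: eq_bigr => n _.
  rewrite mulr_sumr; apply: eq_bigr => k _.
  rewrite ibeta1// subrK (_ : a - 2 + 1 = a - 1); last by ring.
  have n1 : nbin a (k + n) != 0 by rewrite gt_eqF// nbin_gt0.
  by rewrite /c; field; rewrite am1 n1.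
have -> : g1 1 = (lam / (gamma - 1) * \sum_(0 <= k < L) nbin gamma k * q (bpow S k x) +
   lam^-1 * K ^+ 2 / beta * \sum_(0 <= n < n0) nrm (g n) ^+ 2 / nbin (beta + 1) n) / 2.
  rewrite /g1 mulrDl -!mulrA !mulr_suml !mulr_sumr; congr (_ + _); apply: eq_bigr => k _.
    rewrite ibeta1// subrK (_ : gamma - 2 + 1 = gamma - 1); last by ring.
    have n1 : nbin gamma k != 0 by rewrite gt_eqF// nbin_gt0.
    by rewrite /d1; field; rewrite gm1 n1.
  rewrite ibeta1// subrK (_ : beta - 1 + 2 = beta + 1); last by ring.
  have n1 : nbin (beta + 1) k != 0 by rewrite gt_eqF// nbin_gt0// addr_gt0.
  by rewrite /d2; field; rewrite n1 !gt_eqF.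
by [].
Qed.

End Hankel.

Section HankelLimit.
Variable R : realType.
Variables H Y : hilbertType R.
Variables (S : bop H H) (E : bop Y H) (beta gamma K : R).
Hypothesis S1 : nrm S < 1.
Hypothesis beta0 : 0 < beta.
Hypothesis gamma1 : 1 < gamma.
Hypothesis hS : positive_op (opow (bid (bop H H) - Mop S) gamma (bid H)).
Hypothesis K0 : 0 <= K.
Hypothesis hK : forall (z : R[i]) y, nrm z < 1 ->
  nrm (binseries (beta + 1) (z *: S) (E y)) <= K * (1 - nrm z ^+ 2) `^ (- ((1 + beta) / 2)) * nrm y.

Let gamma0 : 0 < gamma. Proof. exact: lt_trans gamma1. Qed.

(** The sums over k tend to <x, S^n E g_n> as L grows, by [defect_sum]. *)
Lemma hankel_le (x : H) (g : nat -> Y) (n0 : nat) (lam : R) : 0 < lam ->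
  (gamma + beta)^-1 * \sum_(0 <= n < n0) rip x (bpow S n (E (g n))) <=
  (lam / (gamma - 1) * nrm x ^+ 2 +
   lam^-1 * K ^+ 2 / beta * \sum_(0 <= n < n0) nrm (g n) ^+ 2 / nbin (beta + 1) n) / 2.
Proof.
move=> lam0; set Q := _ / 2.
have gb : 0 < gamma + beta by rewrite addr_gt0.
apply/ler_addgt0Pl => e e0.
pose N := \sum_(0 <= n < n0) nrm x * nrm (bpow S n (E (g n))).
have N0 : 0 <= N by apply: sumr_ge0 => n _; rewrite mulr_ge0 ?nrm_ge0.
have N1 : 0 < N + 1 by rewrite ltr_wpDl.
have d0 : 0 < e * (gamma + beta) / (N + 1) by rewrite divr_gt0// mulr_gt0.
have [L hL] := @defect_sum R H S gamma S1 _ d0.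
have hp := @hankel_truncated_le R H Y S E beta gamma K S1 beta0 gamma1 hS K0 hK x g L n0 lam lam0.
have {}hp : (gamma + beta)^-1 * \sum_(0 <= n < n0) \sum_(0 <= k < L)
    nbin gamma k * dform S gamma (bpow S k x) (bpow S k (bpow S n (E (g n)))) <= Q.
  move: hp; rewrite (_ : gamma + (beta + 1) - 1 = gamma + beta); last by ring.
  have -> : \sum_(0 <= n < n0) \sum_(0 <= k < L)
      nbin gamma k * dform S gamma (bpow S k x) (bpow S (n + k) (E (g n))) =
    \sum_(0 <= n < n0) \sum_(0 <= k < L)
    nbin gamma k * dform S gamma (bpow S k x) (bpow S k (bpow S n (E (g n)))).
    apply: eq_bigr => n _; apply: eq_bigr => k _.
    by rewrite addnC bpowD.
  move=> hp; apply: le_trans hp _; rewrite /Q ler_pM2r//; apply: lerD => //.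
  rewrite ler_wpM2l ?divr_ge0 ?(ltW lam0) ?subr_ge0 ?(ltW gamma1)//.
  exact: (defect_sum_le S1 gamma0 hS).
have close : \sum_(0 <= n < n0) rip x (bpow S n (E (g n))) <=
   \sum_(0 <= n < n0) \sum_(0 <= k < L)
    nbin gamma k * dform S gamma (bpow S k x) (bpow S k (bpow S n (E (g n)))) +
   e * (gamma + beta) / (N + 1) * N.
  rewrite [in leRHS]mulr_sumr -big_split/=; apply: ler_sum => n _.
  rewrite -lerBlDl; apply: le_trans (hL L x (bpow S n (E (g n))) (leqnn _)).
  by rewrite -normrN opprB ler_norm.
apply: le_trans (ler_wpM2l (_ : 0 <= (gamma + beta)^-1) close) _.
  by rewrite invr_ge0 ltW.
rewrite mulrDr addrC; apply: lerD => //.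
have -> : (gamma + beta)^-1 * (e * (gamma + beta) / (N + 1) * N) = e * (N / (N + 1)).
  by field; rewrite !gt_eqF.
by rewrite ler_piMr ?(ltW e0)// ler_pdivrMr// mul1r lerDl.
Qed.

(** Duality: the sequence g n = nbin (beta + 1) n F T^n x, up to powers of r, makes the
    left-hand side of [hankel_le] a multiple of its last sum, and lam is chosen so that
    this sum absorbs at most half of it. *)
Lemma weighted_sum_bound (x : H) (n0 : nat) :
  \sum_(0 <= n < n0) nbin (beta + 1) n * nrm (adjoint E (bpow (adjoint S) n x)) ^+ 2 <=
  (gamma + beta) ^+ 2 * (K ^+ 2 + 1) / beta / (gamma - 1) * nrm x ^+ 2.
Proof.
pose G n := adjoint E (bpow (adjoint S) n x).
pose W := \sum_(0 <= n < n0) nbin (beta + 1) n * nrm (G n) ^+ 2.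
have gb : 0 < gamma + beta by rewrite addr_gt0.
have K1 : 0 < K ^+ 2 + 1 by rewrite ltr_wpDl ?sqr_ge0.
pose lam := (gamma + beta) * (K ^+ 2 + 1) / beta.
have lam0 : 0 < lam by rewrite divr_gt0// mulr_gt0.
have b1 : 0 < beta + 1 by rewrite addr_gt0.
have W0 : 0 <= W.
  by apply: sumr_ge0 => n _; rewrite mulr_ge0 ?sqr_ge0// nbin_ge0// ltW.
have := hankel_le x (fun n => (nbin (beta + 1) n)%:C *: G n) n0 lam0.
have -> : \sum_(0 <= n < n0) rip x (bpow S n (E ((nbin (beta + 1) n)%:C *: G n))) = W.
  apply: eq_bigr => n _.
  by rewrite ripC !adjoint_rip adjoint_bpow ripC ripZr ripxx.
have -> : \sum_(0 <= n < n0) nrm ((nbin (beta + 1) n)%:C *: G n) ^+ 2 / nbin (beta + 1) n = W.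
  apply: eq_bigr => n _; have p0 := nbin_gt0 n b1.
  rewrite nrmZ nrmR gtr0_norm// exprMn; field; rewrite gt_eqF//.
rewrite -/W => h.
have h2 : lam^-1 * K ^+ 2 / beta * W <= (gamma + beta)^-1 * W.
  rewrite ler_wpM2r// /lam !invfM invrK.
  have -> : (gamma + beta)^-1 * (K ^+ 2 + 1)^-1 * beta * K ^+ 2 / beta =
     (gamma + beta)^-1 * (K ^+ 2 / (K ^+ 2 + 1)) by field; rewrite !gt_eqF.
  by rewrite ler_piMr ?invr_ge0 ?(ltW gb)// ler_pdivrMr// mul1r lerDl.
have h3 : (gamma + beta)^-1 * W <= lam / (gamma - 1) * nrm x ^+ 2.
  move: h h2; move: (_ * W) (_ * W) (_ * nrm x ^+ 2) => A B C; lra.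
move: h3; rewrite mulrC ler_pdivrMr// => h3; apply: le_trans h3 _.
by rewrite le_eqVlt; apply/orP; left; apply/eqP; rewrite /lam; ring.
Qed.

End HankelLimit.

(** * Admissibility and resolvent bounds *)

Section Equivalence.
Variable R : realType.
Variables H Y : hilbertType R.
Variables (beta : R) (F : bop H Y) (T : bop H H).
Hypothesis beta0 : 0 < beta.
Hypothesis T1 : nrm T <= 1.

Let b1 : 0 < beta + 1. Proof. by rewrite addr_gt0. Qed.

(** The supremum condition, in terms of w = conj z. *)
Definition resolvent_bound (K : R) := forall w : R[i], nrm w < 1 ->
  nrm (bcomp F (binseries (beta + 1) (w *: T))) <= K * (1 - nrm w ^+ 2) `^ (- ((1 + beta) / 2)).

Let wT1 (w : R[i]) : nrm w < 1 -> nrm (w *: T) < 1.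
Proof.
by move=> w1; rewrite nrmZ; apply: le_lt_trans w1; rewrite ler_piMr ?nrm_ge0.
Qed.

(** The bound of [weighted_sum_bound] for S = r T' , T' the adjoint of T, does not depend
    on r < 1. *)
Lemma resolvent_bound_admissible gamma K : 1 < gamma -> 0 <= K ->
  (forall r : R, 0 < r < 1 ->
    positive_op (opow (bid (bop H H) - Mop (r%:C *: adjoint T)) gamma (bid H))) ->
  resolvent_bound K -> admissible beta F T.
Proof.
move=> gamma1 K0 hpos hK.
pose C := (gamma + beta) ^+ 2 * (K ^+ 2 + 1) / beta / (gamma - 1).
have C0 : 0 <= C.
  have g1 : 0 <= gamma - 1 by rewrite subr_ge0 ltW.
  apply: divr_ge0 => //; apply: divr_ge0; last exact: ltW.
  by rewrite mulr_ge0 ?sqr_ge0// addr_ge0 ?sqr_ge0.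
have step (r : R) x n0 : 0 < r < 1 ->
    \sum_(0 <= n < n0) nbin (beta + 1) n * (r ^+ n * nrm (F (iter n T x))) ^+ 2 <= C * nrm x ^+ 2.
  move=> r01; have /andP[r0 r1] := r01.
  pose S := r%:C *: adjoint T.
  have nS : nrm S < 1.
    rewrite /S nrmZ nrmR gtr0_norm// nrm_adjoint; apply: le_lt_trans r1.
    by rewrite ler_piMr// ltW.
  have aS : adjoint S = r%:C *: T by rewrite /S adjointZr adjointK.
  have hKS (z : R[i]) y : nrm z < 1 -> nrm (binseries (beta + 1) (z *: S) (adjoint F y)) <=
      K * (1 - nrm z ^+ 2) `^ (- ((1 + beta) / 2)) * nrm y.
    move=> z1; pose w : R[i] := (z^*)%R * r%:C.
    have nw : nrm w = nrm z * r by rewrite /w nrmM nrmR gtr0_norm// nrm_conj.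
    have w1 : nrm w < 1.
      by rewrite nw; apply: le_lt_trans z1; rewrite ler_piMr ?nrm_ge0 ?ltW.
    have -> : z *: S = adjoint (w *: T).
      by rewrite /w -scalerA -aS adjointZ adjointK conjCK.
    rewrite -adjoint_binseries ?wT1//.
    rewrite -[adjoint _ (adjoint F y)]/(bcomp (adjoint _) (adjoint F) y) -adjoint_bcomp.
    apply: le_trans (nrm_app _ _) _; rewrite nrm_adjoint ler_wpM2r ?nrm_ge0//.
    apply: le_trans (hK w w1) _; rewrite ler_wpM2l// !powRN.
    have z2 : 0 < 1 - nrm z ^+ 2 by rewrite subr_gt0 exprn_ilt1 ?nrm_ge0.
    have w2 : 0 < 1 - nrm w ^+ 2 by rewrite subr_gt0 exprn_ilt1 ?nrm_ge0.
    rewrite lef_pV2 ?posrE ?powR_gt0// ge0_ler_powR ?nnegrE ?(ltW z2) ?(ltW w2)//.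
      by rewrite divr_ge0// addr_ge0// ltW.
    rewrite lerD2l lerN2 nw ler_pXn2r ?nnegrE ?mulr_ge0 ?nrm_ge0 ?(ltW r0)//.
    by rewrite ler_piMr ?nrm_ge0 ?ltW.
  have := @weighted_sum_bound R H Y S (adjoint F) beta gamma K nS beta0 gamma1 (hpos _ r01) K0 hKS x n0.
  rewrite aS adjointK -/C; apply: le_trans.
  rewrite le_eqVlt; apply/orP; left; apply/eqP; apply: eq_bigr => n _.
  by rewrite bpowZ bopZ bpow_app linearZ/= nrmZ nrmX nrmR gtr0_norm.
have sum1 x n0 :
    \sum_(0 <= n < n0) nbin (beta + 1) n * nrm (F (iter n T x)) ^+ 2 <= C * nrm x ^+ 2.
  set W := \sum_(_ <= _ < _) _.
  have W0 : 0 <= W.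
    by apply: sumr_ge0 => n _; rewrite mulr_ge0 ?sqr_ge0// nbin_ge0// ltW.
  apply/ler_addgt0Pl => e e0.
  pose D := 2 * n0%:R * W.
  have D0 : 0 <= D by rewrite !mulr_ge0.
  have D1 : 0 < D + 1 by rewrite ltr_wpDl.
  pose d := Num.min 2^-1 (e / (D + 1)).
  have d0 : 0 < d by rewrite lt_min invr_gt0 ltr0n divr_gt0.
  have dh : d <= 2^-1 by rewrite /d ge_min lexx.
  have de : d * D <= e.
    have : d <= e / (D + 1) by rewrite /d ge_min lexx orbT.
    rewrite ler_pdivlMr// => h; apply: le_trans h.
    by rewrite ler_wpM2l ?(ltW d0)// lerDl.
  have h1 : (2^-1 : R) < 1 by rewrite invf_lt1// ltr1n.
  have r01 : 0 < 1 - d < 1.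
    by rewrite subr_gt0 (le_lt_trans dh h1) ltrBlDr ltrDl.
  (* Bernoulli's inequality: (1 - d)^(2 n0) tends to 1 as d tends to 0. *)
  have bern k : 1 - k%:R * d <= (1 - d) ^+ k.
    elim: k => [|k IH]; first by rewrite mul0r subr0.
    rewrite exprS; apply: (@le_trans _ _ ((1 - d) * (1 - k%:R * d))).
      rewrite -subr_ge0 (_ : _ - _ = k%:R * d * d); last by rewrite -natr1; ring.
      by rewrite mulr_ge0 ?(ltW d0)// mulr_ge0 ?(ltW d0).
    by rewrite ler_wpM2l//; case/andP: r01 => /ltW.
  have /andP[r0 r1] := r01.
  have := step _ x n0 r01 => h.
  have h2 : (1 - d) ^+ (n0 * 2) * W <= C * nrm x ^+ 2.
    apply: le_trans h; rewrite /W mulr_sumr; apply: ler_sum_nat => n /andP[_ nn0].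
    rewrite mulrCA exprMn ler_wpM2l ?nbin_ge0 ?(ltW b1)// ler_wpM2r ?sqr_ge0//.
    by rewrite -exprM ler_wiXn2l ?(ltW r0) ?(ltW r1)// leq_mul2r ltnW// orbT.
  have h3 : (1 - (n0 * 2)%:R * d) * W <= (1 - d) ^+ (n0 * 2) * W by rewrite ler_wpM2r.
  have := le_trans h3 h2; rewrite natrM.
  have -> : (1 - n0%:R * 2 * d) * W = W - d * D by rewrite /D; ring.
  by rewrite lerBlDl => h4; apply: le_trans h4 _; rewrite lerD2r.
pose Cb := (1 + beta) `^ beta.
have Cb0 : 0 < Cb by rewrite powR_gt0// addr_gt0.
exists (Cb * C + 1); first by rewrite ltr_wpDl// mulr_ge0// ltW.
move=> x; have nn n : (0 <= ((1 + n%:R) `^ beta * nrm (F (iter n T x)) ^+ 2)%:E)%E.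
  by rewrite lee_fin mulr_ge0 ?powR_ge0 ?sqr_ge0.
apply: lime_le; first by apply: is_cvg_nneseries => n _ _; exact: nn.
apply: nearW => n0; rewrite sumEFin lee_fin.
apply: (@le_trans _ _ (\sum_(0 <= n < n0) Cb * (nbin (beta + 1) n * nrm (F (iter n T x)) ^+ 2))).
  apply: ler_sum => n _; rewrite mulrA ler_wpM2r ?sqr_ge0//.
  apply: le_trans (_ : Cb * ((n.+1%:R + beta) / (1 + beta)) `^ beta <= _); last first.
    by rewrite ler_wpM2l ?(ltW Cb0)// nbin_lower.
  rewrite /Cb -powRM ?divr_ge0 ?addr_ge0 ?(ltW beta0)//.
  rewrite mulrC divfK ?gt_eqF ?addr_gt0//.
  rewrite ge0_ler_powR ?nnegrE ?addr_ge0 ?(ltW beta0)//.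
  by rewrite -natr1 [1 + _]addrC lerDl ltW.
rewrite -mulr_sumr mulrDl mul1r; apply: le_trans (_ : Cb * (C * nrm x ^+ 2) <= _).
  by rewrite ler_wpM2l ?(ltW Cb0).
by rewrite mulrA lerDl sqr_ge0.
Qed.

(** The n-th coefficient of (1 - w T)^(- beta - 1) is at most of order (1 + n)^beta, so
    that Cauchy-Schwarz leaves the sum of nbin (beta + 1) n |w|^(2n), of order
    (1 - |w|^2)^(- beta - 1). *)
Lemma admissible_resolvent_bound : admissible beta F T -> exists K, resolvent_bound K.
Proof.
case=> M M0 hM.
have psumM x n0 : \sum_(0 <= n < n0) (1 + n%:R) `^ beta * nrm (F (iter n T x)) ^+ 2 <= M * nrm x ^+ 2.
  rewrite -lee_fin -sumEFin; apply: le_trans (hM x).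
  by apply: nneseries_lim_ge => n _ _; rewrite lee_fin mulr_ge0 ?powR_ge0 ?sqr_ge0.
exists ((1 + beta + M) / 2) => w w1.
have u0 : 0 < 1 - nrm w ^+ 2 by rewrite subr_gt0 exprn_ilt1 ?nrm_ge0.
pose p := (1 - nrm w ^+ 2) `^ ((1 + beta) / 2).
have p0 : 0 < p by rewrite powR_gt0.
have KM : 0 <= (1 + beta + M) / 2 by rewrite divr_ge0// !addr_ge0 ?(ltW beta0) ?(ltW M0).
rewrite powRN -/p [leLHS]nrm_bop; apply: opnorm_le => [|x].
  by rewrite divr_ge0// ltW.
have [->|x0] := eqVneq x 0; first by rewrite linear0 !nrm0 mulr0.
have nx : 0 < nrm x.
  by rewrite lt_neqAle nrm_ge0 andbT eq_sym; apply: contra x0 => /eqP/nrm0_eq0/eqP.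
have cs := nrm_cvg_bop_app x (binseriesP (@nrm_complete_complete _ H) (beta + 1) (wT1 w1)).
apply: (nrm_cvg_le (bop_nrm_cvg_app F cs) (m := 0)) => m _ /=.
rewrite /binsum bop_sum linear_sum.
apply: le_trans (nrm_sum _ _ _) _.
pose mu := p * nrm x; have mu0 : 0 < mu by rewrite mulr_gt0.
pose c n := nbin (beta + 1) n.
have c0 n : 0 < c n by exact: nbin_gt0.
pose y n := nrm (F (iter n T x)).
have y0 n : 0 <= y n by exact: nrm_ge0.
pose B n := (1 + n%:R : R) `^ beta.
have B0 n : 0 < B n by rewrite powR_gt0// ltr_wpDr.
(* The arithmetic-geometric mean stands for Cauchy-Schwarz; mu is the ratio
   that makes the two resulting terms proportional. *)
apply: (@le_trans _ _ (\sum_(0 <= n < m)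
   (mu * (1 + beta) * (c n * (nrm w ^+ 2) ^+ n) + mu^-1 * (B n * y n ^+ 2)) / 2)).
  apply: ler_sum => n _; rewrite bopZ linearZ/= bpowZ bopZ linearZ/= bpow_app !nrmZ nrmR nrmX.
  rewrite gtr0_norm// -/(c n) -/(y n) exprAC.
  move: (nrm w ^+ n) (exprn_ge0 n (nrm_ge0 w)) => v v0.
  have cB : c n <= (1 + beta) * B n by exact: nbin_upper.
  have s1 : 0 <= (mu * c n * v - B n * y n) ^+ 2 by exact: sqr_ge0.
  have mB : 0 < mu * B n by rewrite mulr_gt0.
  rewrite -subr_ge0.
  have -> : (mu * (1 + beta) * (c n * v ^+ 2) + mu^-1 * (B n * y n ^+ 2)) / 2 - c n * (v * y n) =
    ((mu * c n * v - B n * y n) ^+ 2 / (mu * B n) +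
      mu * c n * v ^+ 2 / B n * ((1 + beta) * B n - c n)) / 2.
    by field; rewrite !gt_eqF.
  rewrite divr_ge0// addr_ge0//; first by rewrite divr_ge0// ltW.
  rewrite mulr_ge0 ?subr_ge0// divr_ge0 ?(ltW (B0 n))// !mulr_ge0 ?sqr_ge0// ltW//.
rewrite -mulr_suml big_split/= -!mulr_sumr.
have h1 : \sum_(0 <= n < m) c n * (nrm w ^+ 2) ^+ n <= (p ^+ 2)^-1.
  rewrite big_mkord /p -(powR_mulrn 2 (powR_ge0 _ _)) -powRrM -powRN.
  have -> : - ((1 + beta) / 2 * 2) = - (beta + 1) by field.
  by apply: nbin_psum_le; [exact: ltW|rewrite sqr_ge0 exprn_ilt1 ?nrm_ge0].
have h2 : \sum_(0 <= n < m) B n * y n ^+ 2 <= M * nrm x ^+ 2 by exact: psumM.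
have b0 : 0 <= mu * (1 + beta) by rewrite mulr_ge0 ?addr_ge0 ?(ltW mu0) ?(ltW beta0).
apply: le_trans (_ : (mu * (1 + beta) * (p ^+ 2)^-1 + mu^-1 * (M * nrm x ^+ 2)) / 2 <= _).
  by rewrite ler_pM2r//; apply: lerD; rewrite ler_wpM2l ?invr_ge0 ?(ltW mu0).
by rewrite le_eqVlt; apply/orP; left; apply/eqP; rewrite /mu; field; rewrite !gt_eqF.
Qed.

End Equivalence.

Theorem theorem3p3 (R : realType) (beta : R) (beta_gt0 : 0 < beta)
    (H Y : hilbertType R) (T : bop H H)
    (hT : exists2 gamma : R, 1 < gamma & hypercontraction gamma (adjoint T))
    (F : bop H Y) :
  admissible beta F T <->
  (ereal_sup
     [set ((1 - nrm z ^+ 2) `^ ((1 + beta) / 2)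
           * nrm (bcomp F (opow (bid H - z^* *: T) (- beta - 1))))%R%:E
     | z in [set z : R[i] | (nrm z < 1)%R]] < +oo)%E.
Proof.
have [gamma gamma1 [nT hpos]] := hT.
have T1 : nrm T <= 1 by rewrite -nrm_adjoint.
have nc (z : R[i]) : nrm z^* = nrm z by exact: nrm_conj.
have opowE (z : R[i]) : nrm z < 1 ->
    opow (bid H - z^* *: T) (- beta - 1) = binseries (beta + 1) (z^* *: T).
  move=> z1; have <- : - (- beta - 1) = beta + 1 by ring.
  apply: opow_binseries_hilbert.
  by rewrite nrmZ nc; apply: le_lt_trans z1; rewrite ler_piMr ?nrm_ge0.
have pz (z : R[i]) : nrm z < 1 -> 0 < (1 - nrm z ^+ 2) `^ ((1 + beta) / 2).
  by move=> z1; rewrite powR_gt0// subr_gt0 exprn_ilt1 ?nrm_ge0.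
split.
- move=> /(admissible_resolvent_bound beta_gt0 T1) [K hK].
  apply: (@le_lt_trans _ _ K%:E); last exact: ltry.
  apply: ge_ereal_sup => _ [z /= z1 <-]; rewrite lee_fin opowE//.
  have := hK z^*; rewrite nc => /(_ z1); rewrite powRN => h.
  by rewrite mulrC -ler_pdivlMr// pz.
- move=> hsup; set A := [set _ | _ in _] in hsup.
  have [K K0 hK] : exists2 K : R, 0 <= K & forall y, A y -> (y <= K%:E)%E.
    exists (fine (Order.max (ereal_sup A) 0)%E).
      by rewrite fine_ge0// le_max lexx orbT.
    move=> y Ay; rewrite fineK; last first.
      by rewrite ge0_fin_numE ?le_max ?lexx ?orbT// gt_max hsup ltry.
    by rewrite le_max ereal_sup_ubound.
  apply: (resolvent_bound_admissible beta_gt0 T1 gamma1 K0 hpos) => w w1.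
  pose v : R[i] := w^*.
  have vw : v^* *: T = w *: T.
    by rewrite /v; case: w {w1 v} => p q; congr (_ *: _); apply: complex_ext; rewrite //= opprK.
  have nv : nrm v = nrm w by exact: nc.
  have v1 : nrm v < 1 by rewrite nv.
  have := hK _ (ex_intro2 _ _ v v1 erefl).
  rewrite lee_fin opowE// vw nv powRN.
  by rewrite mulrC -ler_pdivlMr// pz.
Qed.
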